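(* Let $\Lambda=KQ/I$ be a path algebra modulo relations and $e$ the sum of the primitive idempotents corresponding to the precyclic vertices of $Q$. Moreover, let $e'$ be the sum of those primitive idempotents which correspond to the critical vertices. Suppose that all indecomposable projective left $e\Lambda e$-modules have the same Loewy length, and that all indecomposable injective left $e'\Lambda e'$-modules have the same Loewy length. Then $\Lambda\text{-mod}$ allows for unlimited iteration of strong tilting, thus giving rise to a sequence of related module categories $\Lambda\text{-mod}\rightsquigarrow\text{mod-}\widetilde{\Lambda}\rightsquigarrow\widetilde{\widetilde{\Lambda}}\text{-mod}\rightsquigarrow\cdots$. Starting with the first strong tilt, $\text{mod-}\widetilde{\Lambda}$, the Morita equivalence classes of these categories repeat periodically with period $2$.
   Context: A path algebra modulo relations is $\Lambda=KQ/I$ with $K$ a field, $Q$ a finite quiver and $I$ an admissible ideal of $KQ$ (so $\Lambda$ is a basic finite dimensional algebra). Paths are composed from right to left, so that $\Lambda e_i$ is spanned by the paths starting in the vertex $e_i$; vertices are identified with primitive idempotents of $\Lambda$. A vertex $e_i$ is precyclic if there is a path of length $\ge0$ which starts in $e_i$ and ends on an oriented cycle; it is postcyclic if there is a path of length $\ge0$ which starts on an oriented cycle and ends in $e_i$; it is critical if it is both precyclic and postcyclic. For an Artin algebra $A$, $A\text{-mod}$ (resp. $\text{mod-}A$) is the category of finitely generated left (resp. right) $A$-modules, and $\mathcal{P}^{<\infty}(A\text{-mod})$ (resp. $\mathcal{P}^{<\infty}(\text{mod-}A)$) its full subcategory of modules of finite projective dimension. A module is basic if it has no indecomposable direct summand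 of multiplicity $>1$. $T\in A\text{-mod}$ is a tilting module if (1) $T\in\mathcal{P}^{<\infty}(A\text{-mod})$, (2) $\operatorname{Ext}^i_A(T,T)=0$ for $i\ge1$, (3) there is an exact sequence $0\to A\to T_0\to\cdots\to T_s\to0$ with all $T_j\in\operatorname{add}(T)$. It is strong if, in addition, $\operatorname{Ext}^i_A(M,T)=0$ for all $M\in\mathcal{P}^{<\infty}(A\text{-mod})$ and $i\ge1$. Similarly for right modules. If $A\text{-mod}$ has a strong tilting module, the basic one is unique up to isomorphism. For basic Artin algebras $A,B$: $\text{mod-}B$ results from $A\text{-mod}$ via strong tilting if $A\text{-mod}$ has a basic strong tilting module $T$ and $B\cong\operatorname{End}_A(T)^{\mathrm{op}}$ (written $B=\widetilde{A}$); $B\text{-mod}$ results from $\text{mod-}A$ via strong tilting if $\text{mod-}A$ has a basic strong tilting module $T$ and $B\cong\operatorname{End}_A(T)$ (again written $\widetilde{A}$). The category $\Lambda\text{-mod}$ allows for unlimited iteration of strong tilting if there is an infinite sequence of basic algebras $(\Lambda_i)_{i\ge0}$ with $\Lambda_0=\Lambda$ such that $\text{mod-}\Lambda_{i+1}$ results from $\Lambda_i\text{-mod}$ via strong tilting for $i$ even, and $\Lambda_{i+1}\text{-mod}$ results from $\text{mod-}\Lambda_i$ via strong tilting for $i$ odd; periodicity with period $2$ from the first tilt on means that $\Lambda_i$ and $\Lambda_{i+2}$ are Morita equivalent for all $i\ge1$. *)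

(* Defs.v *)
From HB Require Import structures.
From mathcomp Require Import all_boot all_order all_algebra.
From mathcomp Require Import generic_quotient finmap.
From mathcomp.multinomials Require Import monalg.
From mathcomp.classical Require Import boolp.

Set Implicit Arguments.
Unset Strict Implicit.
Unset Printing Implicit Defensive.

Import GRing.Theory.
Local Open Scope ring_scope.

(* Quivers are nonempty, since the algebras of type [algType K] are nonzero. *)
Record quiver := Quiver {
  vertex : finType;
  arrow : finType;
  source : arrow -> vertex;
  target : arrow -> vertex;
  vertex_gt0 : (0 < #|vertex|)%N }.

Section Paths.
Variable Q : quiver.

Fixpoint walk (v : vertex Q) (s : seq (arrow Q)) : bool :=
  if s is a :: s' then (source a == v) && walk (target a) s' else true.

(* [pword p] is the starting vertex of [p] with the arrows of [p], listed in
   the order in which they are traversed; the usual right-to-left notation for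
   the path is the reverse of this list.  Paths of length 0 are allowed. *)
Record qpath := QPath {
  pword : vertex Q * seq (arrow Q);
  _ : walk pword.1 pword.2 }.

HB.instance Definition _ := [isSub for pword].
HB.instance Definition _ := [Choice of qpath by <:].

Definition pstart (p : qpath) : vertex Q := (pword p).1.
Definition ptrail (p : qpath) : seq (arrow Q) := (pword p).2.
Definition plength (p : qpath) : nat := size (ptrail p).
Definition pvertices (p : qpath) : seq (vertex Q) :=
  pstart p :: map (@target Q) (ptrail p).
Definition pend (p : qpath) : vertex Q :=
  last (pstart p) (map (@target Q) (ptrail p)).

Definition ptriv (v : vertex Q) : qpath := @QPath (v, [::]) isT.

(* The composite "p after q". *)
Definition pcomp (p q : qpath) : option qpath :=
  if pend q == pstart p then insub (pstart q, ptrail q ++ ptrail p) else None.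

Definition oriented_cycle (c : qpath) : Prop :=
  (0 < plength c)%N /\ pend c = pstart c.

Definition precyclic (v : vertex Q) : Prop :=
  exists p c : qpath,
    [/\ pstart p = v, oriented_cycle c & pend p \in pvertices c].
Definition postcyclic (v : vertex Q) : Prop :=
  exists p c : qpath,
    [/\ oriented_cycle c, pstart p \in pvertices c & pend p = v].
Definition critical (v : vertex Q) : Prop := precyclic v /\ postcyclic v.

Lemma walk_cat v s1 s2 :
  walk v (s1 ++ s2) = walk v s1 && walk (last v (map (@target Q) s1)) s2.
Proof. by elim: s1 v => //= a s1 IH v; rewrite IH andbA. Qed.

Lemma pwalk p : walk (pstart p) (ptrail p).
Proof. by case: p. Qed.

Lemma pcompP p q : pend q = pstart p ->
  exists2 r, pcomp p q = Some r & pword r = (pstart q, ptrail q ++ ptrail p).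
Proof.
move=> e; have w : walk (pstart q) (ptrail q ++ ptrail p).
  by rewrite walk_cat pwalk -/(pend q) e pwalk.
by exists (QPath (w : walk (_, _).1 (_, _).2)); rewrite // /pcomp e eqxx insubT.
Qed.

Lemma pcompN p q : pend q != pstart p -> pcomp p q = None.
Proof. by rewrite /pcomp => /negbTE ->. Qed.

Lemma pcomp_endpoints p q r :
  pcomp p q = Some r -> pend r = pend p /\ pstart r = pstart q.
Proof.
case: (pend q =P pstart p) => [e|/eqP/pcompN -> //].
have [r' -> Er [<-]] := pcompP e; rewrite /pend /pstart /ptrail Er /=; split=> //.
by rewrite map_cat last_cat -/(pend q) e.
Qed.

Lemma pcompA p q r :
  obind (pcomp p) (pcomp q r) = obind (pcomp^~ r) (pcomp p q).
Proof.
case: (pend r =P pstart q) => [e1|/eqP n1]; last first.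
  rewrite pcompN //=; case E: (pcomp p q) => [s|] //=.
  by rewrite pcompN // (pcomp_endpoints E).2.
have [s Es Ws] := pcompP e1; have [es1 es2] := pcomp_endpoints Es.
rewrite Es /=; case: (pend q =P pstart p) => [e2|/eqP n2]; last first.
  by rewrite !pcompN ?es1.
have [t Et Wt] := pcompP e2; have [et1 et2] := pcomp_endpoints Et.
rewrite Et /=.
have [u -> Wu] := pcompP (etrans es1 e2).
have [w -> Ww] := pcompP (etrans e1 (esym et2)).
congr Some; apply: val_inj => /=; rewrite Wu Ww.
by rewrite /pstart /ptrail Ws Wt /= catA.
Qed.

Lemma pcomp_trivl v q : pcomp (ptriv v) q = if pend q == v then Some q else None.
Proof.
case: (pend q =P v) => [e|/eqP n]; last by rewrite pcompN.
have [r -> Wr] := @pcompP (ptriv v) q e; congr Some; apply: val_inj => /=.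
by rewrite Wr /= cats0 /pstart /ptrail; case: (pword q).
Qed.

Lemma pcomp_trivr p v : pcomp p (ptriv v) = if pstart p == v then Some p else None.
Proof.
rewrite [pstart p == v]eq_sym.
case: (v =P pstart p) => [e|/eqP n]; last by rewrite pcompN.
have [r -> Wr] := @pcompP p (ptriv v) e; congr Some; apply: val_inj => /=.
by rewrite Wr /= e /pstart /ptrail; case: (pword p).
Qed.

End Paths.

Lemma scale_malgU (T : choiceType) (R : nzRingType) (c d : R) (r : T) :
  << c * d *g r >> = c *: << d *g r >>.
Proof. by apply/malgP => k; rewrite mcoeffZ !mcoeffU mulrnAr. Qed.

Definition pathalg (K : fieldType) (Q : quiver) := {malg K[qpath Q]}.

HB.instance Definition _ K Q := GRing.Lmodule.on (pathalg K Q).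

Section PathAlgebra.
Variables (K : fieldType) (Q : quiver).
Local Notation KQ := (pathalg K Q).
Implicit Types (f g h : KQ) (c : K) (p q r : qpath Q).

Definition pathU (p : qpath Q) : KQ := << p >>.
Definition videm (v : vertex Q) : KQ := pathU (ptriv v).

Definition opathU c (o : option (qpath Q)) : KQ :=
  if o is Some r then << c *g r >> else 0.

Definition pathalg_mul f g : KQ :=
  \sum_(p <- msupp f) \sum_(q <- msupp g) opathU (f@_p * g@_q) (pcomp p q).

Definition pathalg_one : KQ := \sum_(v : vertex Q) videm v.

Lemma pcoeffZ c f p : (c *: f)@_p = c * f@_p.
Proof. exact: mcoeffZ. Qed.

Lemma pcoeff_supp c f : (msupp (c *: f) `<=` msupp f)%fset.
Proof. exact: msuppZ_le. Qed.

Lemma scale_pathU c d r : << c * d *g r >> = c *: (<< d *g r >> : KQ).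
Proof. exact: scale_malgU. Qed.

Lemma opathU0 o : opathU 0 o = 0.
Proof. by case: o => //= r; rewrite monalgU0. Qed.

Lemma opathUD c d o : opathU (c + d) o = opathU c o + opathU d o.
Proof. by case: o => [r|] /=; rewrite ?monalgUD ?addr0. Qed.

Lemma opathUZ c d o : opathU (c * d) o = c *: opathU d o.
Proof. by case: o => [r|] /=; [rewrite scale_pathU | rewrite scaler0]. Qed.

Lemma pathalg_mulw (d1 d2 : {fset qpath Q}) f g :
  (msupp f `<=` d1)%fset -> (msupp g `<=` d2)%fset ->
  pathalg_mul f g
    = \sum_(p <- d1) \sum_(q <- d2) opathU (f@_p * g@_q) (pcomp p q).
Proof.
move=> s1 s2; rewrite /pathalg_mul (big_fset_incl _ s1) /=; last first.
  move=> p _ pf; rewrite big1 // => q _.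
  by rewrite (mcoeff_outdom pf) mul0r opathU0.
apply: eq_bigr => p _; apply: (big_fset_incl _ s2) => q _ qg.
by rewrite (mcoeff_outdom qg) mulr0 opathU0.
Qed.

Lemma pathalg_mulDl : left_distributive pathalg_mul +%R.
Proof.
move=> f1 f2 g.
have s1 := fsubsetUl (msupp f1) (msupp f2).
have s2 := fsubsetUr (msupp f1) (msupp f2).
rewrite (pathalg_mulw (msuppD_le f1 f2) (fsubset_refl _)).
rewrite (pathalg_mulw s1 (fsubset_refl _)) (pathalg_mulw s2 (fsubset_refl _)).
rewrite -big_split; apply: eq_bigr => p _; rewrite -big_split.
by apply: eq_bigr => q _; rewrite mcoeffD mulrDl opathUD.
Qed.

Lemma pathalg_mulDr : right_distributive pathalg_mul +%R.
Proof.
move=> g f1 f2.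
have s1 := fsubsetUl (msupp f1) (msupp f2).
have s2 := fsubsetUr (msupp f1) (msupp f2).
rewrite (pathalg_mulw (fsubset_refl _) (msuppD_le f1 f2)).
rewrite (pathalg_mulw (fsubset_refl _) s1) (pathalg_mulw (fsubset_refl _) s2).
rewrite -big_split; apply: eq_bigr => p _; rewrite -big_split.
by apply: eq_bigr => q _; rewrite mcoeffD mulrDr opathUD.
Qed.

Lemma pathalg_mul0l g : pathalg_mul 0 g = 0.
Proof. by rewrite /pathalg_mul msupp0 big_seq_fset0. Qed.

Lemma pathalg_mul0r f : pathalg_mul f 0 = 0.
Proof.
by rewrite /pathalg_mul big1 // => p _; rewrite msupp0 big_seq_fset0.
Qed.

Lemma pathalg_scaleAl c f g : c *: pathalg_mul f g = pathalg_mul (c *: f) g.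
Proof.
rewrite (pathalg_mulw (pcoeff_supp c f) (fsubset_refl _)) /pathalg_mul scaler_sumr.
apply: eq_bigr => p _; rewrite scaler_sumr; apply: eq_bigr => q _.
by rewrite pcoeffZ -mulrA (opathUZ c).
Qed.

Lemma pathalg_scaleAr c f g : c *: pathalg_mul f g = pathalg_mul f (c *: g).
Proof.
rewrite (pathalg_mulw (fsubset_refl _) (pcoeff_supp c g)) /pathalg_mul scaler_sumr.
apply: eq_bigr => p _; rewrite scaler_sumr; apply: eq_bigr => q _.
by rewrite pcoeffZ mulrCA (opathUZ c).
Qed.

Lemma pathalgE f : f = \sum_(p <- msupp f) f@_p *: pathU p.
Proof.
rewrite [LHS]monalgE; apply: eq_bigr => p _.
by rewrite /pathU -scale_pathU mulr1.
Qed.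

Lemma pathalg_mulU p q : pathalg_mul (pathU p) (pathU q) = opathU 1 (pcomp p q).
Proof.
rewrite (pathalg_mulw msuppU_le msuppU_le) !big_seq_fset1.
by rewrite !mcoeffUU mulr1.
Qed.

Lemma pathalg_mulUo p (o : option (qpath Q)) :
  pathalg_mul (pathU p) (opathU 1 o) = opathU 1 (obind (pcomp p) o).
Proof. by case: o => [q|] /=; [exact: pathalg_mulU | exact: pathalg_mul0r]. Qed.

Lemma pathalg_muloU (o : option (qpath Q)) q :
  pathalg_mul (opathU 1 o) (pathU q) = opathU 1 (obind (fun p => pcomp p q) o).
Proof. by case: o => [p|] /=; [exact: pathalg_mulU | exact: pathalg_mul0l]. Qed.

Let linmap (F : KQ -> KQ) : Prop :=
  (forall f g, F (f + g) = F f + F g) /\ (forall c f, F (c *: f) = c *: F f).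

Let linmap_ext (F G : KQ -> KQ) :
  linmap F -> linmap G -> (forall p, F (pathU p) = G (pathU p)) -> F =1 G.
Proof.
move=> [FD FZ] [GD GZ] FG f.
have F0 : F 0 = 0 by have := FZ 0 0; rewrite !scale0r.
have G0 : G 0 = 0 by have := GZ 0 0; rewrite !scale0r.
rewrite (pathalgE f) (big_morph F FD F0) (big_morph G GD G0).
by apply: eq_bigr => p _; rewrite FZ GZ FG.
Qed.

Let linmap_mull g : linmap (pathalg_mul^~ g).
Proof.
by split=> [f h|c f]; [exact: pathalg_mulDl|rewrite pathalg_scaleAl].
Qed.

Let linmap_mulr g : linmap (pathalg_mul g).
Proof.
by split=> [f h|c f]; [exact: pathalg_mulDr|rewrite pathalg_scaleAr].
Qed.

Let linmap_comp F G : linmap F -> linmap G -> linmap (F \o G).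
Proof. by move=> [FD FZ] [GD GZ]; split=> * /=; rewrite ?GD ?GZ ?FD ?FZ. Qed.

Lemma pathalg_mulA : associative pathalg_mul.
Proof.
move=> f g h; move: f; apply: linmap_ext.
- exact: linmap_mull.
- exact: (linmap_comp (linmap_mull h) (linmap_mull g)).
move=> p; move: g; apply: linmap_ext.
- exact: (linmap_comp (linmap_mulr _) (linmap_mull h)).
- exact: (linmap_comp (linmap_mull h) (linmap_mulr _)).
move=> q; move: h; apply: linmap_ext.
- exact: (linmap_comp (linmap_mulr _) (linmap_mulr _)).
- exact: linmap_mulr.
move=> r.
apply: (etrans (congr1 (pathalg_mul (pathU p)) (pathalg_mulU q r))).
apply/esym/(etrans (congr1 (pathalg_mul^~ (pathU r)) (pathalg_mulU p q))).
by rewrite pathalg_mulUo pathalg_muloU pcompA.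
Qed.

Lemma pathalg_mul1l : left_id pathalg_one pathalg_mul.
Proof.
apply: linmap_ext; [exact: linmap_mulr|by split|move=> p].
rewrite (big_morph (pathalg_mul^~ _) (fun f g => pathalg_mulDl f g _)
  (pathalg_mul0l _)).
rewrite (bigD1 (pend p)) //= big1 ?addr0 => [|v nv].
  by rewrite pathalg_mulU pcomp_trivl eqxx.
by rewrite pathalg_mulU pcomp_trivl eq_sym (negbTE nv).
Qed.

Lemma pathalg_mul1r : right_id pathalg_one pathalg_mul.
Proof.
apply: linmap_ext; [exact: linmap_mull|by split|move=> p].
rewrite (big_morph (pathalg_mul _) (pathalg_mulDr _) (pathalg_mul0r _)).
rewrite (bigD1 (pstart p)) //= big1 ?addr0 => [|v nv].
  by rewrite pathalg_mulU pcomp_trivr eqxx.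
by rewrite pathalg_mulU pcomp_trivr eq_sym (negbTE nv).
Qed.

Lemma pathalg_one_neq0 : pathalg_one != 0.
Proof.
have /card_gt0P [v _] := vertex_gt0 Q.
apply/eqP => /malgP /(_ (ptriv v)) /eqP; rewrite /pathalg_one raddf_sum /=.
rewrite (bigD1 v) //= big1 ?addr0 => [|w nw].
  by rewrite mcoeffUU mcoeff0 oner_eq0.
rewrite mcoeffU; case: eqP => // /(congr1 (@pstart Q)) /= e.
by rewrite (e : w = v) eqxx in nw.
Qed.

HB.instance Definition _ := GRing.Zmodule_isNzRing.Build KQ
  pathalg_mulA pathalg_mul1l pathalg_mul1r pathalg_mulDl pathalg_mulDr
  pathalg_one_neq0.
HB.instance Definition _ := GRing.Lmodule_isLalgebra.Build K KQ pathalg_scaleAl.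
HB.instance Definition _ := GRing.Lalgebra_isAlgebra.Build K KQ pathalg_scaleAr.

Lemma videm_mul v w : videm v * videm w = if v == w then videm v else 0.
Proof.
rewrite [LHS]pathalg_mulU pcomp_trivl /= eq_sym.
by case: (v =P w) => [->|].
Qed.

End PathAlgebra.

(* Containing all paths of length at least [m] is containing the [m]-th power
   of the arrow ideal; having no path of length less than 2 in the support of
   an element is being contained in the square of the arrow ideal. *)
Record admissible_ideal (K : fieldType) (Q : quiver) := AdmissibleIdeal {
  aideal :> {pred pathalg K Q};
  aideal_zmod_closed : zmod_closed aideal;
  aideal_mull : forall a x, x \in aideal -> a * x \in aideal;
  aideal_mulr : forall a x, x \in aideal -> x * a \in aideal;
  aideal_ge2 :
    forall x p, x \in aideal -> p \in msupp x -> (2 <= plength p)%N;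
  aideal_nilpotent :
    exists m, forall p, (m <= plength p)%N -> pathU K p \in aideal }.

HB.instance Definition _ K Q (I : admissible_ideal K Q) :=
  GRing.isZmodClosed.Build (pathalg K Q) (aideal I) (aideal_zmod_closed I).

Definition pathquot K Q (I : admissible_ideal K Q) : Type :=
  {ideal_quot (aideal I : zmodClosed (pathalg K Q))}.

Section PathQuotient.
Variables (K : fieldType) (Q : quiver) (I : admissible_ideal K Q).
Local Notation KQ := (pathalg K Q).
Local Notation L := (pathquot I).
Local Notation LQ := {ideal_quot (aideal I : zmodClosed (pathalg K Q))}.
Local Open Scope quotient_scope.

HB.instance Definition _ := GRing.Zmodule.on L.

Definition to_quot (f : KQ) : L := \pi_(LQ) f.
Definition of_quot (x : L) : KQ := repr (x : LQ).

Lemma of_quotK : cancel of_quot to_quot.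
Proof. by move=> x; rewrite /to_quot /of_quot reprK. Qed.

Lemma to_quot_eq f g : (to_quot f == to_quot g) = (f - g \in I).
Proof. by rewrite Quotient.idealrBE. Qed.

Lemma to_quotD f g : to_quot (f + g) = to_quot f + to_quot g.
Proof. exact: (@Quotient.pi_add KQ (aideal I) f g). Qed.

Lemma to_quot0 : to_quot 0 = 0.
Proof. by apply: (@addIr L (to_quot 0)); rewrite -to_quotD !add0r. Qed.

Lemma of_to_quot f : of_quot (to_quot f) - f \in I.
Proof. by rewrite -to_quot_eq of_quotK. Qed.

Definition quot_mul (x y : L) : L := to_quot (of_quot x * of_quot y).
Definition quot_scale (c : K) (x : L) : L := to_quot (c *: of_quot x).
Definition quot_one : L := to_quot 1.

Lemma to_quotM f g : to_quot (f * g) = quot_mul (to_quot f) (to_quot g).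
Proof.
apply/esym/eqP; rewrite to_quot_eq.
set f' := of_quot _; set g' := of_quot _.
have -> : f' * g' - f * g = f' * (g' - g) + (f' - f) * g.
  by rewrite mulrBr mulrBl addrA subrK.
apply: rpredD.
  exact: (aideal_mull f' (of_to_quot g)).
exact: (aideal_mulr g (of_to_quot f)).
Qed.

Lemma to_quotZ c f : to_quot (c *: f) = quot_scale c (to_quot f).
Proof.
apply/esym/eqP; rewrite to_quot_eq -scalerBr.
by have := aideal_mull c%:A (of_to_quot f); rewrite -scalerAl mul1r.
Qed.

Lemma quot_mulA : associative quot_mul.
Proof.
by move=> x y z; rewrite -[x]of_quotK -[y]of_quotK -[z]of_quotK -!to_quotM mulrA.
Qed.

Lemma quot_mul1l : left_id quot_one quot_mul.
Proof. by move=> x; rewrite -[x]of_quotK -to_quotM mul1r. Qed.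

Lemma quot_mul1r : right_id quot_one quot_mul.
Proof. by move=> x; rewrite -[x]of_quotK -to_quotM mulr1. Qed.

Lemma quot_mulDl : left_distributive quot_mul +%R.
Proof.
move=> x y z; rewrite -[x]of_quotK -[y]of_quotK -[z]of_quotK.
by rewrite -to_quotD -!to_quotM -to_quotD mulrDl.
Qed.

Lemma quot_mulDr : right_distributive quot_mul +%R.
Proof.
move=> x y z; rewrite -[x]of_quotK -[y]of_quotK -[z]of_quotK.
by rewrite -to_quotD -!to_quotM -to_quotD mulrDr.
Qed.

Lemma quot_one_neq0 : quot_one != 0.
Proof.
rewrite -to_quot0 to_quot_eq subr0.
have /card_gt0P [v _] := vertex_gt0 Q; apply/negP => I1.
have /(aideal_ge2 (aideal_mull (videm K v) I1)) : ptriv v \in msupp (videm K v * 1).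
  by rewrite mulr1 /videm /pathU -mcoeff_neq0 mcoeffUU oner_eq0.
by [].
Qed.

HB.instance Definition _ := GRing.Zmodule_isNzRing.Build L
  quot_mulA quot_mul1l quot_mul1r quot_mulDl quot_mulDr quot_one_neq0.

Lemma quot_scaleA c d x : quot_scale c (quot_scale d x) = quot_scale (c * d) x.
Proof. by rewrite -[x]of_quotK -!to_quotZ scalerA. Qed.

Lemma quot_scale1 : left_id 1 quot_scale.
Proof. by move=> x; rewrite -[x]of_quotK -to_quotZ scale1r. Qed.

Lemma quot_scaleDr : right_distributive quot_scale +%R.
Proof.
move=> c x y; rewrite -[x]of_quotK -[y]of_quotK.
by rewrite -to_quotD -!to_quotZ -to_quotD scalerDr.
Qed.

Lemma quot_scaleDl x : {morph quot_scale^~ x : c d / c + d}.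
Proof.
by move=> c d; rewrite -[x]of_quotK -!to_quotZ -to_quotD scalerDl.
Qed.

HB.instance Definition _ := GRing.Zmodule_isLmodule.Build K L
  quot_scaleA quot_scale1 quot_scaleDr quot_scaleDl.

Lemma quot_scaleAl (c : K) (x y : L) : c *: (x * y) = (c *: x) * y.
Proof.
rewrite -[x]of_quotK -[y]of_quotK.
change (quot_scale c (quot_mul (to_quot (of_quot x)) (to_quot (of_quot y)))
  = quot_mul (quot_scale c (to_quot (of_quot x))) (to_quot (of_quot y))).
by rewrite -to_quotM -!to_quotZ -to_quotM scalerAl.
Qed.

HB.instance Definition _ := GRing.Lmodule_isLalgebra.Build K L quot_scaleAl.

Lemma quot_scaleAr (c : K) (x y : L) : c *: (x * y) = x * (c *: y).
Proof.
rewrite -[x]of_quotK -[y]of_quotK.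
change (quot_scale c (quot_mul (to_quot (of_quot x)) (to_quot (of_quot y)))
  = quot_mul (to_quot (of_quot x)) (quot_scale c (to_quot (of_quot y)))).
by rewrite -to_quotM -!to_quotZ -to_quotM scalerAr.
Qed.

HB.instance Definition _ := GRing.Lalgebra_isAlgebra.Build K L quot_scaleAr.

Definition qvidem (v : vertex Q) : L := to_quot (videm K v).

Lemma qvidem_mul v w : qvidem v * qvidem w = if v == w then qvidem v else 0.
Proof.
change (quot_mul (qvidem v) (qvidem w) = if v == w then qvidem v else 0).
by rewrite -to_quotM videm_mul; case: eqP => // _; rewrite to_quot0.
Qed.

Definition qvsum (P : vertex Q -> Prop) : L := \sum_(v | `[< P v >]) qvidem v.

Lemma qvsum_idem P : qvsum P * qvsum P = qvsum P.
Proof.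
rewrite /qvsum mulr_suml; apply: eq_bigr => v Pv.
rewrite mulr_sumr (bigD1 v) //= qvidem_mul eqxx big1 ?addr0 // => w /andP[_ nw].
by rewrite qvidem_mul eq_sym (negbTE nw).
Qed.

End PathQuotient.

Record idempotent (A : pzRingType) := Idempotent {
  idem_val : A;
  idemP : idem_val * idem_val = idem_val }.

Section Corner.
Variables (A : pzRingType) (idem : idempotent A).
Local Notation e := (idem_val idem).

(* As [e] is idempotent, the elements of the form [e * x * e] are those fixed
   by multiplication with [e] on both sides. *)
Definition corner_pred : {pred A} := [pred x : A | e * x * e == x].

Lemma corner_zmod_closed : zmod_closed corner_pred.
Proof.
split=> [|x y]; rewrite !inE ?mulr0 ?mul0r // => /eqP ex /eqP ey.
by rewrite mulrBr mulrBl ex ey.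
Qed.

HB.instance Definition _ :=
  GRing.isZmodClosed.Build A corner_pred corner_zmod_closed.

Record corner := Corner { corner_val : A; _ : corner_val \in corner_pred }.

HB.instance Definition _ := [isSub for corner_val].
HB.instance Definition _ := [Choice of corner by <:].
HB.instance Definition _ := [SubChoice_isSubZmodule of corner by <:].

Implicit Types x y z : corner.

Lemma corner_idl x : e * val x = val x.
Proof. by case: x => x /= /eqP ex; rewrite -{1}ex !mulrA idemP ex. Qed.

Lemma corner_idr x : val x * e = val x.
Proof. by case: x => x /= /eqP ex; rewrite -{1}ex -!mulrA idemP mulrA ex. Qed.

Lemma corner_mul_subproof x y : val x * val y \in corner_pred.
Proof. by rewrite inE mulrA corner_idl -mulrA corner_idr. Qed.

Lemma corner_one_subproof : e \in corner_pred.
Proof. by rewrite inE !idemP. Qed.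

Definition corner_mul x y : corner := Corner (corner_mul_subproof x y).
Definition corner_one : corner := Corner corner_one_subproof.

Lemma corner_mulA : associative corner_mul.
Proof. by move=> x y z; apply: val_inj; rewrite /= mulrA. Qed.

Lemma corner_mul1l : left_id corner_one corner_mul.
Proof. by move=> x; apply: val_inj; rewrite /= corner_idl. Qed.

Lemma corner_mul1r : right_id corner_one corner_mul.
Proof. by move=> x; apply: val_inj; rewrite /= corner_idr. Qed.

Lemma corner_mulDl : left_distributive corner_mul +%R.
Proof. by move=> x y z; apply: val_inj; rewrite /= mulrDl. Qed.

Lemma corner_mulDr : right_distributive corner_mul +%R.
Proof. by move=> x y z; apply: val_inj; rewrite /= mulrDr. Qed.

HB.instance Definition _ := GRing.Zmodule_isPzRing.Build corner
  corner_mulA corner_mul1l corner_mul1r corner_mulDl corner_mulDr.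

End Corner.

Definition vertex_idempotent K Q (I : admissible_ideal K Q)
    (P : vertex Q -> Prop) : idempotent (pathquot I) :=
  Idempotent (qvsum_idem I P).

(* Right modules over [R] are left modules over the converse ring [R^c]. *)

Section Modules.
Variable R : pzRingType.
Implicit Types M N P X Y T : lmodType R.

Definition is_zero M : Prop := forall x : M, x = 0.

Definition fin_gen M : Prop :=
  exists n (g : 'I_n -> M), forall x : M,
  exists c : 'I_n -> R, x = \sum_i c i *: g i.

Definition lmod_iso M N : Prop :=
  exists (f : {linear M -> N}) (g : {linear N -> M}), cancel f g /\ cancel g f.

Definition summand X M : Prop :=
  exists Y : lmodType R, lmod_iso M (X * Y)%type.

Definition indecomposable M : Prop :=
  ~ is_zero M /\
  forall X Y : lmodType R, lmod_iso M (X * Y)%type -> is_zero X \/ is_zero Y.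

Definition basic_module M : Prop :=
  forall X : lmodType R, indecomposable X -> ~ summand (X * X)%type M.

Definition in_add T X : Prop := exists n : nat, summand X {ffun 'I_n -> T}.

Definition surjective_map (U V : Type) (f : U -> V) : Prop :=
  forall y, exists x, f x = y.

Definition exact_at (U V : Type) (W : zmodType) (f : U -> V) (g : V -> W) :
  Prop := forall y, g y = 0 <-> exists x, f x = y.

Definition projective P : Prop :=
  forall (X Y : lmodType R) (f : {linear X -> Y}) (g : {linear P -> Y}),
  surjective_map f -> exists h : {linear P -> X}, forall x, f (h x) = g x.

Definition injective_module N : Prop :=
  forall (X Y : lmodType R) (f : {linear X -> Y}) (g : {linear X -> N}),
  injective f -> exists h : {linear Y -> N}, forall x, h (f x) = g x.

(* Loewy length, through the radical series: the radical of a submodule is the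
   intersection of its maximal submodules. *)

Definition submodule M (N : M -> Prop) : Prop :=
  [/\ N 0, forall x y, N x -> N y -> N (x + y)
    & forall (a : R) x, N x -> N (a *: x)].

Definition maximal_in M (N L : M -> Prop) : Prop :=
  [/\ submodule L, forall x, L x -> N x, exists2 x, N x & ~ L x
    & forall L' : M -> Prop, submodule L' ->
        (forall x, L x -> L' x) -> (forall x, L' x -> N x) ->
        (forall x, L' x -> L x) \/ (forall x, N x -> L' x)].

Definition radical M (N : M -> Prop) : M -> Prop :=
  fun x => N x /\ forall L, maximal_in N L -> L x.

Definition rad_series M (n : nat) : M -> Prop :=
  iter n (@radical M) (fun=> True).

Definition has_loewy_length M (l : nat) : Prop :=
  (forall x, rad_series l x -> x = 0 :> M) /\
  forall m, (m < l)%N -> exists2 x : M, rad_series m x & x <> 0.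

Definition same_loewy_length (C : lmodType R -> Prop) : Prop :=
  exists l, forall M, C M -> has_loewy_length M l.

Definition indec_projective M : Prop :=
  [/\ fin_gen M, indecomposable M & projective M].

Definition indec_injective M : Prop :=
  [/\ fin_gen M, indecomposable M & injective_module M].

Record proj_resolution M := ProjResolution {
  res_obj : nat -> lmodType R;
  res_diff : forall n, {linear res_obj n.+1 -> res_obj n};
  res_aug : {linear res_obj 0%N -> M};
  res_projective : forall n, projective (res_obj n);
  res_surj : surjective_map res_aug;
  res_exact0 : exact_at (res_diff 0%N) res_aug;
  res_exact : forall n, exact_at (res_diff n.+1) (res_diff n) }.

Definition finite_pd M : Prop :=
  exists (r : proj_resolution M) (n : nat),
  forall m, (n < m)%N -> is_zero (res_obj r m).

Definition fin_pd_module M : Prop := fin_gen M /\ finite_pd M.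

Definition cocycle M N (r : proj_resolution M) n
    (f : {linear res_obj r n -> N}) : Prop :=
  forall x, f (res_diff r n x) = 0.

Definition coboundary M N (r : proj_resolution M) n :
    {linear res_obj r n -> N} -> Prop :=
  match n return {linear res_obj r n -> N} -> Prop with
  | 0 => fun f => forall x, f x = 0
  | m.+1 => fun f => exists g : {linear res_obj r m -> N},
              forall x, f x = g (res_diff r m x)
  end.

(* [Ext^n(M, N) = 0]: the complex [Hom(P, N)] of any projective resolution [P]
   of [M] has no cohomology in degree [n]. *)
Definition Ext_zero (n : nat) M N : Prop :=
  forall (r : proj_resolution M) (f : {linear res_obj r n -> N}),
  cocycle f -> coboundary f.

(* An exact sequence 0 -> R -> C 0 -> ... -> C s -> 0 with all terms in add T,
   continued by zero modules. *)
Definition has_add_coresolution T : Prop :=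
  exists (s : nat) (C : nat -> lmodType R)
    (d : forall n, {linear C n -> C n.+1}) (eta : {linear R^o -> C 0%N}),
  [/\ injective eta, exact_at eta (d 0%N),
      forall n, exact_at (d n) (d n.+1),
      forall n, (n <= s)%N -> in_add T (C n)
    & forall n, (s < n)%N -> is_zero (C n)].

Definition tilting T : Prop :=
  [/\ fin_pd_module T,
      forall n, (1 <= n)%N -> Ext_zero n T T
    & has_add_coresolution T].

Definition strong_tilting T : Prop :=
  tilting T /\
  forall M, fin_pd_module M -> forall n, (1 <= n)%N -> Ext_zero n M T.

End Modules.

Section OppositeAlgebra.
Variables (K : fieldType) (A : algType K).

Let cscale (c : K) (x : A^c) : A^c := c *: (x : A).

Let cscaleA c d x : cscale c (cscale d x) = cscale (c * d) x.
Proof. exact: scalerA. Qed.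
Let cscale1 : left_id 1 cscale. Proof. exact: scale1r. Qed.
Let cscaleDr : right_distributive cscale +%R. Proof. exact: scalerDr. Qed.
Let cscaleDl x : {morph cscale^~ x : c d / c + d}.
Proof. exact: (scalerDl (x : A)). Qed.

HB.instance Definition _ := GRing.Zmodule_isLmodule.Build K A^c
  cscaleA cscale1 cscaleDr cscaleDl.

Let cscaleAl (c : K) (x y : A^c) : c *: (x * y) = (c *: x) * y.
Proof. exact: (@scalerAr K A c y x). Qed.

HB.instance Definition _ := GRing.Lmodule_isLalgebra.Build K A^c cscaleAl.

Let cscaleAr (c : K) (x y : A^c) : c *: (x * y) = x * (c *: y).
Proof. exact: (@scalerAl K A c y x). Qed.

HB.instance Definition _ := GRing.Lalgebra_isAlgebra.Build K A^c cscaleAr.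

End OppositeAlgebra.

(* The Artin algebras considered here are the finite dimensional K-algebras. *)

Section Tilting.
Variable K : fieldType.
Implicit Types A B : algType K.

Definition basic_algebra A : Prop :=
  fin_gen (A : lmodType K) /\ basic_module (A^o : lmodType A).

(* [B] is isomorphic to [End_A(T)] as a K-algebra; the last two clauses are
   injectivity and surjectivity of the isomorphism. *)
Definition iso_End A (T : lmodType A) B : Prop :=
  exists phi : B -> {linear T -> T},
  [/\ (forall (c : K) b1 b2 t,
         phi (c *: b1 + b2) t = c%:A *: phi b1 t + phi b2 t),
      forall t, phi 1 t = t,
      forall b1 b2 t, phi (b1 * b2) t = phi b1 (phi b2 t),
      forall b, (forall t, phi b t = 0) -> b = 0
    & forall f : {linear T -> T}, exists b, forall t, phi b t = f t].

(* [mod-B] results from [A-mod]: the condition [B = End(T)^op] is expressed as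
   [B^op = End(T)]. *)
Definition strong_tilt_left A B : Prop :=
  exists T : lmodType A,
  [/\ basic_module T, strong_tilting T & iso_End T B^c].

(* [B-mod] results from [mod-A]. *)
Definition strong_tilt_right A B : Prop :=
  exists T : lmodType A^c,
  [/\ basic_module T, strong_tilting T & iso_End T B].

Definition strong_tilting_sequence A (S : nat -> algType K) : Prop :=
  [/\ S 0%N = A, forall i, basic_algebra (S i)
    & forall i, if odd i then strong_tilt_right (S i) (S i.+1)
                else strong_tilt_left (S i) (S i.+1)].

Definition unlimited_strong_tilting A : Prop :=
  exists S : nat -> algType K, strong_tilting_sequence A S.

(* Morphisms are compared pointwise, and the last field is K-linearity. *)
Record mod_functor A B := ModFunctor {
  fobj :> lmodType A -> lmodType B;
  fmap : forall M N : lmodType A, {linear M -> N} -> {linear fobj M -> fobj N};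
  fmap_id : forall (M : lmodType A) (f : {linear M -> M}),
    (forall x, f x = x) -> forall y, fmap f y = y;
  fmap_comp : forall (M N P : lmodType A) (g : {linear N -> P})
      (f : {linear M -> N}) (h : {linear M -> P}),
    (forall x, h x = g (f x)) -> forall y, fmap h y = fmap g (fmap f y);
  fmap_linear : forall (M N : lmodType A) (c : K) (f g h : {linear M -> N}),
    (forall x, h x = c%:A *: f x + g x) ->
    forall y, fmap h y = c%:A *: fmap f y + fmap g y }.

(* A natural isomorphism from [G \o F] to the identity. *)
Definition nat_iso_id A B (F : mod_functor A B) (G : mod_functor B A) : Prop :=
  exists eta : forall M : lmodType A, {linear G (F M) -> M},
  (forall M, bijective (eta M)) /\
  forall (M N : lmodType A) (f : {linear M -> N}) x,
    eta N (fmap G (fmap F f) x) = f (eta M x).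

Definition morita_equivalent A B : Prop :=
  exists (F : mod_functor A B) (G : mod_functor B A),
  nat_iso_id F G /\ nat_iso_id G F.

End Tilting.

(* Main.v *)
(* Write A = e Lambda e and F = e' Lambda e'.

   Periodicity.  For a strong tilting module T over R with E = End(T), the
   functor Hom_R(-, T) is a duality between the modules of finite projective
   dimension over R and modules of finite projective dimension over E, and T, as
   an E-module, is itself strong tilting as soon as every nonzero finitely
   generated R-module has a nonzero map to T.  This last condition holds when R
   is itself the result of a strong tilt.  So from the second step on the next
   strong tilting module is, up to add-equivalence, the previous one seen from
   the other side, which gives a Morita context between R(i) and R(i+2).

   Existence.  A finite dimensional algebra has a strong tilting module as soon
   as its modules of finite projective dimension have bounded dimension and all
   finitely generated modules have approximations by them; the tilting module is
   the approximation of the injective cogenerator.  Both properties pass from S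
   to R along Phi = Hom_R(V, -), for V finitely generated projective with
   S = End(V)^op and Hom_R(V, R) projective over S, if all M with Phi M = 0 have
   bounded projective dimension.  If all indecomposable projective modules of a
   split basic algebra have the same Loewy length, then every module of finite
   projective dimension is projective (in a minimal resolution, J^(l-1) detects
   the radical of a projective module), and the properties are trivial.  This
   applies to A and, dualizing the hypothesis on injectives, to F^op.  The
   properties then pass from F^op to A^op and from A to Lambda, because the
   vertices removed lie on no oriented cycle; and from A^op to the first tilt
   E = End(T), with V = Hom(Z, T), where Z is coinduced from A to Lambda and lies
   in add T. *)

From HB Require Import structures.
Require Import Defs.
From mathcomp Require Import all_boot all_order all_algebra.
From mathcomp Require Import finmap.
From mathcomp.multinomials Require Import monalg.
From mathcomp.classical Require Import boolp classical_sets.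

Set Implicit Arguments.
Unset Strict Implicit.
Unset Printing Implicit Defensive.

Import GRing.Theory.
Local Open Scope ring_scope.

(** Right modules are left modules over the opposite ring, so tilting alternates between algebras
    and their opposites. A [bimod] keeps one additive group with two commuting left actions;
    exchanging its sides turns a statement on T over R into one on T over End(T).

    Krull-Schmidt decompositions, projective covers and Ext groups are bypassed: projective
    dimension and higher Ext are read off from an arbitrary chain of syzygies, where Schanuel's
    lemma removes the choice; Ext^1 is an extension property; a module without repeated summands is
    found by minimising the dimension over K.

    The hypothesis on injectives enters at the second tilt: the corner that controls End(T) is the
    opposite of A, and its own corner at the critical vertices is the opposite of F. Both corners
    vanish when the quiver has no oriented cycle, so the transfer results are stated for rings with
    a [kstr] and not for [algType]. The constructed sequence repeats literally from the first tilt
    on, whereas an arbitrary sequence repeats up to Morita equivalence. *)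

Section MkMod.
Variable R : pzRingType.
Variables (C : Type) (zero : C) (opp : C -> C) (add : C -> C -> C).
Variable scale : R -> C -> C.
Hypotheses (addA : associative add) (addC : commutative add).
Hypotheses (add0 : left_id zero add) (addN : left_inverse zero opp add).
Hypothesis scaleA : forall a b x, scale a (scale b x) = scale (a * b) x.
Hypothesis scale1 : left_id 1 scale.
Hypothesis scaleDr : forall a x y, scale a (add x y) = add (scale a x) (scale a y).
Hypothesis scaleDl : forall x a b, scale (a + b) x = add (scale a x) (scale b x).

(** The axioms are arguments of the type itself, so that its instances can be inferred from them and
    several module structures can live on one carrier. *)
Definition mod_carrier of associative add & commutative add & left_id zero add
  & left_inverse zero opp add & (forall a b x, scale a (scale b x) = scale (a * b) x)
  & left_id 1 scale
  & (forall a x y, scale a (add x y) = add (scale a x) (scale a y))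
  & (forall x a b, scale (a + b) x = add (scale a x) (scale b x)) := C.
Local Notation V := (mod_carrier addA addC add0 addN scaleA scale1 scaleDr scaleDl).
HB.instance Definition _ := gen_eqMixin V.
HB.instance Definition _ := gen_choiceMixin V.
HB.instance Definition _ := GRing.isZmodule.Build V addA addC add0 addN.
HB.instance Definition _ := GRing.Zmodule_isLmodule.Build R V scaleA scale1 scaleDr scaleDl.
Definition mk_lmod : lmodType R := V.
End MkMod.

(** * Linear maps, submodules, quotients and finite generation *)

Section LinearMaps.
Variable R : pzRingType.
Implicit Types M N X Y Z W A B C P Q T : lmodType R.

(** Bundled linear maps contain proofs; proof irrelevance reduces their equality to pointwise
    equality, so that Hom-sets become groups. *)
Lemma lin_ext M N (f g : {linear M -> N}) : f =1 g -> f = g.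
Proof.
case: f g => [f [[[f1 f2]] [f3]]] [g [[[g1 g2]] [g3]]] /= /funext fg.
move: f1 f2 f3; rewrite fg => f1 f2 f3.
by rewrite (Prop_irrelevance f1 g1) (Prop_irrelevance f2 g2) (Prop_irrelevance f3 g3).
Qed.

Definition mklin M N (f : M -> N) (fL : linear f) : {linear M -> N} :=
  HB.pack f (GRing.isLinear.Build R M N *:%R f fL).

Lemma zero_linP M N : linear (fun _ : M => 0 : N).
Proof. by move=> a x y; rewrite scaler0 addr0. Qed.
Definition lin0 M N := mklin (@zero_linP M N).

Lemma add_linP M N (f g : {linear M -> N}) : linear (fun x => f x + g x).
Proof. by move=> a x y; rewrite !linearP scalerDr addrACA. Qed.
Definition linD M N f g := mklin (@add_linP M N f g).

Lemma opp_linP M N (f : {linear M -> N}) : linear (fun x => - f x).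
Proof. by move=> a x y; rewrite linearP opprD scalerN. Qed.
Definition linN M N f := mklin (@opp_linP M N f).

Lemma id_linP M : linear (@id M).
Proof. by []. Qed.
Definition lin1 M := mklin (@id_linP M).

Lemma comp_linP X Y Z (f : {linear Y -> Z}) (g : {linear X -> Y}) :
  linear (fun x => f (g x)).
Proof. by move=> a x y; rewrite !linearP. Qed.
Definition linc X Y Z f g := mklin (@comp_linP X Y Z f g).

HB.instance Definition _ M N := gen_eqMixin {linear M -> N}.
HB.instance Definition _ M N := gen_choiceMixin {linear M -> N}.

Lemma linDA M N : associative (@linD M N).
Proof. by move=> f g h; apply: lin_ext => x /=; rewrite addrA. Qed.
Lemma linDC M N : commutative (@linD M N).
Proof. by move=> f g; apply: lin_ext => x /=; rewrite addrC. Qed.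
Lemma lin0D M N : left_id (lin0 M N) (@linD M N).
Proof. by move=> f; apply: lin_ext => x /=; rewrite add0r. Qed.
Lemma linND M N : left_inverse (lin0 M N) (@linN M N) (@linD M N).
Proof. by move=> f; apply: lin_ext => x /=; rewrite addNr. Qed.

HB.instance Definition _ M N := GRing.isZmodule.Build {linear M -> N}
  (@linDA M N) (@linDC M N) (@lin0D M N) (@linND M N).

(** Maps that a diagram determines uniquely are built from their graph: choice picks the values,
    single-valuedness makes them linear. *)
Lemma ex_lin_rel M N (G : M -> N -> Prop) :
  (forall x, exists y, G x y) ->
  (forall x y y', G x y -> G x y' -> y = y') ->
  (forall a x x' y y', G x y -> G x' y' -> G (a *: x + x') (a *: y + y')) ->
  exists h : {linear M -> N}, forall x, G x (h x).
Proof.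
move=> /choice[f fG] Gu GL.
have fL : linear f by move=> a x y; apply: Gu (fG _) _; apply: GL.
by exists (mklin fL).
Qed.

Lemma linB_eq0 M N (f : {linear M -> N}) x y : f x = f y -> f (x - y) = 0.
Proof. by move=> e; rewrite linearB e subrr. Qed.

Lemma lin_inj M N (f : {linear M -> N}) :
  (forall x, f x = 0 -> x = 0) -> injective f.
Proof. by move=> f0 x y /linB_eq0/f0/eqP; rewrite subr_eq0 => /eqP. Qed.

Lemma lin_inj0 M N (f : {linear M -> N}) x : injective f -> f x = 0 -> x = 0.
Proof. by move=> fi fx; apply: fi; rewrite fx linear0. Qed.


Section Sub.
Variables (M : lmodType R) (S : M -> Prop).
Hypothesis hS : submodule S.

Let carrier := {x : M | `[< S x >]}.
Let inS (x : carrier) : S (val x). Proof. exact/asboolP/(valP x). Qed.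
Let mk x (Sx : S x) : carrier := exist _ x (introT (asboolP _) Sx).
Let S0 : S 0. Proof. by case: hS. Qed.
Let SD x y : S x -> S y -> S (x + y). Proof. by case: hS => ? + ?; exact. Qed.
Let SZ a x : S x -> S (a *: x). Proof. by case: hS => ? ?; exact. Qed.
Let SN x : S x -> S (- x). Proof. by move=> /(@SZ (-1)); rewrite scaleN1r. Qed.

Let add (x y : carrier) := mk (SD (inS x) (inS y)).
Let opp (x : carrier) := mk (SN (inS x)).
Let scale a (x : carrier) := mk (SZ a (inS x)).
Let addA : associative add.
Proof. by move=> x y z; apply: val_inj; exact: addrA. Qed.
Let addC : commutative add.
Proof. by move=> x y; apply: val_inj; exact: addrC. Qed.
Let add0 : left_id (mk S0) add.
Proof. by move=> x; apply: val_inj; exact: add0r. Qed.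
Let addN : left_inverse (mk S0) opp add.
Proof. by move=> x; apply: val_inj; exact: addNr. Qed.
Let scaleA a b x : scale a (scale b x) = scale (a * b) x.
Proof. by apply: val_inj; exact: scalerA. Qed.
Let scale1 : left_id 1 scale.
Proof. by move=> x; apply: val_inj; exact: scale1r. Qed.
Let scaleDr a x y : scale a (add x y) = add (scale a x) (scale a y).
Proof. by apply: val_inj; exact: scalerDr. Qed.
Let scaleDl x a b : scale (a + b) x = add (scale a x) (scale b x).
Proof. by apply: val_inj; exact: scalerDl. Qed.
Definition subm : lmodType R :=
  mk_lmod addA addC add0 addN scaleA scale1 scaleDr scaleDl.

Lemma subm_valP : linear (fun x : subm => val (x : carrier)).
Proof. by []. Qed.
Definition subm_val : {linear subm -> M} := mklin subm_valP.

Lemma subm_val_inj : injective subm_val. Proof. exact: val_inj. Qed.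
Lemma subm_valE x : S x <-> exists y, subm_val y = x.
Proof. by split=> [Sx|[y <-]]; [exists (mk Sx)|exact: inS]. Qed.

End Sub.

Section Quot.
Variables (M : lmodType R) (S : M -> Prop).
Hypothesis hS : submodule S.

Let S0 : S 0. Proof. by case: hS. Qed.
Let SD x y : S x -> S y -> S (x + y). Proof. by case: hS => ? + ?; exact. Qed.
Let SZ a x : S x -> S (a *: x). Proof. by case: hS => ? ?; exact. Qed.
Let SN x : S x -> S (- x). Proof. by move=> /(@SZ (-1)); rewrite scaleN1r. Qed.

(** Canonical coset representatives: [choose] sees only the predicate, which is the same for the
    whole coset. The quotient is the set of these representatives. *)
Let rep (x : M) : M := choose (fun y => `[< S (y - x) >]) x.
Let repS x : S (rep x - x).
Proof.
by apply/asboolP/(@chooseP _ (fun y => `[< S (y - x) >])); rewrite subrr; apply/asboolP.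
Qed.
Let rep_eq x y : S (x - y) -> rep x = rep y.
Proof.
move=> Sxy; have e : (fun z => `[< S (z - x) >]) =1 (fun z => `[< S (z - y) >]).
  move=> z; apply: asbool_equiv_eq; split => h.
    by have := SD h Sxy; rewrite addrA subrK.
  by have := SD h (SN Sxy); rewrite opprB addrA subrK.
rewrite /rep (eq_choose e); apply: choose_id; apply/asboolP => //.
by rewrite subrr.
Qed.

Let carrier := {x : M | rep x == x}.
Let rep_rep x : rep (rep x) == rep x. Proof. exact/eqP/rep_eq. Qed.
Let pr x : carrier := exist _ (rep x) (rep_rep x).
Let prK (u : carrier) : pr (val u) = u.
Proof. by apply: val_inj; case: u => x /= /eqP. Qed.
Let pr_eq x y : S (x - y) -> pr x = pr y.
Proof. by move=> /rep_eq e; apply: val_inj. Qed.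
Let add (u v : carrier) := pr (val u + val v).
Let prD x y : add (pr x) (pr y) = pr (x + y).
Proof.
by apply: pr_eq => /=; rewrite opprD addrACA; apply: SD; exact: repS.
Qed.
Let opp (u : carrier) := pr (- val u).
Let prN x : opp (pr x) = pr (- x).
Proof. by apply: pr_eq => /=; rewrite -opprB opprK addrC; exact/SN/repS. Qed.
Let scale a (u : carrier) := pr (a *: val u).
Let prZ a x : scale a (pr x) = pr (a *: x).
Proof. by apply: pr_eq => /=; rewrite -scalerBr; exact/SZ/repS. Qed.

Let addA : associative add.
Proof. by move=> u v w; rewrite -[u]prK -[v]prK -[w]prK !prD addrA. Qed.
Let addC : commutative add.
Proof. by move=> u v; rewrite -[u]prK -[v]prK !prD addrC. Qed.
Let add0 : left_id (pr 0) add.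
Proof. by move=> u; rewrite -[u]prK !prD add0r. Qed.
Let addN : left_inverse (pr 0) opp add.
Proof. by move=> u; rewrite -[u]prK prN prD addNr. Qed.
Let scaleA a b u : scale a (scale b u) = scale (a * b) u.
Proof. by rewrite -[u]prK !prZ scalerA. Qed.
Let scale1 : left_id 1 scale.
Proof. by move=> u; rewrite -[u]prK !prZ scale1r. Qed.
Let scaleDr a u v : scale a (add u v) = add (scale a u) (scale a v).
Proof. by rewrite -[u]prK -[v]prK prD !prZ scalerDr -prD. Qed.
Let scaleDl u a b : scale (a + b) u = add (scale a u) (scale b u).
Proof. by rewrite -[u]prK !prZ scalerDl -prD. Qed.
Definition quotm : lmodType R :=
  mk_lmod addA addC add0 addN scaleA scale1 scaleDr scaleDl.

Lemma quotm_prP : linear (pr : M -> quotm).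
Proof. by move=> a x y; change (pr (a *: x + y) = add (scale a (pr x)) (pr y)); rewrite prZ prD. Qed.
Definition quotm_pr : {linear M -> quotm} := mklin quotm_prP.

Lemma quotm_prE x : quotm_pr x = 0 <-> S x.
Proof.
split=> [/(congr1 val) /= e|Sx]; last by apply: pr_eq; rewrite subr0.
have := SD (repS 0) (SN (repS x)).
by rewrite e subr0 opprB addrC subrK.
Qed.
Lemma quotm_pr_surj : surjective_map quotm_pr.
Proof. by move=> u; exists (val (u : carrier)); exact: prK. Qed.

End Quot.

Definition ses X Y Z (f : {linear X -> Y}) (g : {linear Y -> Z}) : Prop :=
  [/\ injective f, exact_at f g & surjective_map g].

Lemma ker_sub X Y (f : {linear X -> Y}) : submodule (fun x => f x = 0).
Proof.
split=> [|x y fx fy|a x fx]; first exact: linear0.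
  by rewrite linearD fx fy addr0.
by rewrite linearZ /= fx scaler0.
Qed.

Lemma im_sub X Y (f : {linear X -> Y}) : submodule (fun y => exists x, f x = y).
Proof.
split=> [|_ _ [x <-] [y <-]|a _ [x <-]]; first by exists 0; exact: linear0.
  by exists (x + y); exact: linearD.
by exists (a *: x); exact: linearZ.
Qed.

Lemma sub_ex M (S : M -> Prop) : submodule S ->
  exists Z (i : {linear Z -> M}), injective i /\ forall x, S x <-> exists z, i z = x.
Proof.
move=> hS; exists (subm hS), (subm_val hS).
by split; [exact: subm_val_inj|exact: subm_valE].
Qed.

Lemma ker_ex X Y (f : {linear X -> Y}) :
  exists Z (i : {linear Z -> X}), injective i /\ exact_at i f.
Proof. exact: sub_ex (ker_sub f). Qed.

Lemma im_ex X Y (f : {linear X -> Y}) :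
  exists Z (i : {linear Z -> Y}) (p : {linear X -> Z}),
    [/\ injective i, surjective_map p & forall x, i (p x) = f x].
Proof.
have [Z [i [ii iE]]] := sub_ex (im_sub f).
have [|||p pE] := @ex_lin_rel X Z (fun x z => i z = f x).
- by move=> x; apply/iE; exists x.
- by move=> x y y' <- /ii.
- by move=> a x x' y y' e e'; rewrite !linearP e e'.
exists Z, i, p; split=> // z; have /iE[x xE] : exists z', i z' = i z by exists z.
by exists x; apply: ii; rewrite pE.
Qed.

Lemma quot_ex M (S : M -> Prop) : submodule S ->
  exists C (g : {linear M -> C}), surjective_map g /\ forall x, g x = 0 <-> S x.
Proof.
move=> hS; exists (quotm hS), (quotm_pr hS).
by split; [exact: quotm_pr_surj|exact: quotm_prE].
Qed.

Lemma coker_ex X Y (f : {linear X -> Y}) :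
  exists C (g : {linear Y -> C}), surjective_map g /\ exact_at f g.
Proof. exact: quot_ex (im_sub f). Qed.

Lemma ses_ker X Y (g : {linear X -> Y}) : surjective_map g ->
  exists Z (i : {linear Z -> X}), ses i g.
Proof. by move=> gs; have [Z [i [ii ie]]] := ker_ex g; exists Z, i. Qed.

Lemma ses_coker X Y (f : {linear X -> Y}) : injective f ->
  exists Z (g : {linear Y -> Z}), ses f g.
Proof. by move=> fi; have [Z [g [gs ge]]] := coker_ex f; exists Z, g. Qed.

Lemma ses0 X Y Z (f : {linear X -> Y}) (g : {linear Y -> Z}) x :
  ses f g -> g (f x) = 0.
Proof. by case=> _ e _; apply/e; exists x. Qed.

Lemma exact0 X Y Z (f : {linear X -> Y}) (g : {linear Y -> Z}) x :
  exact_at f g -> g (f x) = 0.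
Proof. by move=> e; apply/e; exists x. Qed.

Lemma lift_ker X Y Z W (f : {linear X -> Y}) (g : {linear Y -> Z})
    (h : {linear W -> Y}) : injective f -> exact_at f g ->
  (forall w, g (h w) = 0) -> exists k : {linear W -> X}, forall w, f (k w) = h w.
Proof.
move=> fi fe gh; have [|||k kE] := @ex_lin_rel W X (fun w x => f x = h w).
- by move=> w; exact/fe.
- by move=> w x x' <- /fi.
- by move=> a w w' x x' e e'; rewrite !linearP e e'.
by exists k.
Qed.

Lemma desc_coker X Y Z W (f : {linear X -> Y}) (g : {linear Y -> Z})
    (h : {linear Y -> W}) : exact_at f g -> surjective_map g ->
  (forall x, h (f x) = 0) -> exists k : {linear Z -> W}, forall y, k (g y) = h y.
Proof.
move=> fe gs hf.
have h0 y y' : g y = g y' -> h y = h y'.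
  move=> /linB_eq0/fe[x xE]; apply/eqP; rewrite -subr_eq0 -linearB -xE.
  by rewrite hf.
have [|||k kE] := @ex_lin_rel Z W (fun z w => exists2 y, g y = z & h y = w).
- by move=> z; have [y <-] := gs z; exists (h y), y.
- by move=> z w w' [y <- <-] [y' /h0 -> <-].
- move=> a _ _ _ _ [y <- <-] [y' <- <-]; exists (a *: y + y'); exact: linearP.
by exists k => y; have [y' /h0 <- <-] := kE (g y).
Qed.

Lemma inv_ex X Y (f : {linear X -> Y}) : injective f -> surjective_map f ->
  exists g : {linear Y -> X}, cancel f g /\ cancel g f.
Proof.
move=> fi fs; have [|||g gE] := @ex_lin_rel Y X (fun y x => f x = y) => //.
- by move=> y x x' <- /fi.
- by move=> a y y' x x' <- <-; exact: linearP.
by exists g; split=> x //; apply: fi; rewrite gE.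
Qed.

Lemma pair_linP M X Y (f : {linear M -> X}) (g : {linear M -> Y}) :
  linear (fun x => (f x, g x) : X * Y).
Proof. by move=> a x y; rewrite !linearP. Qed.
Definition lin_pair M X Y f g := mklin (@pair_linP M X Y f g).
Lemma copair_linP M X Y (f : {linear X -> M}) (g : {linear Y -> M}) :
  linear (fun u : X * Y => f u.1 + g u.2).
Proof.
by move=> a [x1 x2] [y1 y2] /=; rewrite !linearP scalerDr addrACA.
Qed.
Definition lin_copair M X Y f g := mklin (@copair_linP M X Y f g).
Lemma fst_linP X Y : linear (fun u : X * Y => u.1). Proof. by []. Qed.
Definition lin_fst X Y := mklin (@fst_linP X Y).
Lemma snd_linP X Y : linear (fun u : X * Y => u.2). Proof. by []. Qed.
Definition lin_snd X Y := mklin (@snd_linP X Y).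

(** The last clause is joint injectivity of the projections; with the second one it replaces the
    universal property. *)
Lemma pullback_ex X Y Z (f : {linear X -> Z}) (g : {linear Y -> Z}) :
  exists B (p : {linear B -> X}) (q : {linear B -> Y}),
  [/\ forall b, f (p b) = g (q b), forall x y, f x = g y -> exists b, p b = x /\ q b = y
    & forall b, p b = 0 -> q b = 0 -> b = 0].
Proof.
pose hL := linD (linc f (lin_fst X Y)) (linN (linc g (lin_snd X Y))).
have [B [i [ii ie]]] := ker_ex hL.
exists B, (linc (lin_fst X Y) i), (linc (lin_snd X Y) i); split=> /=.
- by move=> b; apply/eqP; rewrite -subr_eq0; apply/eqP/(ie (i b)); exists b.
- move=> x y e; have /ie[b bE] : hL (x, y) = 0 by rewrite /= e subrr.
  by exists b; rewrite bE.
- by move=> b e1 e2; apply: ii; rewrite linear0 [i b]surjective_pairing e1 e2.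
Qed.

Lemma tuple_linP M X n (f : 'I_n -> {linear M -> X}) :
  linear (fun x => [ffun i => f i x] : {ffun 'I_n -> X}).
Proof. by move=> a x y; apply/ffunP => i; rewrite !ffunE linearP. Qed.
Definition lin_tuple M X n f := mklin (@tuple_linP M X n f).
Lemma cotuple_linP M X n (f : 'I_n -> {linear X -> M}) :
  linear (fun u : {ffun 'I_n -> X} => \sum_i f i (u i)).
Proof.
move=> a x y; rewrite scaler_sumr -big_split /=; apply: eq_bigr => i _.
by rewrite !ffunE linearP.
Qed.
Definition lin_cotuple M X n f := mklin (@cotuple_linP M X n f).
Lemma proj_linP X n (i : 'I_n) : linear (fun u : {ffun 'I_n -> X} => u i).
Proof. by move=> a x y; rewrite !ffunE. Qed.
Definition lin_proj X n i := mklin (@proj_linP X n i).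
Lemma inj_linP X n (i : 'I_n) :
  linear (fun x => [ffun j => if j == i then x else 0] : {ffun 'I_n -> X}).
Proof.
move=> a x y; apply/ffunP => j; rewrite !ffunE; case: eqP => // _.
by rewrite scaler0 addr0.
Qed.
Definition lin_inj_at X n i := mklin (@inj_linP X n i).

Lemma ffun_decomp X n (u : {ffun 'I_n -> X}) :
  u = \sum_i lin_inj_at X i (u i).
Proof.
apply/ffunP => j; rewrite sum_ffunE (bigD1 j) //= ffunE eqxx big1 ?addr0 // => i.
by rewrite ffunE eq_sym => /negbTE ->.
Qed.

Lemma scalel_linP M (m : M) : linear (fun a : R^o => (a : R) *: m).
Proof. by move=> a x y; rewrite scalerDl scalerA. Qed.
Definition lin_scalel M m := mklin (@scalel_linP M m).

Definition retract X Y : Prop :=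
  exists (i : {linear X -> Y}) (p : {linear Y -> X}), cancel i p.

Lemma retract_refl X : retract X X.
Proof. by exists (lin1 X), (lin1 X). Qed.

Lemma retract_trans X Y Z : retract X Y -> retract Y Z -> retract X Z.
Proof.
move=> [i [p ip]] [j [q jq]]; exists (linc j i), (linc p q) => x /=.
by rewrite jq ip.
Qed.

(** The complement of a retract is the kernel of the retraction. *)
Lemma summandP X M : summand X M <-> retract X M.
Proof.
split=> [[Y [f [g [fg gf]]]]|[i [p ip]]].
  have h1 : linear (fun x : X => (x, 0) : X * Y).
    by move=> a x y; congr pair; rewrite /= scaler0 addr0.
  exists (linc g (mklin h1)), (linc (lin_fst X Y) f) => x /=.
  by rewrite gf.
have [Y [j [ji je]]] := ker_ex p.
have [q qE] : exists q : {linear M -> Y}, forall m, j (q m) = m - i (p m).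
  apply: (lift_ker (h := linD (lin1 M) (linN (linc i p))) ji je) => m /=.
  by rewrite linearB /= ip subrr.
exists Y, (lin_pair p q), (lin_copair i j); split=> [m|[x y]] /=.
  by rewrite qE addrC subrK.
have e : p (i x + j y) = x by rewrite linearD /= ip (exact0 y je) addr0.
by rewrite e; congr pair; apply: ji; rewrite qE e addrC addKr.
Qed.

Lemma in_addP T X : in_add T X <-> exists n, retract X {ffun 'I_n -> T}.
Proof. by split=> -[n /summandP h]; exists n. Qed.

Lemma retract_proj X Y : retract X Y -> projective Y -> projective X.
Proof.
move=> [i [p ip]] pY A B f g fs; have [h hE] := pY _ _ f (linc g p) fs.
by exists (linc h i) => x /=; rewrite hE /= ip.
Qed.

Lemma proj_R : projective (R^o : lmodType R).
Proof.
move=> A B f g fs; have [a aE] := fs (g 1); exists (lin_scalel a) => x /=.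
by rewrite linearZ /= aE -linearZ; congr (g _); exact: mulr1.
Qed.

Lemma proj_ffun P n : projective P -> projective ({ffun 'I_n -> P} : lmodType R).
Proof.
move=> pP A B f g fs.
have /choice[h hE] : forall i : 'I_n, exists h : {linear P -> A},
    forall x, f (h x) = g (lin_inj_at P i x).
  by move=> i; have [h hE] := pP _ _ f (linc g (lin_inj_at P i)) fs; exists h.
exists (lin_cotuple h) => u; rewrite [in RHS](ffun_decomp u) [in RHS]raddf_sum.
rewrite (_ : lin_cotuple h u = \sum_i h i (u i)) // raddf_sum.
by apply: eq_bigr => i _ /=; rewrite hE.
Qed.

Lemma proj_pair P Q : projective P -> projective Q -> projective (P * Q : lmodType R)%type.
Proof.
move=> pP pQ A B f g fs.
have a1 : linear (fun x : P => (x, 0) : P * Q).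
  by move=> a x y; congr pair; rewrite /= scaler0 addr0.
have a2 : linear (fun x : Q => (0, x) : P * Q).
  by move=> a x y; congr pair; rewrite /= scaler0 addr0.
have [h hE] := pP _ _ f (linc g (mklin a1)) fs.
have [k kE] := pQ _ _ f (linc g (mklin a2)) fs.
exists (lin_copair h k) => -[x y] /=; rewrite linearD /= hE kE /= -linearD.
by congr (g _); congr pair; rewrite /= ?addr0 ?add0r.
Qed.

Definition free n : lmodType R := {ffun 'I_n -> R^o}.

Lemma proj_free n : projective (free n).
Proof. exact: proj_ffun proj_R. Qed.

Lemma free_map M n (g : 'I_n -> M) :
  exists f : {linear free n -> M}, forall u, f u = \sum_i (u i : R) *: g i.
Proof. by exists (lin_cotuple (fun i => lin_scalel (g i))). Qed.

Lemma fin_genP M : fin_gen M <->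
  exists n (f : {linear free n -> M}), surjective_map f.
Proof.
split=> [[n [g gP]]|[n [f fs]]].
  have [f fE] := free_map g; exists n, f => x; have [c ->] := gP x.
  by exists (finfun c); rewrite fE; apply: eq_bigr => i _; rewrite ffunE.
exists n, (fun i => f (lin_inj_at R^o i 1)) => x; have [u <-] := fs x.
exists u; rewrite {1}(ffun_decomp u) raddf_sum; apply: eq_bigr => i _.
rewrite -linearZ; congr (f _); apply/ffunP => j; rewrite !ffunE.
by case: eqP => _; rewrite ?scaler0 //; exact/esym/mulr1.
Qed.

Lemma fin_gen_free n : fin_gen (free n).
Proof. by apply/fin_genP; exists n, (lin1 _) => x; exists x. Qed.

Lemma fin_gen_R : fin_gen (R^o : lmodType R).
Proof.
exists 1%N, (fun=> 1) => c; exists (fun=> c); rewrite big_ord1; exact/esym/mulr1.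
Qed.

(** V is the left ideal Re; the projection onto it is right multiplication by e, so V is a summand
    of R. *)
Lemma left_ideal_ex (e : R) : e * e = e ->
  exists (V : lmodType R) (j : {linear V -> R^o}) (p : {linear (R^o : lmodType R) -> V}),
  [/\ injective j, forall a : R^o, (a : R) * e = a <-> exists v, j v = a,
      cancel j p & forall a, j (p a) = (a : R) * e].
Proof.
move=> ee; have hV : submodule (fun a : R^o => (a : R) * e = a).
  split=> [|x y xe ye|a x xe]; first by rewrite mul0r.
    by rewrite mulrDl xe ye.
  by rewrite -mulrA xe.
have [V [j [ji jE]]] := sub_ex hV; exists V, j.
have [|||p pE] := @ex_lin_rel (R^o : lmodType R) V (fun a v => j v = (a : R) * e).
- by move=> a; apply/jE; rewrite -mulrA ee.
- by move=> a v v' <- /ji.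
- by move=> a r r' v v' h h'; rewrite linearP h h' /= mulrDl -mulrA.
exists p; split=> // v; apply: ji; rewrite pE.
by apply/jE; exists v.
Qed.

Lemma fin_gen_surj M N (f : {linear M -> N}) :
  surjective_map f -> fin_gen M -> fin_gen N.
Proof.
move=> fs [n [g gP]]; exists n, (f \o g) => y; have [x <-] := fs y.
have [c ->] := gP x; exists c; rewrite raddf_sum; apply: eq_bigr => i _.
exact: linearZ.
Qed.

Lemma fin_gen_ext X Y Z (f : {linear X -> Y}) (g : {linear Y -> Z}) :
  exact_at f g -> surjective_map g -> fin_gen X -> fin_gen Z -> fin_gen Y.
Proof.
move=> fe gs /fin_genP[n [p ps]] /fin_genP[m [q qs]].
have [h hE] := proj_free q gs.
have [k kP] : exists k : {linear (free n * free m)%type -> Y}, surjective_map k.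
  exists (lin_copair (linc f p) h) => y; have [v vE] := qs (g y).
  have /fe[x xE] : g (y - h v) = 0 by rewrite linearB hE vE subrr.
  have [u uE] := ps x; exists (u, v); by rewrite /= uE xE subrK.
have [k' k'P] : exists k' : {linear free (n + m) -> (free n * free m)%type},
    surjective_map k'.
  exists (lin_pair (lin_tuple (fun i => lin_proj R^o (lshift m i)))
                   (lin_tuple (fun i => lin_proj R^o (rshift n i)))) => -[u v].
  exists [ffun i => match split i with inl j => u j | inr j => v j end].
  congr pair; apply/ffunP => i; rewrite !ffunE /=.
    by rewrite !ffunE (unsplitK (inl i : 'I_n + 'I_m)).
  by rewrite !ffunE (unsplitK (inr i : 'I_n + 'I_m)).
apply/fin_genP; exists (n + m)%N, (linc k k') => y.
by have [w <-] := kP y; have [u <-] := k'P w; exists u.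
Qed.


End LinearMaps.

(** * Extensions, syzygies and projective dimension *)

Section Homological.
Variable R : pzRingType.
Implicit Types M N X Y Z W A B C P Q T K L : lmodType R.

Lemma ses_proj_section X Y P (f : {linear X -> Y}) (g : {linear Y -> P}) :
  ses f g -> projective P -> exists s : {linear P -> Y}, cancel s g.
Proof. by case=> _ _ gs pP; have [s sE] := pP _ _ g (lin1 P) gs; exists s. Qed.

Lemma ses_section_retraction X Y Z (f : {linear X -> Y}) (g : {linear Y -> Z})
    (s : {linear Z -> Y}) : ses f g -> cancel s g ->
  exists r : {linear Y -> X}, cancel f r /\ forall y, f (r y) = y - s (g y).
Proof.
move=> S gs; have [fi fe _] := S.
have [|r rE] := lift_ker (h := linD (lin1 Y) (linN (linc s g))) fi fe.
  by move=> y /=; rewrite linearB /= gs subrr.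
exists r; split=> // x; apply: fi; rewrite rE /= (ses0 _ S).
by rewrite linear0 subr0.
Qed.

Lemma ses_retraction_section X Y Z (f : {linear X -> Y}) (g : {linear Y -> Z})
    (r : {linear Y -> X}) : ses f g -> cancel f r ->
  exists s : {linear Z -> Y}, cancel s g.
Proof.
move=> S fr; have [fi fe gs] := S.
have [|s sE] := desc_coker (h := linD (lin1 Y) (linN (linc f r))) fe gs.
  by move=> x /=; rewrite fr subrr.
exists s => z; have [y <-] := gs z; rewrite sE /= linearB.
by rewrite /= (ses0 _ S) subr0.
Qed.

Lemma ses_comp_surj X Y Z (f : {linear X -> Y}) (g : {linear Y -> Z}) :
  surjective_map f -> surjective_map g -> surjective_map (linc g f).
Proof.
by move=> fs gs z; have [y <-] := gs z; have [x <-] := fs y; exists x.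
Qed.

(** The corner B of a pullback square carries two exact sequences: one ending in W with kernel X
    and, when h is onto, one ending in Y with the kernel of h. Schanuel's lemma and dimension
    shifting compare the two. *)
Lemma pullback_ses X Y Z W (f : {linear X -> Y}) (g : {linear Y -> Z})
    (h : {linear W -> Z}) : ses f g ->
  exists B (u : {linear X -> B}) (v : {linear B -> W}) (w : {linear B -> Y}),
  [/\ ses u v, forall b, h (v b) = g (w b), forall x, w (u x) = f x
    & forall K (i : {linear K -> W}), ses i h ->
      exists j : {linear K -> B}, ses j w /\ forall k, v (j k) = i k].
Proof.
move=> S; have [fi fe gs] := S.
have [B [v [w [hvw ex inj]]]] := pullback_ex h g.
have wi b : v b = 0 -> w b = 0 -> b = 0 by exact: inj.
have [|||u uE] := @ex_lin_rel _ X B (fun x b => v b = 0 /\ w b = f x).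
- by move=> x; apply: ex; rewrite linear0 (ses0 _ S).
- move=> x b b' [v1 w1] [v2 w2]; apply/eqP; rewrite -subr_eq0; apply/eqP/inj.
    by rewrite linearB v1 v2 subrr.
  by rewrite linearB w1 w2 subrr.
- move=> a x x' b b' [v1 w1] [v2 w2]; rewrite !linearP v1 v2 w1 w2.
  by rewrite scaler0 addr0.
exists B, u, v, w; split=> //.
- split.
  + by apply: lin_inj => x ux; apply: (lin_inj0 fi); rewrite -(uE x).2 ux linear0.
  + move=> b; split=> [vb|[x <-]]; last by rewrite (uE x).1.
    have /fe[x xE] : g (w b) = 0 by rewrite -hvw vb linear0.
    exists x; apply/eqP; rewrite -subr_eq0; apply/eqP/inj.
      by rewrite linearB vb (uE x).1 subrr.
    by rewrite linearB (uE x).2 xE subrr.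
  + move=> y; have [y' y'E] := gs (h y).
    by have [b [<- _]] := ex y y' (esym y'E); exists b.
- by move=> x; rewrite (uE x).2.
- move=> K i Sh; have [ii ie hs] := Sh.
  have [|||j jE] := @ex_lin_rel _ K B (fun k b => v b = i k /\ w b = 0).
  + by move=> k; apply: ex; rewrite linear0 (ses0 _ Sh).
  + move=> k b b' [v1 w1] [v2 w2]; apply/eqP; rewrite -subr_eq0; apply/eqP/inj.
      by rewrite linearB v1 v2 subrr.
    by rewrite linearB w1 w2 subrr.
  + move=> a k k' b b' [v1 w1] [v2 w2]; rewrite !linearP v1 v2 w1 w2.
    by rewrite scaler0 addr0.
  exists j; split=> [|k]; last by rewrite (jE k).1.
  split.
  + by apply: lin_inj => k jk; apply: (lin_inj0 ii); rewrite -(jE k).1 jk linear0.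
  + move=> b; split=> [wb|[k <-]]; last by rewrite (jE k).2.
    have /ie[k kE] : h (v b) = 0 by rewrite hvw wb linear0.
    exists k; apply/eqP; rewrite -subr_eq0; apply/eqP/inj.
      by rewrite linearB (jE k).1 kE subrr.
    by rewrite linearB wb (jE k).2 subrr.
  + by move=> y; have [x xE] := hs (g y); have [b [_ <-]] := ex x y xE; exists b.
Qed.

(** L is the preimage of X in Q; it is filtered by K and X. *)
Lemma ses_compose X Y Z K Q (f : {linear X -> Y}) (g : {linear Y -> Z})
    (i : {linear K -> Q}) (p : {linear Q -> Y}) : ses f g -> ses i p ->
  exists L (j : {linear L -> Q}) (a : {linear K -> L}) (b : {linear L -> X}),
  [/\ ses j (linc g p), ses a b, forall k, j (a k) = i k
    & forall l, f (b l) = p (j l)].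
Proof.
move=> Sf Si; have [fi fe gs] := Sf; have [ii ie ps] := Si.
have [L [j Sj]] := ses_ker (ses_comp_surj ps gs); have [ji je _] := Sj.
have [|a aE] := lift_ker (h := i) ji je.
  by move=> k /=; rewrite (ses0 _ Si) linear0.
have [|b bE] := lift_ker (h := linc p j) fi fe.
  by move=> l; have := ses0 l Sj.
exists L, j, a, b; split=> //; split.
- by move=> k k' e; apply: ii; rewrite -!aE e.
- move=> l; split=> [bl|[k <-]].
    have /ie[k kE] : p (j l) = 0 by have := bE l; rewrite bl linear0 => /= <-.
    by exists k; apply: ji; rewrite aE.
  by apply: fi; rewrite bE /= aE (ses0 _ Si) linear0.
- move=> x; have [q qE] := ps (f x).
  have /je[l lE] : linc g p q = 0 by rewrite /= qE (ses0 _ Sf).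
  by exists l; apply: fi; rewrite bE /= lE.
Qed.

(** Ext^1(M, N) = 0 without a choice of resolution: maps to N extend along every monomorphism with
    cokernel M. By pushout this says that all extensions of M by N split. *)
Definition ext1 M N : Prop :=
  forall X Y (f : {linear X -> Y}) (g : {linear Y -> M}), ses f g ->
  forall h : {linear X -> N}, exists k : {linear Y -> N}, forall x, k (f x) = h x.

Lemma ext1_proj P N : projective P -> ext1 P N.
Proof.
move=> pP X Y f g S h; have [s gs] := ses_proj_section S pP.
have [r [fr _]] := ses_section_retraction S gs.
by exists (linc h r) => x /=; rewrite fr.
Qed.

(** With L the preimage of X in the extension B of Y by A, the map is extended from A to L and then
    from L to B. *)
Lemma ext1_half X Y Z N (f : {linear X -> Y}) (g : {linear Y -> Z}) :
  ses f g -> ext1 X N -> ext1 Z N -> ext1 Y N.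
Proof.
move=> Sf eX eZ A B a b Sa h; have [_ _ gs] := Sf; have [_ _ bs] := Sa.
have [L [j [a' [b' [Sj Sa' ja bE]]]]] := ses_compose Sf Sa.
have [k kE] := eX _ _ _ _ Sa' h; have [k' k'E] := eZ _ _ _ _ Sj k.
by exists k' => x; rewrite -ja k'E kE.
Qed.

(** The extension of X is pulled back along the retraction of Y; e embeds B as a section of the
    pullback, and the extended map is restricted along it. *)
Lemma ext1_retract1 X Y N : retract X Y -> ext1 Y N -> ext1 X N.
Proof.
move=> [i [r ir]] eY A B a b Sa h.
have [D [u [v [w [Su vw wu _]]]]] := pullback_ses r Sa.
have [k kE] := eY _ _ _ _ Su h.
have [_ _ bs] := Sa; have [ai ae _] := Sa.
have [e [eE1 eE2]] : exists e : {linear B -> D},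
    (forall x, w (e x) = x) /\ (forall x, v (e x) = i (b x)).
  have [ui ue vs] := Su.
  have [|||e eE] := @ex_lin_rel _ B D (fun x d => w d = x /\ v d = i (b x)).
  - move=> x; have [d dE] := vs (i (b x)).
    have /ae[y yE] : b (x - w d) = 0 by rewrite linearB -vw dE ir subrr.
    exists (d + u y); rewrite !linearD wu yE addrC subrK; split=> //.
    by rewrite (ses0 _ Su) addr0.
  - move=> x d d' [w1 v1] [w2 v2]; apply/eqP; rewrite -subr_eq0; apply/eqP.
    have /ue[y yE] : v (d - d') = 0 by rewrite linearB v1 v2 subrr.
    rewrite -yE; have : w (u y) = 0 by rewrite yE linearB w1 w2 subrr.
    by rewrite wu => /(lin_inj0 ai) ->; rewrite linear0.
  - move=> c x x' d d' [w1 v1] [w2 v2]; by rewrite !linearP w1 w2 v1 v2.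
  by exists e; split=> x; have [] := eE x.
exists (linc k e) => x /=; rewrite -kE; congr (k _).
have [ui ue vs] := Su.
have /ue[y yE] : v (e (a x)) = 0 by rewrite eE2 (ses0 _ Sa) linear0.
by rewrite -yE; congr (u _); apply: ai; rewrite -wu yE eE1.
Qed.

Lemma ext1_retract2 M N N' : retract N' N -> ext1 M N -> ext1 M N'.
Proof.
move=> [i [r ir]] eM A B a b Sa h; have [k kE] := eM _ _ _ _ Sa (linc i h).
by exists (linc r k) => x /=; rewrite kE /= ir.
Qed.

(** Pulled back to the projective P, any extension of M splits; after correction by a map on P,
    which the premise provides, the splitting descends along D -> B. *)
Lemma ext1_pres Z P M N (i : {linear Z -> P}) (p : {linear P -> M}) :
  projective P -> ses i p ->
  (forall h : {linear Z -> N}, exists k : {linear P -> N}, forall z, k (i z) = h z) ->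
  ext1 M N.
Proof.
move=> pP Si H A B a b Sa h.
have [D [u [v [w [Su vw wu /(_ _ _ Si)[j [Sj vj]]]]]]] := pullback_ses p Sa.
have [s vs] := ses_proj_section Su pP.
have [r [ur rE]] := ses_section_retraction Su vs.
have [k kE] := H (linc h (linc r j)).
have [ji je ws] := Sj.
have [|k' k'E] :=
    desc_coker (h := linD (linc h r) (linN (linc k v))) je ws.
  by move=> z /=; rewrite vj kE /= subrr.
by exists k' => x; rewrite -wu k'E /= ur (ses0 _ Su) linear0 subr0.
Qed.

Lemma ext1_half2 M N1 N2 N3 (f : {linear N1 -> N2}) (g : {linear N2 -> N3})
    Z P (i : {linear Z -> P}) (p : {linear P -> M}) :
  projective P -> ses i p -> ses f g -> ext1 M N1 -> ext1 M N3 -> ext1 M N2.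
Proof.
move=> pP Si Sf e1 e3; apply: (ext1_pres pP Si) => h.
have [fi fe gs] := Sf.
have [k kE] := e3 _ _ _ _ Si (linc g h).
have [k' k'E] := pP _ _ g k gs.
have [|d dE] := lift_ker (h := linD h (linN (linc k' i))) fi fe.
  by move=> z /=; rewrite linearB /= k'E kE subrr.
have [l lE] := e1 _ _ _ _ Si d.
by exists (linD k' (linc f l)) => z /=; rewrite lE dE /= addrC subrK.
Qed.

Lemma ext1_splits X Y Z (f : {linear X -> Y}) (g : {linear Y -> Z}) :
  ses f g -> ext1 Z X -> exists r : {linear Y -> X}, cancel f r.
Proof. by move=> Sf /(_ _ _ _ _ Sf (lin1 X))[r rE]; exists r. Qed.

Section Syzygies.
Variable Q0 : lmodType R -> Prop.
Hypothesis Q0A : forall X Y P (f : {linear X -> Y}) (g : {linear Y -> P}),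
  ses f g -> projective P -> Q0 X <-> Q0 Y.

(** Q0 holds for some n-th syzygy. If Q0 is insensitive to adding a projective, the choice does not
    matter ([syz_any]), and one set of inductions serves both projective dimension and higher
    Ext. *)
Fixpoint syz n M : Prop :=
  if n is m.+1 then exists Z P (i : {linear Z -> P}) (p : {linear P -> M}),
    [/\ projective P, ses i p & syz m Z]
  else Q0 M.

(** Here Y is the direct sum of X and P. A cover Q of X gives the cover Q x P of Y, and a cover of
    Y, cut down to the preimage of X, covers X; the kernel is the same in both cases. *)
Lemma syzA n X Y P (f : {linear X -> Y}) (g : {linear Y -> P}) :
  ses f g -> projective P -> syz n X <-> syz n Y.
Proof.
elim: n X Y P f g => [|n IH] X Y P f g Sf pP; first exact: Q0A Sf pP.
have [s gs] := ses_proj_section Sf pP; have [fi fe gsu] := Sf.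
split=> -[Z [Q [i [p [pQ Si hZ]]]]]; have [ii ie ps] := Si.
  have [r [fr rE]] := ses_section_retraction Sf gs.
  exists Z, (Q * P)%type, (lin_pair i (lin0 Z P)), (lin_copair (linc f p) s).
  split=> //; first exact: proj_pair.
  split.
  - by move=> z z' [] /ii.
  - move=> [q x]; split=> [/= e|[z [<- <-]]] /=; last first.
      by rewrite (ses0 _ Si) !linear0 addr0.
    have x0 : x = 0.
      have := congr1 g e; rewrite linear0 linearD /= (ses0 _ Sf) add0r.
      by rewrite gs.
    move: e; rewrite x0 linear0 addr0 => /(lin_inj0 fi)/ie[z <-].
    by exists z.
  - move=> y; have [q qE] := ps (r y); exists (q, g y).
    by rewrite /= qE rE subrK.
have [L [j [a [b [Sj Sa _ _]]]]] := ses_compose Sf Si.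
have pL : projective L.
  have [s' gs'] := ses_proj_section Sj pP.
  have [r' [fr' _]] := ses_section_retraction Sj gs'.
  by apply: (retract_proj _ pQ); exists j, r'.
by exists Z, L, a, b.
Qed.

(** Schanuel's lemma: the pullback of the two covers of M is an extension of P by Z' and of P' by
    Z. *)
Lemma syz_any n Z P M (i : {linear Z -> P}) (p : {linear P -> M}) :
  projective P -> ses i p -> syz n.+1 M -> syz n Z.
Proof.
move=> pP Si [Z' [P' [i' [p' [pP' Si' hZ']]]]].
have [B [u [v [w [Su _ _ /(_ _ _ Si)[j [Sj _]]]]]]] := pullback_ses p Si'.
by apply/(syzA n Sj pP')/(syzA n Su pP).
Qed.

Lemma syz_iso n X Y (f : {linear X -> Y}) :
  injective f -> surjective_map f -> syz n X <-> syz n Y.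
Proof.
move=> fi fs; apply: (@syzA n _ _ (free R 0) f (lin0 _ _)); last exact: proj_free.
split=> //; last by move=> u; exists 0; apply/ffunP => -[].
Qed.

Hypothesis Q0H : forall X Y Z (f : {linear X -> Y}) (g : {linear Y -> Z}),
  ses f g -> Q0 X -> Q0 Z -> Q0 Y.

(** Horseshoe lemma: P x Q covers Y, by the cover of X and a lift of the cover of Z. *)
Lemma syz_half n X Y Z (f : {linear X -> Y}) (g : {linear Y -> Z}) :
  ses f g -> syz n X -> syz n Z -> syz n Y.
Proof.
elim: n X Y Z f g => [|n IH] X Y Z f g Sf; first exact: Q0H Sf.
move=> [K1 [P [i1 [p1 [pP S1 h1]]]]] [K2 [Q [i2 [p2 [pQ S2 h2]]]]].
have [fi fe gs] := Sf; have [_ e1 s1] := S1; have [_ e2 s2] := S2.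
have [l lE] := pQ _ _ g p2 gs.
pose p := lin_copair (linc f p1) l.
have ps : surjective_map p.
  move=> y; have [q qE] := s2 (g y).
  have /fe[x xE] : g (y - l q) = 0 by rewrite linearB lE qE subrr.
  by have [x' x'E] := s1 x; exists (x', q); rewrite /= x'E xE subrK.
have [L [j Sj]] := ses_ker ps; have [ji je _] := Sj.
exists L, (P * Q)%type, j, p; split=> //; first exact: proj_pair.
have [i1i _ _] := S1; have [i2i _ _] := S2.
have pj l' : f (p1 (j l').1) + l (j l').2 = 0 by have := ses0 l' Sj.
have [|a aE] := lift_ker (h := lin_pair i1 (lin0 K1 Q)) ji je.
  by move=> k /=; rewrite (ses0 _ S1) !linear0 addr0.
have [|b bE] := lift_ker (h := linc (lin_snd P Q) j) i2i e2.
  move=> l' /=; have := congr1 g (pj l'); rewrite linear0 linearD /=.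
  by rewrite (ses0 _ Sf) add0r lE.
apply: (IH _ _ _ a b) => //; split.
- by move=> k k' e; apply: i1i; have := aE k; rewrite e aE => -[].
- move=> l'; split=> [bl|[k <-]]; last first.
    by apply: i2i; rewrite bE /= aE linear0.
  have l2 : (j l').2 = 0 by have := bE l'; rewrite bl linear0 /= => <-.
  have := pj l'; rewrite l2 linear0 addr0 => /(lin_inj0 fi)/e1[k kE].
  by exists k; apply: ji; rewrite aE /= kE -l2 -surjective_pairing.
- move=> k; have : g (l (i2 k)) = 0 by rewrite lE (ses0 _ S2).
  move=> /fe[x xE]; have [q qE] := s1 x.
  have /je[l' l'E] : p (- q, i2 k) = 0 by rewrite /= !linearN /= qE xE addNr.
  by exists l'; apply: i2i; rewrite bE /= l'E.
Qed.

(** The pullback B of Y and the cover P of Z is X up to a projective, and also an extension of Y by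
    the syzygy L. *)
Lemma syz_left n X Y Z (f : {linear X -> Y}) (g : {linear Y -> Z}) :
  ses f g -> syz n Y -> syz n.+1 Z -> syz n X.
Proof.
move=> Sf hY [L [P [i [p [pP Si hL]]]]].
have [B [u [v [w [Su _ _ /(_ _ _ Si)[j [Sj _]]]]]]] := pullback_ses p Sf.
by apply/(syzA n Su pP)/(syz_half Sj).
Qed.

Lemma syz_right n X Y Z (f : {linear X -> Y}) (g : {linear Y -> Z}) :
  ses f g -> syz n X -> syz n.+1 Y -> syz n.+1 Z.
Proof.
move=> Sf hX [K [P [i [p [pP Si hK]]]]].
have [L [j [a [b [Sj Sa _ _]]]]] := ses_compose Sf Si.
by exists L, P, j, (linc g p); split=> //; apply: (syz_half Sa).
Qed.

End Syzygies.

Lemma proj_ses X Y P (f : {linear X -> Y}) (g : {linear Y -> P}) :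
  ses f g -> projective P -> projective X <-> projective Y.
Proof.
move=> Sf pP; have [s gs] := ses_proj_section Sf pP.
have [r [fr rE]] := ses_section_retraction Sf gs.
split=> h; last by apply: retract_proj h; exists f, r.
apply: retract_proj (proj_pair h pP).
by exists (lin_pair r g), (lin_copair f s) => y /=; rewrite rE subrK.
Qed.

Lemma ext1_ses N X Y P (f : {linear X -> Y}) (g : {linear Y -> P}) :
  ses f g -> projective P -> ext1 X N <-> ext1 Y N.
Proof.
move=> Sf pP; split=> [h|]; first exact: (ext1_half Sf h (@ext1_proj P N pP)).
have [s gs] := ses_proj_section Sf pP.
have [r [fr rE]] := ses_section_retraction Sf gs.
by apply: ext1_retract1; exists f, r.
Qed.

Definition pdle := syz (@projective R).
(** Index shift: [extv N n M] is the vanishing of Ext^(n+1)(M, N), so that [perp] is vanishing in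
    all positive degrees. *)
Definition extv N := syz (ext1^~ N).
Definition perp N M : Prop := forall n, extv N n M.

Lemma proj_half X Y Z (f : {linear X -> Y}) (g : {linear Y -> Z}) :
  ses f g -> projective X -> projective Z -> projective Y.
Proof. by move=> Sf pX pZ; apply/(proj_ses Sf pZ). Qed.

Lemma pdle_half n X Y Z (f : {linear X -> Y}) (g : {linear Y -> Z}) :
  ses f g -> pdle n X -> pdle n Z -> pdle n Y.
Proof. exact: (syz_half proj_half). Qed.

Lemma pdle_left n X Y Z (f : {linear X -> Y}) (g : {linear Y -> Z}) :
  ses f g -> pdle n Y -> pdle n.+1 Z -> pdle n X.
Proof. exact: (syz_left proj_ses proj_half). Qed.

Lemma pdle_right n X Y Z (f : {linear X -> Y}) (g : {linear Y -> Z}) :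
  ses f g -> pdle n X -> pdle n.+1 Y -> pdle n.+1 Z.
Proof. exact: (syz_right proj_half). Qed.

Lemma pdle_any n Z P M (i : {linear Z -> P}) (p : {linear P -> M}) :
  projective P -> ses i p -> pdle n.+1 M -> pdle n Z.
Proof. exact: (syz_any proj_ses). Qed.

Lemma pdle_iso n X Y (f : {linear X -> Y}) :
  injective f -> surjective_map f -> pdle n X <-> pdle n Y.
Proof. exact: (syz_iso proj_ses). Qed.

Lemma ses_zero M : ses (lin0 (free R 0) M) (lin1 M).
Proof.
split; first by move=> u v _; apply/ffunP => -[].
  by move=> y; split=> [/= ->|[x <-]]; [exists 0|].
by move=> y; exists y.
Qed.

Lemma pdleS n M : pdle n M -> pdle n.+1 M.
Proof.
elim: n M => [|n IH] M; last first.
  move=> [Z [P [i [p [pP Si hZ]]]]]; exists Z, P, i, p; split=> //; exact: IH.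
move=> pM; exists (free R 0), M, (lin0 _ _), (lin1 M); split=> //; last exact: proj_free.
exact: ses_zero.
Qed.

Lemma pdle_mono n m M : (n <= m)%N -> pdle n M -> pdle m M.
Proof. by move=> /subnK <- h; elim: (m - n)%N => // k; exact: pdleS. Qed.

Lemma perp_proj N P : projective P -> perp N P.
Proof.
move=> pP n; elim: n P pP => [|n IH] P pP; first exact: ext1_proj.
exists (free R 0), P, (lin0 _ _), (lin1 P); split=> //; first exact: ses_zero.
exact/IH/proj_free.
Qed.

Lemma perp_iso N X Y (f : {linear X -> Y}) :
  injective f -> surjective_map f -> perp N X -> perp N Y.
Proof.
by move=> fi fs h n; apply/(@syz_iso (ext1^~ N) (@ext1_ses N) n _ _ f fi fs)/h.
Qed.

(** Dimension shifting costs one degree at Z, which vanishing in all positive degrees absorbs. *)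
Lemma perp_left N X Y Z (f : {linear X -> Y}) (g : {linear Y -> Z}) :
  ses f g -> perp N Y -> perp N Z -> perp N X.
Proof.
move=> Sf hY hZ n; apply: (syz_left (@ext1_ses N) _ Sf (hY n) (hZ n.+1)).
by move=> X1 X2 X3 f1 f2 S1 h1 h3; exact: (ext1_half S1 h1 h3).
Qed.

Lemma perp_syz N Z P M (i : {linear Z -> P}) (p : {linear P -> M}) :
  projective P -> ses i p -> ext1 M N -> perp N Z -> perp N M.
Proof. by move=> pP Si e h [|n] //; exists Z, P, i, p. Qed.

End Homological.

(** * Resolutions, coresolutions and strong tilting modules *)

Section Resolutions.
Variable R : pzRingType.
Implicit Types M N X Y Z P T C : lmodType R.

Section Cons.
Variables (Z P M : lmodType R) (i : {linear Z -> P}) (p : {linear P -> M}).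
Variable r : proj_resolution Z.

Definition cons_obj n : lmodType R := if n is m.+1 then res_obj r m else P.
Definition cons_diff n : {linear cons_obj n.+1 -> cons_obj n} :=
  match n return {linear cons_obj n.+1 -> cons_obj n} with
  | 0 => linc i (res_aug r)
  | m.+1 => res_diff r m
  end.

Lemma res_cons : projective P -> ses i p ->
  exists r' : proj_resolution M, forall n, res_obj r' n = cons_obj n.
Proof.
move=> pP Si; have [ii ie ps] := Si.
have h1 n : projective (cons_obj n) by case: n => //= n; exact: res_projective.
have h2 : exact_at (cons_diff 0) p.
  move=> y; split=> [/ie[z <-]|[x <-]] /=; last exact: (ses0 _ Si).
  by have [x <-] := @res_surj _ _ r z; exists x.
have h3 n : exact_at (cons_diff n.+1) (cons_diff n).
  case: n => [|n]; last exact: res_exact.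
  move=> y; rewrite -(@res_exact0 _ _ r y) /=; split=> [/(lin_inj0 ii) //|->].
  exact: linear0.
by exists (ProjResolution h1 ps h2 h3).
Qed.
End Cons.

Lemma pdle_resolution n M : pdle n M ->
  exists r : proj_resolution M, forall m, (n < m)%N -> is_zero (res_obj r m).
Proof.
elim: n M => [|n IH] M.
  move=> pM; pose ob m := if m is 0 then M else free R 0.
  have z0 (u v : free R 0) : u = v by apply/ffunP => -[].
  have h1 m : projective (ob m) by case: m => //= m; exact: proj_free.
  have h2 : exact_at (lin0 (ob 1%N) (ob 0%N)) (lin1 M).
    by move=> y; split=> [/= ->|[x <-]]; [exists 0|].
  have h3 m : exact_at (lin0 (ob m.+2) (ob m.+1)) (lin0 (ob m.+1) (ob m)).
    by move=> y; split=> // _; exists 0; exact: z0.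
  have hs : surjective_map (lin1 M) by move=> x; exists x.
  by exists (ProjResolution h1 hs h2 h3) => -[|m] //= _ u; exact: z0.
move=> [Z [P [i [p [pP Si /IH[r rP]]]]]].
have [r' r'E] := res_cons r pP Si.
by exists r' => -[|m] // nm; rewrite r'E; exact: rP.
Qed.

(** Z is the first syzygy of the given resolution and the rest of the resolution resolves it; this
    turns statements on resolutions into inductions on [syz]. *)
Lemma res_shift M (r : proj_resolution M) :
  exists Z (i : {linear Z -> res_obj r 0}) (a : {linear res_obj r 1 -> Z}),
  [/\ ses i (res_aug r), surjective_map a, exact_at (res_diff r 1) a
    & forall x, i (a x) = res_diff r 0 x].
Proof.
have [Z [i Si]] := ses_ker (@res_surj _ _ r); have [ii ie _] := Si.
have [|a aE] := lift_ker (h := res_diff r 0) ii ie.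
  by move=> x; apply/(@res_exact0 _ _ r); exists x.
exists Z, i, a; split=> //.
  move=> z; have /(@res_exact0 _ _ r)[x xE] : res_aug r (i z) = 0 by exact: (ses0 _ Si).
  by exists x; apply: ii; rewrite aE.
move=> y; rewrite -(@res_exact _ _ r 0 y) -aE.
by split=> [->|/(lin_inj0 ii) //]; exact: linear0.
Qed.

Lemma resolution_pdle n M (r : proj_resolution M) :
  (forall m, (n < m)%N -> is_zero (res_obj r m)) -> pdle n M.
Proof.
elim: n M r => [|n IH] M r rz.
  apply/(pdle_iso _ (f := res_aug r)); last exact: (@res_projective _ _ r 0%N).
    apply: lin_inj => x /(@res_exact0 _ _ r)[y <-].
    by rewrite (rz 1%N isT y) linear0.
  exact: res_surj.
have [Z [i [a [Si sa ea aE]]]] := res_shift r.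
exists Z, (res_obj r 0), i, (res_aug r); split=> //; first exact: res_projective.
pose r' := ProjResolution (fun m => @res_projective _ _ r m.+1) sa ea
  (fun m => @res_exact _ _ r m.+1).
by apply: (IH Z r') => m nm; exact: rz.
Qed.

Lemma finite_pdP M : finite_pd M <-> exists n, pdle n M.
Proof.
split=> [[r [n rz]]|[n /pdle_resolution[r rz]]]; last by exists r, n.
by exists n; exact: resolution_pdle rz.
Qed.

Lemma extv_resolution n M N (r : proj_resolution M) : extv N n M ->
  forall f : {linear res_obj r n.+1 -> N}, cocycle f -> coboundary f.
Proof.
elim: n M r => [|n IH] M r h f cf.
  have [Z [i [a [Si sa ea aE]]]] := res_shift r.
  have [k kE] := desc_coker ea sa cf.
  have [l lE] := h _ _ _ _ Si k.
  by exists l => x; rewrite -kE -lE aE.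
have [Z [i [a [Si sa ea aE]]]] := res_shift r.
pose r' := ProjResolution (fun m => @res_projective _ _ r m.+1) sa ea
  (fun m => @res_exact _ _ r m.+1).
apply: (IH Z r' _ f cf).
have H := @syz_any R (fun X => ext1 X N) (@ext1_ses _ N) n Z _ M i (res_aug r) (@res_projective _ _ r 0%N) Si h.
exact: H.
Qed.

(** [Ext_zero] ranges over all resolutions and would hold vacuously if there were none, hence the
    first premise. *)
Lemma Ext_zero1 M N : (exists r : proj_resolution M, True) ->
  Ext_zero 1 M N -> ext1 M N.
Proof.
move=> [r _] h; have [Z [i [a [Si sa ea aE]]]] := res_shift r.
apply: (ext1_pres (@res_projective _ _ r 0%N) Si) => g.
have [|l lE] := h r (linc g a); first by move=> x /=; rewrite (exact0 _ ea) linear0.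
by exists l => z; have [x <-] := sa z; rewrite aE -lE.
Qed.

Lemma in_add_retract T X Y : retract X Y -> in_add T Y -> in_add T X.
Proof.
move=> rXY /in_addP[n rY]; apply/in_addP; exists n; exact: retract_trans rY.
Qed.

(** Coresolutions in add T read one cokernel at a time; s counts the remaining steps, and at s = 0
    the module itself lies in add T. *)
Fixpoint coresk T s X : Prop :=
  if s is s'.+1 then exists C X' (f : {linear X -> C}) (g : {linear C -> X'}),
    [/\ ses f g, in_add T C & coresk T s' X']
  else in_add T X.

Lemma coresk_iso T s X Y (f : {linear X -> Y}) (g : {linear Y -> X}) :
  cancel f g -> cancel g f -> coresk T s Y -> coresk T s X.
Proof.
move=> fg gf; case: s => [|s] /=.
  by apply: in_add_retract; exists f, g.
move=> [C [X' [a [b [Sa hC hX]]]]]; have [ai ae bs] := Sa.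
exists C, X', (linc a f), b; split=> //; split=> //.
  by move=> x y /ai/(can_inj fg).
move=> y; rewrite ae; split=> -[x <-]; first by exists (g x); rewrite /= gf.
by exists (f x).
Qed.

Definition coresolution T s X : Prop :=
  exists (C : nat -> lmodType R)
    (d : forall n, {linear C n -> C n.+1}) (eta : {linear X -> C 0%N}),
  [/\ injective eta, exact_at eta (d 0%N),
      forall n, exact_at (d n) (d n.+1),
      forall n, (n <= s)%N -> in_add T (C n)
    & forall n, (s < n)%N -> is_zero (C n)].

Lemma coresolution_coresk T s X : coresolution T s X -> coresk T s X.
Proof.
elim: s X => [|s IH] X [C [d [eta [ei ee de hC zC]]]].
  have es : surjective_map eta by move=> y; apply/ee/(zC 1%N).
  have [g [eg ge]] := inv_ex ei es.
  by apply: in_add_retract (hC 0%N isT); exists eta, g.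
have [X' [g Sg]] := ses_coker ei; have [_ ge gs] := Sg.
have [|e' e'E] := desc_coker (h := d 0%N) ge gs; first by move=> x; exact: exact0.
exists (C 0%N), X', eta, g; split=> //; first exact: hC.
apply: IH; exists (fun n => C n.+1), (fun n => d n.+1), e'; split=> //.
- apply: lin_inj => x'; have [c <-] := gs x'.
  by rewrite e'E => /ee[x <-]; exact: (ses0 _ Sg).
- move=> y; rewrite (de 0%N y); split=> [[c <-]|[x' <-]].
    by exists (g c); rewrite e'E.
  by have [c <-] := gs x'; exists c; rewrite e'E.
- by move=> n ns; exact: hC.
- by move=> n ns; exact: zC.
Qed.

Section ConsC.
Variables (X C X' : lmodType R) (f : {linear X -> C}) (g : {linear C -> X'}).
Variables (D : nat -> lmodType R) (d : forall n, {linear D n -> D n.+1}).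
Variable eta : {linear X' -> D 0%N}.
Let Ob n : lmodType R := if n is m.+1 then D m else C.
Let df n : {linear Ob n -> Ob n.+1} :=
  match n return {linear Ob n -> Ob n.+1} with
  | 0 => linc eta g | m.+1 => d m end.

Lemma coresolution_cons T s : ses f g -> in_add T C ->
  injective eta -> exact_at eta (d 0%N) -> (forall n, exact_at (d n) (d n.+1)) ->
  (forall n, (n <= s)%N -> in_add T (D n)) ->
  (forall n, (s < n)%N -> is_zero (D n)) -> coresolution T s.+1 X.
Proof.
move=> Sf hC ei ee de hD zD; have [fi fe gs] := Sf.
exists Ob, df, f; split=> //.
- move=> y; rewrite -(fe y) /=; split=> [/(lin_inj0 ei) //|->]; exact: linear0.
- case=> [|n]; last exact: de.
  move=> y /=; rewrite (ee y); split=> [[x' <-]|[c <-]]; last by exists (g c).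
  by have [c <-] := gs x'; exists c.
- by case=> [|n] //; exact: hD.
- by case=> [|n] //; exact: zD.
Qed.
End ConsC.

Lemma coresk_coresolution T s X : coresk T s X -> coresolution T s X.
Proof.
elim: s X => [|s IH] X.
  move=> hX; exists (fun n => if n is 0 then X else free R 0).
  exists (fun n => lin0 _ _), (lin1 X).
  have z0 (u v : free R 0) : u = v by apply/ffunP => -[].
  split=> //.
  - by move=> y; split=> // _; exists y.
  - by move=> n y; split=> // _; exists 0; exact: z0.
  - by case.
  - by case=> // n _ u; exact: z0.
move=> [C [X' [f [g [Sf hC /IH[D [d [eta [ei ee de hD zD]]]]]]]]].
exact: (coresolution_cons Sf hC ei ee de hD zD).
Qed.

Definition noeth : Prop :=
  forall X Y (i : {linear X -> Y}), injective i -> fin_gen Y -> fin_gen X.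

Definition fgpd n M : Prop := fin_gen M /\ pdle n M.
Definition fpd M : Prop := exists n, fgpd n M.

(** Only Ext^1 appears: over a noetherian ring the class of the modules M is closed under syzygies
    of finitely generated covers, so higher Ext vanishes by dimension shifting. Self-orthogonality
    is included, since T is one of the M. *)
Definition fstrong T : Prop :=
  [/\ fpd T, exists s, coresk T s (R^o : lmodType R)
    & forall M, fpd M -> ext1 M T].

Lemma fin_pd_moduleP M : fin_pd_module M <-> fpd M.
Proof.
by split=> [[gM /finite_pdP[n h]]|[n [gM h]]]; [exists n|split=> //; apply/finite_pdP; exists n].
Qed.

Lemma fpd_cover : noeth -> forall n M, fgpd n.+1 M ->
  exists k Z (i : {linear Z -> free R k}) (p : {linear free R k -> M}),
    ses i p /\ fgpd n Z.
Proof.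
move=> hR n M [gM hM]; have [k [p ps]] := (fin_genP M).1 gM.
have [Z [i Si]] := ses_ker ps; exists k, Z, i, p; split=> //; split.
  by case: Si => ii _ _; exact: hR ii (fin_gen_free R k).
exact: (@pdle_any R n Z (free R k) M i p (@proj_free R k) Si hM).
Qed.

Lemma fgpdS n M : fgpd n M -> fgpd n.+1 M.
Proof. by case=> gM /pdleS. Qed.

Lemma fpd_perp T : noeth -> (forall M, fpd M -> ext1 M T) ->
  forall M, fpd M -> perp T M.
Proof.
move=> hR hT M [n hM] m; elim: m M hM => [|m IH] M hM; first by apply: hT; exists n.
have [k [Z [i [p [Si hZ]]]]] := fpd_cover hR (fgpdS hM).
by exists Z, (free R k), i, p; split=> //; [exact: proj_free|exact: IH].
Qed.

Lemma strong_tiltingP T : noeth -> strong_tilting T <-> fstrong T.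
Proof.
move=> hR; split=> [[[h1 h2 [s h3]] h4]|[h1 [s h2] h3]].
  split; first exact/fin_pd_moduleP.
    by exists s; exact: coresolution_coresk.
  move=> M /fin_pd_moduleP hM; apply: Ext_zero1; last exact: h4.
  by case: hM => _ [r _]; exists r.
have hE M : fin_pd_module M -> forall n, (1 <= n)%N -> Ext_zero n M T.
  move=> /fin_pd_moduleP hM [//|n] _ r; apply: extv_resolution.
  exact: fpd_perp.
split=> //; split; first exact/fin_pd_moduleP.
  by apply: hE; apply/fin_pd_moduleP.
by exists s; exact: coresk_coresolution.
Qed.

End Resolutions.

(** * Finite dimensional algebras and dual modules *)

Section FieldModules.
Variable K : fieldType.
Implicit Types V W : lmodType K.

Lemma fin_gen_Ko V (f : {linear V -> (K^o : lmodType K)}) :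
  (forall v, f v = 0) \/ surjective_map f.
Proof.
case: (pselect (exists v, f v <> 0)) => [[v fv]|]; last first.
  by move=> h; left => v; apply: contrapT => fv; apply: h; exists v.
right=> c; exists (((c : K) / f v) *: v); rewrite linearZ /=.
have fv0 : (f v : K) != 0 by apply/negP => /eqP.
exact: (mulfVK fv0 c).
Qed.

Lemma fin_gen_sub_free n V (f : {linear V -> free K n}) : injective f -> fin_gen V.
Proof.
elim: n V f => [|n IH] V f fi.
  exists 0%N, (fun=> 0) => x; exists (fun=> 0); rewrite big_ord0.
  by apply: fi; apply/ffunP => -[].
pose l := linc (lin_proj (K^o : lmodType K) (@ord0 n)) f.
have [Z [i [ii ie]]] := ker_ex l.
have gZ : fin_gen Z.
  pose g := linc (lin_tuple (fun j : 'I_n => lin_proj (K^o : lmodType K) (lift ord0 j))) (linc f i).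
  apply: (IH _ g); apply: lin_inj => z gz; apply: (lin_inj0 ii); apply: (lin_inj0 fi).
  apply/ffunP => j; rewrite ffunE; case: (unliftP ord0 j) => [j' ->|->].
    by have := congr1 (fun u : free K n => u j') gz; rewrite !ffunE.
  exact: (exact0 z ie).
case: (fin_gen_Ko l) => [l0|ls].
  by apply: (fin_gen_surj (f := i) _ gZ) => v; apply/ie.
exact: (fin_gen_ext ie ls gZ (fin_gen_R K)).
Qed.

Lemma noeth_field : noeth K.
Proof.
move=> V W i ii /fin_genP[n [p ps]].
have [B [b [q [e1 e2 e3]]]] := pullback_ex i p.
apply: (fin_gen_surj (f := b)).
  by move=> v; have [u uE] := ps (i v); have [w [<- _]] := e2 v u (esym uE); exists w.
apply: (fin_gen_sub_free (f := q)); apply: lin_inj => w qw; apply: e3 => //.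
by apply: (lin_inj0 ii); rewrite e1 qw linear0.
Qed.

Definition spanned V n : Prop := exists p : {linear free K n -> V}, surjective_map p.

Definition kdim V n : Prop :=
  spanned V n /\ forall m, spanned V m -> (n <= m)%N.

Lemma kdim_ex V : fin_gen V -> exists n, kdim V n.
Proof.
move=> /fin_genP hV.
have h : exists n, `[< spanned V n >] by have [n hn] := hV; exists n; apply/asboolP.
exists (ex_minn h); case: ex_minnP => n /asboolP hn hm; split=> // m hm'.
by apply: hm; apply/asboolP.
Qed.

Lemma kdim_inj V n (p : {linear free K n -> V}) :
  kdim V n -> surjective_map p -> injective p.
Proof.
move=> [_ mn] ps; apply: lin_inj => u pu; apply: contrapT => u0.
have [i ui] : exists i, u i != 0.
  apply: contrapT => h; apply: u0; apply/ffunP => i; rewrite ffunE.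
  by apply/eqP/negPn/negP => ui; apply: h; exists i.
case: n p mn ps u pu {u0} i ui => [|n] p mn ps u pu i ui; first by case: i {ui}.
suff /mn : spanned V n by rewrite ltnn.
pose q := linc p (lin_cotuple (fun j : 'I_n => lin_inj_at (K^o : lmodType K) (lift i j))).
exists q => v; have [w <-] := ps v.
pose w' := w - (w i / u i : K) *: u.
have w'i : w' i = 0.
  rewrite !ffunE; have -> : (w i / u i) *: u i = w i by exact: mulfVK.
  exact: subrr.
exists [ffun j => w' (lift i j)].
have -> : p w = p w' by rewrite linearB linearZ /= pu scaler0 subr0.
have -> : q [ffun j => w' (lift i j)] =
    p (\sum_j lin_inj_at (K^o : lmodType K) (lift i j) (w' (lift i j))).
  by congr (p _); apply: eq_bigr => j _; rewrite ffunE.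
congr (p _); rewrite [RHS]ffun_decomp (bigD1_ord i) // w'i linear0.
by rewrite Monoid.mul1m.
Qed.

Lemma kdim_bij V W n (f : {linear V -> W}) :
  kdim V n -> kdim W n -> surjective_map f -> injective f.
Proof.
move=> [[p ps] _] hW fs; have ii := kdim_inj hW (ses_comp_surj ps fs).
by move=> x y; have [u <-] := ps x; have [v <-] := ps y => /ii ->.
Qed.

Lemma kbasis V : fin_gen V -> exists n (p : {linear V -> free K n}),
  injective p.
Proof.
move=> /kdim_ex[n hn]; have [[p ps] _] := hn.
have [q [pq qp]] := inv_ex (kdim_inj hn ps) ps.
by exists n, q; exact: can_inj qp.
Qed.

Section Functional.
Variables (V W : lmodType K) (f : {linear V -> W}) (l : V -> K).
Hypotheses (fi : injective f) (lL : forall c x y, l (c *: x + y) = c * l x + l y).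

Let graph (A : set (W * K)) : Prop :=
  [/\ forall w c c', A (w, c) -> A (w, c') -> c = c',
      forall a w w' c c', A (w, c) -> A (w', c') -> A (a *: w + w', a * c + c')
    & forall v, A (f v, l v)].

(** Zorn's lemma on graphs of partial extensions: injectivity quantifies over all modules, so W may
    have infinite dimension. *)
Lemma functional_ext : exists m : W -> K,
  (forall c x y, m (c *: x + y) = c * m x + m y) /\ forall v, m (f v) = l v.
Proof.
pose G := {A : set (W * K) | graph A}.
have g0 : graph (fun u => exists v, u = (f v, l v)).
  split.
  - by move=> w c c' [v [-> ->]] [v' [/fi -> ->]].
  - move=> a w w' c c' [v [-> ->]] [v' [-> ->]]; exists (a *: v + v').
    by rewrite linearP lL.
  - by move=> v; exists v.
pose r (A B : G) := `[< forall u, sval A u -> sval B u >].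
have [||||[A gA] mA] := @Zorn G r.
- by move=> A; apply/asboolP.
- by move=> A B C /asboolP h1 /asboolP h2; apply/asboolP => u /h1/h2.
- move=> [A gA] [B gB] /asboolP /= h1 /asboolP /= h2.
  by apply: eq_exist; apply/funext => u; apply/propext; split=> [/h1|/h2].
- move=> F tF; case: (pselect (exists A, F A)) => [[A0 FA0]|nF]; last first.
    by exists (exist _ _ g0) => A FA; case: nF; exists A.
  pose U u := exists2 A : G, F A & sval A u.
  have gU : graph U.
    split.
    + move=> w c c' [A FA Aw] [B FB Bw].
      case: (tF A B FA FB) => /asboolP h.
        by have [h1 _ _] := svalP B; exact: (h1 _ _ _ (h _ Aw) Bw).
      by have [h1 _ _] := svalP A; exact: (h1 _ _ _ Aw (h _ Bw)).
    + move=> a w w' c c' [A FA Aw] [B FB Bw].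
      case: (tF A B FA FB) => /asboolP h.
        by exists B => //; have [_ h2 _] := svalP B; apply: h2 => //; exact: h.
      by exists A => //; have [_ h2 _] := svalP A; apply: h2 => //; exact: h.
    + by move=> v; exists A0 => //; have [_ _ h3] := svalP A0; exact: h3.
  by exists (exist _ _ gU) => A FA; apply/asboolP => u Au; exists A.
have [A1 A2 A3] := gA.
have A00 : A (0, 0).
  have l0 : l 0 = 0 by rewrite -[X in l X](addNr 0) -scaleN1r lL mulN1r addNr.
  by have := A3 0; rewrite linear0 l0.
have tot w : exists c, A (w, c).
  apply: contrapT => nw.
  (* The graph enlarged by w with value 0; it stays single-valued because w has no value in A. *)
  pose B u := exists w' c a, A (w', c) /\ u = (w' + a *: w, c) :> W * K.
  have gB : graph B.
    split.
    - move=> v c c' [w1 [c1 [a1 [h1 [e1 ->]]]]] [w2 [c2 [a2 [h2 [e2 ->]]]]].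
      have := A2 (-1) _ _ _ _ h2 h1.
      have -> : -1 *: w2 + w1 = (a2 - a1) *: w.
        have -> : w1 = w2 + a2 *: w - a1 *: w by rewrite -e2 e1 addrK.
        by rewrite scaleN1r -addrA addKr scalerBl.
      case: (a2 =P a1) e2 => [-> e2|/eqP ne e2 h].
        rewrite e1 in e2; move/addIr: e2 => e2; rewrite e2 in h1.
        by rewrite (A1 _ _ _ h1 h2).
      case: nw; exists ((a2 - a1)^-1 * (-1 * c2 + c1)).
      have := A2 (a2 - a1)^-1 _ _ _ _ h A00.
      by rewrite !addr0 scalerA mulVf ?scale1r // subr_eq0.
    - move=> a v v' c c' [w1 [c1 [a1 [h1 [-> ->]]]]] [w2 [c2 [a2 [h2 [-> ->]]]]].
      exists (a *: w1 + w2), (a * c1 + c2), (a * a1 + a2); split; first exact: A2.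
      by rewrite scalerDr scalerDl scalerA addrACA.
    - by move=> v; exists (f v), (l v), 0; rewrite scale0r addr0.
  have AB : r (exist _ _ gA) (exist _ _ gB).
    by apply/asboolP => -[v c] h; exists v, c, 0; rewrite scale0r addr0.
  have e := mA _ AB; case: nw; exists 0.
  have -> : A = B by have := congr1 sval e.
  by exists 0, 0, 1; rewrite scale1r add0r.
have [m mA'] := choice tot; exists m; split.
  by move=> c x y; apply: A1 (mA' _) _; exact: A2.
by move=> v; apply: A1 (mA' _) (A3 v).
Qed.

End Functional.

End FieldModules.

Section KStructure.
Variables (K : fieldType) (R : pzRingType).
Implicit Types M N X Y : lmodType R.

(* A finite dimensional K-algebra structure on a ring that may be zero, as a
   corner can be; algebras of type [algType K] are nonzero. *)
Record kstr := KStr {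
  kio :> K -> R;
  kio1 : kio 1 = 1;
  kioD : forall a b, kio (a + b) = kio a + kio b;
  kioM : forall a b, kio (a * b) = kio a * kio b;
  kioC : forall a r, kio a * r = r * kio a;
  kiofg : exists n (g : 'I_n -> R), forall r, exists c : 'I_n -> K,
            r = \sum_i kio (c i) * g i }.

Variable k : kstr.

Section KMod.
Variable M : lmodType R.
Let kscale (c : K) (x : M) : M := k c *: x.
Let kA a b x : kscale a (kscale b x) = kscale (a * b) x.
Proof. by rewrite /kscale scalerA kioM. Qed.
Let k1 : left_id 1 kscale.
Proof. by move=> x; rewrite /kscale kio1 scale1r. Qed.
Let kDr a x y : kscale a (x + y) = kscale a x + kscale a y.
Proof. exact: scalerDr. Qed.
Let kDl x a b : kscale (a + b) x = kscale a x + kscale b x.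
Proof. by rewrite /kscale kioD scalerDl. Qed.
Definition kmod : lmodType K :=
  mk_lmod (@addrA M) (@addrC M) (@add0r M) (@addNr M) kA k1 kDr kDl.
End KMod.

Lemma kmodZ M (c : K) (x : M) : c *: (x : kmod M) = k c *: x.
Proof. by []. Qed.

Lemma kmodf_linP M N (f : {linear M -> N}) :
  linear ((f : M -> N) : kmod M -> kmod N).
Proof. by move=> c x y; exact: (linearP f (k c) x y). Qed.
Definition kmodf M N f := mklin (@kmodf_linP M N f).

Lemma kmod_sumE M n (F : 'I_n -> M) :
  \sum_i (F i : kmod M) = \sum_i F i.
Proof. by []. Qed.

Lemma fin_gen_kmod M : fin_gen M <-> fin_gen (kmod M).
Proof.
split=> [/fin_genP[n [p ps]]|[n [g gP]]]; last first.
  exists n, g => x; have [c xE] := gP x; exists (fun i => k (c i)).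
  by rewrite [LHS]xE kmod_sumE.
suff gF : fin_gen (kmod (free R n)).
  exact: (fin_gen_surj (f := kmodf p) ps gF).
have [m [g gP]] := kiofg k.
have h i : fin_gen (kmod (R^o : lmodType R)).
  by exists m, g => r; have [c ->] := gP r; exists c; rewrite kmod_sumE.
elim: n {p ps} => [|n IH].
  exists 0%N, (fun=> 0) => x; exists (fun=> 0); rewrite big_ord0.
  by apply/ffunP => -[].
pose p1 := kmodf (lin_proj (R^o : lmodType R) (@ord0 n)).
pose i1 := kmodf (lin_cotuple (fun j : 'I_n => lin_inj_at (R^o : lmodType R) (lift ord0 j))).
apply: (@fin_gen_ext K _ _ _ i1 p1) => //; last exact: h ord0.
  move=> x; split=> [x0|[y <-]].
    exists [ffun j => x (lift ord0 j)].
    rewrite [RHS]ffun_decomp big_ord_recl; have -> : x ord0 = 0 by [].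
    rewrite linear0 add0r; apply: eq_bigr => j _.
    by rewrite ffunE.
  rewrite /= sum_ffunE big1 // => j _; rewrite ffunE.
  by rewrite (negbTE (neq_lift _ _)).
by move=> r; exists (lin_inj_at (R^o : lmodType R) ord0 r); rewrite /= ffunE eqxx.
Qed.

(** An R-submodule is a K-subspace, and finite generation over R is finite generation over K. *)
Lemma noeth_kstr : noeth R.
Proof.
move=> X Y i ii /fin_gen_kmod gY; apply/fin_gen_kmod.
exact: (noeth_field (i := kmodf i) ii gY).
Qed.


End KStructure.

Section Dual.
Variables (K : fieldType) (R : pzRingType) (k : kstr K R).
Implicit Types M N X Y : lmodType R.

Let fopp (p : R -> K) s := - p s.
Let fadd (p q : R -> K) s := p s + q s.
Let fscale (r : R) (p : R -> K) s := p (s * r).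
Let faddA : associative fadd.
Proof. by move=> p q u; apply/funext => s; exact: addrA. Qed.
Let faddC : commutative fadd.
Proof. by move=> p q; apply/funext => s; exact: addrC. Qed.
Let fadd0 : left_id (fun=> 0) fadd.
Proof. by move=> p; apply/funext => s; exact: add0r. Qed.
Let faddN : left_inverse (fun=> 0) fopp fadd.
Proof. by move=> p; apply/funext => s; exact: addNr. Qed.
Let fscaleA a b p : fscale a (fscale b p) = fscale (a * b) p.
Proof. by apply/funext => s; rewrite /fscale mulrA. Qed.
Let fscale1 : left_id 1 fscale.
Proof. by move=> p; apply/funext => s; rewrite /fscale mulr1. Qed.
Definition kfun (p : R -> K) : Prop :=
  (forall s t, p (s + t) = p s + p t) /\ (forall c s, p (k c * s) = c * p s).
Definition kfunT := {p : R -> K | `[< kfun p >]}.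
Let vP (p : kfunT) : kfun (sval p). Proof. exact/asboolP/(svalP p). Qed.
Let mk p (h : kfun p) : kfunT := exist _ p (introT (asboolP _) h).
Let kf0 : kfun (fun=> 0).
Proof. by split=> *; rewrite ?addr0 ?mulr0. Qed.
Let kfN p : kfun p -> kfun (fopp p).
Proof. by case=> h1 h2; split=> *; rewrite /fopp ?h1 ?h2 ?opprD ?mulrN. Qed.
Let kfD p q : kfun p -> kfun q -> kfun (fadd p q).
Proof.
case=> h1 h2 [h3 h4]; split=> *; rewrite /fadd; first by rewrite h1 h3 addrACA.
by rewrite h2 h4 mulrDr.
Qed.
Let kfZ r p : kfun p -> kfun (fscale r p).
Proof. by case=> h1 h2; split=> *; rewrite /fscale ?mulrDl ?h1 // -mulrA h2. Qed.
Let D0 := mk kf0.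
Let Dopp p := mk (kfN (vP p)).
Let Dadd p q := mk (kfD (vP p) (vP q)).
Let Dscale r p := mk (kfZ r (vP p)).
Let DaddA : associative Dadd.
Proof. by move=> p q r; apply: val_inj; exact: faddA. Qed.
Let DaddC : commutative Dadd.
Proof. by move=> p q; apply: val_inj; exact: faddC. Qed.
Let Dadd0 : left_id D0 Dadd.
Proof. by move=> p; apply: val_inj; exact: fadd0. Qed.
Let DaddN : left_inverse D0 Dopp Dadd.
Proof. by move=> p; apply: val_inj; exact: faddN. Qed.
Let DscaleA a b p : Dscale a (Dscale b p) = Dscale (a * b) p.
Proof. by apply: val_inj; exact: fscaleA. Qed.
Let Dscale1 : left_id 1 Dscale.
Proof. by move=> p; apply: val_inj; exact: fscale1. Qed.
Let DscaleDr a p q : Dscale a (Dadd p q) = Dadd (Dscale a p) (Dscale a q).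
Proof. by apply: val_inj. Qed.
Let DscaleDl p a b : Dscale (a + b) p = Dadd (Dscale a p) (Dscale b p).
Proof.
apply: val_inj; apply/funext => s; rewrite /= /fscale /fadd mulrDr.
by case: (vP p).
Qed.
(** The K-dual of R as a right module over itself, a left module by (r p)(s) = p(s r). *)
Definition dualR : lmodType R :=
  mk_lmod DaddA DaddC Dadd0 DaddN DscaleA Dscale1 DscaleDr DscaleDl.

Definition dval (p : dualR) : R -> K := sval (p : kfunT).
Lemma dvalP p : kfun (dval p). Proof. exact: vP. Qed.
Lemma dval_inj p q : (forall s, dval p s = dval q s) -> p = q.
Proof. by move=> e; apply: val_inj; apply/funext. Qed.
Lemma dvalD p q s : dval (p + q) s = dval p s + dval q s. Proof. by []. Qed.
Lemma dvalZ r p s : dval (r *: p) s = dval p (s * r). Proof. by []. Qed.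
Lemma dualR_ex p : kfun p -> exists q : dualR, dval q = p.
Proof. by move=> h; exists (mk h). Qed.

Lemma dvalr p s t : dval p (s + t) = dval p s + dval p t.
Proof. by case: (dvalP p). Qed.
Lemma dvalk p c s : dval p (k c * s) = c * dval p s.
Proof. by case: (dvalP p). Qed.
Lemma dvalr0 p : dval p 0 = 0.
Proof. by apply: (addIr (dval p 0)); rewrite -dvalr !add0r. Qed.
Lemma dval_sum p n (F : 'I_n -> R) : dval p (\sum_i F i) = \sum_i dval p (F i).
Proof. by apply: (big_morph (dval p) (dvalr p) (dvalr0 p)). Qed.

(* [dual_ideal e] is the K-dual of the right ideal eR when e is idempotent. *)
Section DualIdeal.
Variable e : R.
Hypothesis ee : e * e = e.

Lemma dual_ideal_sub : submodule (fun p : dualR => forall s, dval p (e * s) = dval p s).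
Proof.
split=> [s|p q hp hq s|r p hp s] //; first by rewrite !dvalD hp hq.
by rewrite !dvalZ -mulrA hp.
Qed.
Definition dual_ideal : lmodType R := subm dual_ideal_sub.
Definition dival : {linear dual_ideal -> dualR} := subm_val dual_ideal_sub.
Lemma dival_inj : injective dival. Proof. exact: subm_val_inj. Qed.
Lemma divalE p s : dval (dival p) (e * s) = dval (dival p) s.
Proof.
by move: s; apply/(subm_valE dual_ideal_sub (dival p)); exists p.
Qed.
Lemma dual_ideal_ex p : kfun p -> (forall s, p (e * s) = p s) ->
  exists q, dval (dival q) = p.
Proof.
move=> /dualR_ex[q qE] h; have : forall s, dval q (e * s) = dval q s by rewrite qE.
by move=> /(subm_valE dual_ideal_sub)[q' q'E]; exists q'; rewrite -qE -q'E.
Qed.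

(** A map g from X to the dual of eR is determined by the K-linear form x |-> g(x)(1). The form
    extends along f over K to some m, and s |-> m(e s y) defines the extended map; the factor e
    keeps it in the dual of eR. *)
Lemma dual_ideal_injective : injective_module dual_ideal.
Proof.
move=> X Y f g fi.
pose l (x : kmod k X) : K := dval (dival (g x)) 1.
have lL c x y : l (c *: x + y) = c * l x + l y.
  rewrite /l kmodZ !linearP dvalD dvalZ mul1r.
  by rewrite -[k c]mulr1 dvalk.
have fi' : injective (kmodf k f) by [].
have [m [mL mE]] := functional_ext fi' lL.
have m0 : m 0 = 0 by have := mE 0; rewrite linear0 /l linear0.
pose G y (q : dual_ideal) := forall s, dval (dival q) s = m ((e * s) *: y).
have mD (x y : Y) : m (x + y) = m x + m y.
  by have := mL 1 x y; rewrite mul1r kmodZ kio1 scale1r.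
have mK c (x : Y) : m (k c *: x) = c * m x.
  by have := mL c x 0; rewrite m0 !addr0.
have [|||h hE] := @ex_lin_rel _ Y dual_ideal G.
- move=> y; have [|s|q qE] := @dual_ideal_ex (fun s => m ((e * s) *: y)).
  + split=> [s t|c s]; first by rewrite mulrDr scalerDl mD.
    by rewrite mulrA -[e * _]kioC -mulrA -scalerA mK.
  + by rewrite mulrA ee.
  + by exists q => s; rewrite qE.
- move=> y q q' h h'; apply: dival_inj; apply: dval_inj => s.
  by rewrite h h'.
- move=> a y y' q q' h h' s; rewrite linearP dvalD dvalZ h h'.
  by rewrite scalerDr mD scalerA mulrA.
exists h => x; apply: dival_inj; apply: dval_inj => s.
rewrite hE -linearZ; have := mE ((e * s) *: x); rewrite /= => ->.
by rewrite /l !linearZ !dvalZ mul1r divalE.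
Qed.

Lemma dual_ideal_fg : fin_gen dual_ideal.
Proof.
apply/(fin_gen_kmod k); have [n [g gP]] := kiofg k.
have hL : linear (fun p : kmod k dual_ideal =>
    [ffun i => dval (dival p) (g i)] : free K n).
  move=> c p q; apply/ffunP => i; rewrite !ffunE kmodZ linearP dvalD dvalZ.
  by rewrite -kioC dvalk.
apply: (fin_gen_sub_free (f := mklin hL)) => p q e'.
apply: dival_inj; apply: dval_inj => s; have [c ->] := gP s.
rewrite !dval_sum; apply: eq_bigr => i _; rewrite !dvalk; congr (_ * _).
by have := congr1 (fun u : free K n => u i) e'; rewrite !ffunE.
Qed.

End DualIdeal.
Arguments dival {e}.

Definition dual1 := dual_ideal 1.

Lemma dual1_injective : injective_module dual1.
Proof. by apply: dual_ideal_injective; rewrite mulr1. Qed.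

Lemma dual1_fg : fin_gen dual1.
Proof. exact: dual_ideal_fg. Qed.

(** By adjunction, each coordinate of a K-linear embedding of X in K^n is an R-linear map from X to
    the dual of R. *)
Lemma embed_dual X : fin_gen X ->
  exists n (f : {linear X -> {ffun 'I_n -> dual1}}), injective f.
Proof.
move=> /(fin_gen_kmod k)/kbasis[n [p pi]].
have /choice[f fE] : forall i : 'I_n, exists f : {linear X -> dual1},
    forall x s, dval (dival (f x)) s = p (s *: x) i.
  move=> i.
  have pD (x y : X) : p (x + y) i = p x i + p y i.
    by rewrite linearD ffunE.
  have pZ c (x : X) : p (k c *: x) i = c * p x i.
    by have := linearP p c x 0; rewrite kmodZ linear0 !addr0 => ->; rewrite ffunE.
  have [|||f fE] := @ex_lin_rel _ X dual1 (fun x q => forall s, dval (dival q) s = p (s *: x) i).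
  - move=> x; have [|s|q qE] := @dual_ideal_ex 1 (fun s => p (s *: x) i).
    + split=> [s t|c s]; first by rewrite scalerDl pD.
      by rewrite -scalerA pZ.
    + by rewrite mul1r.
    + by exists q => s; rewrite qE.
  - move=> y q q' h h'; apply: dival_inj; apply: dval_inj => s.
    by rewrite h h'.
  - move=> a y y' q q' h h' s; rewrite linearP dvalD dvalZ h h'.
    by rewrite scalerDr pD scalerA.
  by exists f.
exists n, (lin_tuple f); apply: lin_inj => x fx; apply: (lin_inj0 pi).
apply/ffunP => i; have := congr1 (fun u : {ffun 'I_n -> dual1} => dval (dival (u i)) 1) fx.
by rewrite !ffunE fE scale1r linear0.
Qed.

End Dual.
Arguments dival {K R k e}.

(** * Stability under retracts and finite powers *)

Section SyzRetract.
Variable R : pzRingType.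
Implicit Types M N X Y Z P T C : lmodType R.

Lemma ses_prod X Y Z X' Y' Z' (f : {linear X -> Y}) (g : {linear Y -> Z})
    (f' : {linear X' -> Y'}) (g' : {linear Y' -> Z'}) : ses f g -> ses f' g' ->
  ses (lin_pair (linc f (lin_fst X X')) (linc f' (lin_snd X X')))
      (lin_pair (linc g (lin_fst Y Y')) (linc g' (lin_snd Y Y'))).
Proof.
move=> [fi fe gs] [fi' fe' gs']; split.
- by move=> [x x'] [y y'] /= [/fi -> /fi' ->].
- move=> [y y']; split=> [[/fe[x <-] /fe'[x' <-]]|[[x x'] [<- <-]]] /=.
    by exists (x, x').
  by congr pair; [exact: exact0|exact: exact0].
- by move=> [z z']; have [y <-] := gs z; have [y' <-] := gs' z'; exists (y, y').
Qed.

Lemma ses_pair X Y : exists (i : {linear X -> (X * Y)%type}), ses i (lin_snd X Y).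
Proof.
exists (lin_pair (lin1 X) (lin0 X Y)); split.
- by move=> x y [].
- move=> [x y]; split=> [/= ->|[x' [_ <-]]] //; by exists x.
- by move=> y; exists (0, y).
Qed.

Lemma ses_ffunS X n : exists (i : {linear {ffun 'I_n -> X} -> {ffun 'I_n.+1 -> X}}),
  ses i (lin_proj X (@ord0 n)).
Proof.
pose i := lin_tuple (fun j : 'I_n.+1 => if unlift ord0 j is Some j' then lin_proj X j'
  else lin0 _ _).
have iE u j : i u (lift ord0 j) = u j by rewrite ffunE liftK.
exists i; split.
- by move=> u v e; apply/ffunP => j; rewrite -!iE e.
- move=> v; split=> [v0|[u <-]]; last by rewrite /= ffunE unlift_none.
  exists [ffun j => v (lift ord0 j)]; apply/ffunP => j; rewrite ffunE.
  by case: unliftP => [j' ->|->] /=; rewrite ?ffunE.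
- by move=> x; exists [ffun=> x]; rewrite /= ffunE.
Qed.

Lemma fin_gen_retract X Y : retract X Y -> fin_gen Y -> fin_gen X.
Proof. by move=> [i [p ip]]; apply: fin_gen_surj => x; exists (i x). Qed.

Lemma fin_gen_pair X Y : fin_gen X -> fin_gen Y -> fin_gen (X * Y : lmodType R)%type.
Proof. by have [i [_ ie gs]] := ses_pair X Y; exact: fin_gen_ext ie gs. Qed.

Lemma fin_gen_ffun X n : fin_gen X -> fin_gen ({ffun 'I_n -> X} : lmodType R).
Proof.
move=> gX; elim: n => [|n IH].
  exists 0%N, (fun=> 0) => x; exists (fun=> 0); rewrite big_ord0.
  by apply/ffunP => -[].
by have [i [_ ie gs]] := ses_ffunS X n; exact: fin_gen_ext ie gs IH gX.
Qed.

Lemma fin_gen_proj P : fin_gen P -> projective P -> exists n, retract P (free R n).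
Proof.
move=> /fin_genP[n [p ps]] pP; have [s sE] := pP _ _ p (lin1 P) ps.
by exists n, s, p.
Qed.

Section Generic.
Variable Q0 : lmodType R -> Prop.
Hypothesis Q0A : forall X Y P (f : {linear X -> Y}) (g : {linear Y -> P}),
  ses f g -> projective P -> Q0 X <-> Q0 Y.
Hypothesis Q0R : forall X Y, retract X Y -> Q0 Y -> Q0 X.
Hypothesis Q0H : forall X Y Z (f : {linear X -> Y}) (g : {linear Y -> Z}),
  ses f g -> Q0 X -> Q0 Z -> Q0 Y.
Hypothesis hR : noeth R.

(** Covers of X and of a complement Z add up to a cover of Y, so the syzygy of X is a retract of one
    of Y. Noetherianity keeps the syzygies finitely generated for the induction. *)
Lemma syz_retract n X Y : fin_gen Y -> retract X Y -> syz Q0 n Y -> syz Q0 n X.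
Proof.
elim: n X Y => [|n IH] X Y gY; first exact: Q0R.
move=> rXY hY; have gX := fin_gen_retract rXY gY.
have /summandP[Z [f [g [fg gf]]]] := rXY.
have gZ : fin_gen Z.
  apply: (fin_gen_surj (f := linc (lin_snd X Z) f)) gY => z.
  by exists (g (0, z)); rewrite /= gf.
have [a [p ps]] := (fin_genP X).1 gX; have [b [q qs]] := (fin_genP Z).1 gZ.
have [K1 [i1 S1]] := ses_ker ps; have [K2 [i2 S2]] := ses_ker qs.
have S := ses_prod S1 S2; have [Si Se Ss] := S.
set i := lin_pair (linc i1 _) _ in S Si Se; set pq := lin_pair _ _ in S Se Ss.
have S' : ses i (linc g pq).
  split=> //.
    move=> y; rewrite -(Se y) (_ : linc g pq y = g (pq y)) //; split=> [e|->]; last exact: linear0.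
    by have := congr1 f e; rewrite linear0 gf.
  by move=> y; have [u uE] := Ss (f y); exists u; rewrite (_ : linc g pq u = g (pq u)) // uE fg.
have hK : syz Q0 n (K1 * K2)%type.
  by apply: (syz_any Q0A _ S' hY); apply: proj_pair; exact: proj_free.
exists K1, (free R a), i1, p; split=> //; first exact: proj_free.
apply: IH hK.
  apply: (hR Si); apply: fin_gen_pair; exact: fin_gen_free.
exists (lin_pair (lin1 K1) (lin0 _ _)), (lin_fst K1 K2); by [].
Qed.

Lemma proj_zero Z : (forall x y : Z, x = y) -> projective Z.
Proof. by move=> zZ A B f g fs; exists (lin0 _ _) => u; rewrite (zZ u 0) !linear0. Qed.

Lemma syz_zero n X Z : (forall x y : Z, x = y) -> syz Q0 n X -> syz Q0 n Z.
Proof.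
move=> zZ; elim: n X => [|n IH] X hX.
  by apply: Q0R hX; exists (lin0 _ _), (lin0 _ _) => x; exact: zZ.
have [A [P [a [b [pP Sa /IH hZ]]]]] := hX.
exists Z, Z, (lin0 _ _), (lin1 _); split=> //; first exact: proj_zero.
split=> //; first by move=> y; split=> _; [exists 0|]; exact: zZ.
by move=> y; exists y.
Qed.

Lemma syz_ffun n m X : syz Q0 n X -> syz Q0 n ({ffun 'I_m -> X} : lmodType R).
Proof.
move=> hX; elim: m => [|m IH]; last first.
  by have [i Si] := ses_ffunS X m; exact: (syz_half Q0H Si).
by apply: syz_zero hX => u v; apply/ffunP => -[].
Qed.
End Generic.

Lemma fgpd_retract n X Y : noeth R -> retract X Y -> fgpd n Y -> fgpd n X.
Proof.
move=> hR rXY [gY hY]; split; first exact: fin_gen_retract rXY gY.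
exact: (syz_retract (@proj_ses R) (@retract_proj R) hR gY rXY hY).
Qed.

Lemma fgpd_ffun n m X : fgpd n X -> fgpd n ({ffun 'I_m -> X} : lmodType R).
Proof.
move=> [gX hX]; split; first exact: fin_gen_ffun.
exact: (syz_ffun (@retract_proj R) (@proj_half R) m hX).
Qed.

Lemma fgpd_add n T X : noeth R -> fgpd n T -> in_add T X -> fgpd n X.
Proof.
move=> hR hT /in_addP[m rX]; exact: fgpd_retract hR rX (fgpd_ffun m hT).
Qed.

Lemma perp_retract N X Y : noeth R -> fin_gen Y -> retract X Y -> perp N Y -> perp N X.
Proof.
move=> hR gY rXY hY n; apply: (syz_retract (@ext1_ses R N) _ hR gY rXY (hY n)).
by move=> A B rAB hB; exact: (ext1_retract1 rAB hB).
Qed.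

Lemma perp_ffun N m X : perp N X -> perp N ({ffun 'I_m -> X} : lmodType R).
Proof.
move=> hX n; apply: (syz_ffun _ _ m (hX n)).
  by move=> A B rAB hB; exact: (ext1_retract1 rAB hB).
by move=> A B C f g S hA hC; exact: (ext1_half S hA hC).
Qed.

Lemma fpd_coker X Y Z (f : {linear X -> Y}) (g : {linear Y -> Z}) :
  ses f g -> fpd X -> fpd Y -> fpd Z.
Proof.
move=> Sf [n [gX hX]] [m [gY hY]]; have [_ _ gs] := Sf.
exists (maxn n m).+1; split; first exact: fin_gen_surj gs gY.
apply: (pdle_right Sf); first exact: pdle_mono (leq_maxl _ _) hX.
exact/pdleS/(pdle_mono (leq_maxr n m) hY).
Qed.

Lemma fpd_ker X Y Z (f : {linear X -> Y}) (g : {linear Y -> Z}) : noeth R ->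
  ses f g -> fpd Y -> fpd Z -> fpd X.
Proof.
move=> hR Sf [n [gY hY]] [m [gZ hZ]]; have [fi _ _] := Sf.
exists (maxn n m); split; first exact: (hR _ _ _ fi).
apply: (pdle_left Sf); first exact: pdle_mono (leq_maxl _ _) hY.
exact/pdleS/(pdle_mono (leq_maxr n m) hZ).
Qed.

Lemma fgpd_free n : fgpd 0 (free R n).
Proof. by split; [exact: fin_gen_free|exact: proj_free]. Qed.

End SyzRetract.

Lemma free_decomp (R : pzRingType) n (u : free R n) :
  u = \sum_i (u i : R) *: lin_inj_at (R^o : lmodType R) i 1.
Proof.
rewrite {1}(ffun_decomp u); apply: eq_bigr => i _.
rewrite -linearZ; congr (lin_inj_at _ _ _); exact/esym/mulr1.
Qed.

Lemma lin_free (R : pzRingType) n (M : lmodType R) (f : {linear free R n -> M}) u :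
  f u = \sum_i (u i : R) *: f (lin_inj_at (R^o : lmodType R) i 1).
Proof.
rewrite {1}(free_decomp u) raddf_sum; apply: eq_bigr => i _; exact: linearZ.
Qed.

(** * Duality with respect to a strong tilting module *)

(* The same additive group as a module over R and over E, the two actions
   commuting; [bt] and [bs] identify the two carriers. *)
Record bimod (R E : pzRingType) := Bimod {
  bl : lmodType R;
  br : lmodType E;
  bt : bl -> br;
  bs : br -> bl;
  btK : cancel bt bs;
  bsK : cancel bs bt;
  btD : forall x y, bt (x + y) = bt x + bt y;
  btC : forall (r : R) (c : E) (t : bl),
    bs (c *: bt (r *: t)) = r *: bs (c *: bt t) }.

Arguments bt {R E b}.
Arguments bs {R E b}.

Section BimodTheory.
Variables (R E : pzRingType) (B : bimod R E).
Implicit Types (t : bl B) (u : br B) (r : R) (b : E).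

Lemma bsD u v : bs (u + v) = bs u + bs v :> bl B.
Proof. by apply: (can_inj (btK (b := B))); rewrite btD !bsK. Qed.
Lemma bt0 : bt (0 : bl B) = 0.
Proof. by apply: (addIr (bt 0)); rewrite -btD !add0r. Qed.
Lemma bs0 : bs (0 : br B) = 0.
Proof. by rewrite -bt0 btK. Qed.
Lemma bt_sum n (F : 'I_n -> bl B) : bt (\sum_i F i) = \sum_i bt (F i).
Proof. exact: (big_morph _ (@btD _ _ B) bt0). Qed.
Lemma bs_sum n (F : 'I_n -> br B) : bs (\sum_i F i) = \sum_i bs (F i).
Proof. exact: (big_morph _ bsD bs0). Qed.

Lemma bopC b r u : bt (r *: bs (b *: u)) = b *: bt (r *: bs u) :> br B.
Proof. by apply: (can_inj (bsK (b := B))); rewrite btK btC bsK. Qed.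

Definition bop : bimod E R := Bimod (@bsK _ _ B) (@btK _ _ B) bsD bopC.

Lemma bact_linP b : linear (fun t : bl B => bs (b *: bt t) : bl B).
Proof. by move=> r x y; rewrite btD scalerDr bsD btC. Qed.
Definition bact b : {linear bl B -> bl B} := mklin (bact_linP b).

(** Together with [bfaith]: E is the ring of R-endomorphisms of T. *)
Definition bfull := forall f : {linear bl B -> bl B}, exists b, forall t, f t = bs (b *: bt t).
Definition bfaith := forall b, (forall t : bl B, b *: bt t = 0) -> b = 0.

Section Star.
Variable X : lmodType R.
Let sscale b (f : {linear X -> bl B}) := linc (bact b) f.
Let sA a b f : sscale a (sscale b f) = sscale (a * b) f.
Proof. by apply: lin_ext => x; rewrite /= bsK scalerA. Qed.
Let s1 : left_id 1 sscale.
Proof. by move=> f; apply: lin_ext => x; rewrite /= scale1r btK. Qed.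
Let sDr a f g : sscale a (f + g) = sscale a f + sscale a g.
Proof. by apply: lin_ext => x; rewrite /= btD scalerDr bsD. Qed.
Let sDl f a b : sscale (a + b) f = sscale a f + sscale b f.
Proof. by apply: lin_ext => x; rewrite /= scalerDl bsD. Qed.
(** The dual Hom_R(X, T), an E-module through the second action on T. *)
Definition star : lmodType E :=
  mk_lmod (@addrA {linear X -> bl B}) (@addrC {linear X -> bl B})
    (@add0r {linear X -> bl B}) (@addNr {linear X -> bl B}) sA s1 sDr sDl.
Definition s2l (f : star) : {linear X -> bl B} := f.
Definition l2s (f : {linear X -> bl B}) : star := f.
Lemma s2lD f g x : s2l (f + g) x = s2l f x + s2l g x. Proof. by []. Qed.
Lemma s2l0 x : s2l 0 x = 0. Proof. by []. Qed.
Lemma s2lZ b f x : s2l (b *: f) x = bs (b *: bt (s2l f x)). Proof. by []. Qed.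
Lemma s2lP b f g x : s2l (b *: f + g) x = bs (b *: bt (s2l f x)) + s2l g x.
Proof. by []. Qed.
Lemma l2sK f : s2l (l2s f) = f. Proof. by []. Qed.
Lemma star_ext f g : s2l f =1 s2l g -> f = g.
Proof. by move=> h; apply: lin_ext. Qed.
End Star.

End BimodTheory.
Arguments s2l {R E B X}.
Arguments l2s {R E B X}.

Section Duality.
Variables (R E : pzRingType) (B : bimod R E).
Implicit Types X Y Z P C W : lmodType R.
Local Notation S := (star B).
Local Notation T := (bl B).
Local Notation U := (br B).

Lemma starm_linP X Y (f : {linear X -> Y}) :
  linear (fun g : S Y => l2s (linc (s2l g) f) : S X).
Proof. by move=> b g h; apply: star_ext => x. Qed.
Definition starm X Y f : {linear S Y -> S X} := mklin (@starm_linP X Y f).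
Lemma starmE X Y (f : {linear X -> Y}) g x : s2l (starm f g) x = s2l g (f x).
Proof. by []. Qed.

(** Reflexivity: evaluation from X to the double dual is injective and onto. Functionals on the dual
    take values in U, the copy of T on the E-side. *)
Definition refl X : Prop :=
  (forall x : X, (forall f : {linear X -> T}, f x = 0) -> x = 0) /\
  (forall p : {linear S X -> U}, exists x : X, forall f, p f = bt (s2l f x)).

Lemma evP X (x : X) : exists p : {linear S X -> U}, forall f, p f = bt (s2l f x).
Proof.
have h : linear (fun f : S X => bt (s2l f x)).
  by move=> b f g; rewrite s2lP btD bsK.
by exists (mklin h).
Qed.

(** Ext^1(Z, T) = 0 makes restriction along f onto; the rest is left exactness of Hom. *)
Lemma star_ses X Y Z (f : {linear X -> Y}) (g : {linear Y -> Z}) :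
  ses f g -> ext1 Z T -> ses (starm g) (starm f).
Proof.
move=> Sf eZ; have [fi fe gs] := Sf; split.
- move=> a b e; apply: star_ext => z; have [y <-] := gs z.
  by rewrite -!starmE e.
- move=> h; split=> [h0|[k <-]]; last first.
    by apply: star_ext => x; rewrite !starmE (ses0 _ Sf) s2l0 linear0.
  have [|k kE] := desc_coker (h := s2l h) fe gs.
    by move=> x; rewrite -starmE h0.
  by exists (l2s k); apply: star_ext => y; rewrite starmE kE.
- move=> h; have [k kE] := eZ _ _ _ _ Sf (s2l h).
  by exists (l2s k); apply: star_ext => x; rewrite starmE kE.
Qed.

Lemma star_retract X Y : retract X Y -> retract (S X) (S Y).
Proof.
move=> [i [p ip]]; exists (starm p), (starm i) => f; apply: star_ext => x.
by rewrite !starmE ip.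
Qed.

Lemma star_ffun X n :
  exists (f : {linear S {ffun 'I_n -> X} -> {ffun 'I_n -> S X}})
         (g : {linear {ffun 'I_n -> S X} -> S {ffun 'I_n -> X}}),
  cancel f g /\ cancel g f.
Proof.
pose f := lin_tuple (fun i : 'I_n => starm (lin_inj_at X i)).
pose g := lin_cotuple (fun i : 'I_n => starm (lin_proj X i)).
have gE (u : {ffun 'I_n -> S X}) v : s2l (g u) v = \sum_i s2l (u i) (v i).
  have h (r : seq 'I_n) : s2l (\sum_(i <- r) starm (lin_proj X i) (u i)) v =
      \sum_(i <- r) s2l (u i) (v i).
    by elim: r => [|i r IH]; rewrite ?big_nil // !big_cons s2lD IH.
  exact: h.
exists f, g; split=> u.
  apply: star_ext => v; rewrite gE [in RHS](ffun_decomp v) raddf_sum.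
  by apply: eq_bigr => i _; rewrite ffunE starmE.
apply/ffunP => i; rewrite ffunE; apply: star_ext => x; rewrite starmE gE.
rewrite (bigD1 i) //= ffunE eqxx big1 ?addr0 // => j ji.
by rewrite ffunE (negbTE ji) linear0.
Qed.

Lemma star_R1 : exists (f : {linear S (R^o : lmodType R) -> U})
    (g : {linear U -> S (R^o : lmodType R)}),
  [/\ cancel f g, cancel g f & forall h, f h = bt (s2l h 1)].
Proof.
have [f fE] := @evP (R^o : lmodType R) 1.
have h : linear (fun u : U => l2s (lin_scalel (bs u)) : S (R^o : lmodType R)).
  move=> b u v; apply: star_ext => r; rewrite s2lP l2sK /= bsD scalerDr.
  by congr (_ + _); rewrite btC bsK.
exists f, (mklin h); split=> // u.
  apply: star_ext => r; rewrite /= fE btK -linearZ; congr (s2l u _).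
  exact: mulr1.
by rewrite fE /= scale1r bsK.
Qed.

Lemma star_R : exists (f : {linear S (R^o : lmodType R) -> U})
    (g : {linear U -> S (R^o : lmodType R)}), cancel f g /\ cancel g f.
Proof. by have [f [g [fg gf _]]] := star_R1; exists f, g. Qed.

Lemma star_T : bfull B -> bfaith B ->
  exists (f : {linear (E^o : lmodType E) -> S T})
    (g : {linear S T -> (E^o : lmodType E)}), cancel f g /\ cancel g f.
Proof.
move=> full faith.
have h : linear (fun b : E^o => l2s (bact B b) : S T).
  by move=> a b c; apply: star_ext => t; rewrite s2lP /= bsK scalerDl bsD scalerA.
have hi : injective (mklin h).
  apply: lin_inj => b e; apply: faith => t.
  have := congr1 (fun f => bt (s2l f t)) e.
  by rewrite /= bsK bt0.
have hs : surjective_map (mklin h).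
  move=> f; have [b bE] := full (s2l f); exists b; apply: star_ext => t.
  by rewrite bE.
have [g [e1 e2]] := inv_ex hi hs; by exists (mklin h), g.
Qed.

Lemma refl_retract X Y : retract X Y -> refl Y -> refl X.
Proof.
move=> [i [p ip]] [inj sur]; split=> [x hx|q].
  have : i x = 0 by apply: inj => g; have := hx (linc g i).
  by move/(congr1 p); rewrite ip linear0.
have [y yE] := sur (linc q (starm i)); exists (p y) => f.
have := yE (starm p f); rewrite starmE => <- /=; congr (q _).
by apply: star_ext => x; rewrite !starmE ip.
Qed.

Lemma refl_ffun X n : refl X -> refl ({ffun 'I_n -> X} : lmodType R).
Proof.
move=> [inj sur]; split=> [v hv|q].
  by apply/ffunP => i; rewrite ffunE; apply: inj => f; have := hv (linc f (lin_proj X i)).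
have /choice[x xE] : forall i : 'I_n, exists x : X, forall f,
    q (starm (lin_proj X i) f) = bt (s2l f x).
  by move=> i; have [x xE] := sur (linc q (starm (lin_proj X i))); exists x.
exists (finfun x) => f.
have [a [b [ab ba]]] := star_ffun X n.
have -> : f = \sum_i starm (lin_proj X i) (starm (lin_inj_at X i) f).
  have h (r : seq 'I_n) v : s2l (\sum_(i <- r) starm (lin_proj X i) (starm (lin_inj_at X i) f)) v =
      \sum_(i <- r) s2l f (lin_inj_at X i (v i)).
    by elim: r => [|i r IH]; rewrite ?big_nil // !big_cons s2lD IH.
  by apply: star_ext => v; rewrite h -raddf_sum -ffun_decomp.
have h (r : seq 'I_n) : bt (s2l (\sum_(i <- r) starm (lin_proj X i) (starm (lin_inj_at X i) f)) (finfun x)) =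
      \sum_(i <- r) bt (s2l f (lin_inj_at X i (x i))).
  elim: r => [|i r IH]; rewrite ?big_nil ?bt0 // !big_cons s2lD btD IH.
  by rewrite !starmE /= ffunE.
by rewrite h raddf_sum; apply: eq_bigr => i _; exact: xE.
Qed.

(** The dual of T is generated over E by the identity, so a functional on it is determined by its
    value there. *)
Lemma refl_T : bfull B -> refl T.
Proof.
move=> full; split=> [t /(_ (lin1 T)) //|q].
exists (bs (q (l2s (lin1 T)))) => f; have [b bE] := full (s2l f).
rewrite bE !bsK -linearZ; congr (q _); apply: star_ext => t.
by rewrite s2lZ bE.
Qed.

Lemma refl_add X : bfull B -> in_add T X -> refl X.
Proof.
by move=> full /in_addP[n rX]; apply: refl_retract rX _; apply/refl_ffun/refl_T.
Qed.

Lemma star_add_proj X : bfull B -> bfaith B -> in_add T X ->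
  fin_gen (S X) /\ projective (S X).
Proof.
move=> full faith /in_addP[n /star_retract rX].
have [f [g [fg gf]]] := star_ffun T n; have [h [k [hk kh]]] := star_T full faith.
have rT : retract (S T) (E^o : lmodType E) by exists k, h.
have rX' : retract (S X) {ffun 'I_n -> S T}.
  by apply: retract_trans rX _; exists f, g.
split.
  apply: fin_gen_retract rX' _; apply: fin_gen_ffun.
  exact: fin_gen_retract rT (fin_gen_R E).
apply: retract_proj rX' _; apply: proj_ffun; apply: retract_proj rT _; exact: proj_R.
Qed.

Lemma star_proj_add X : fin_gen X -> projective X -> in_add U (S X).
Proof.
move=> gX pX; have [n /star_retract rX] := fin_gen_proj gX pX.
apply/in_addP; exists n; apply: retract_trans rX _.
have [f [g [fg gf]]] := star_ffun (R^o : lmodType R) n.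
have [h [k [hk kh]]] := star_R.
exists (linc (lin_tuple (fun i => linc h (lin_proj _ i))) f).
exists (linc g (lin_tuple (fun i => linc k (lin_proj _ i)))) => u /=.
rewrite -[RHS]fg; congr (g _); apply/ffunP => i; by rewrite !ffunE /= ?ffunE /= hk.
Qed.

Lemma star_refl_inj X Y (f g : {linear X -> Y}) : refl Y ->
  (forall h, starm f h = starm g h) -> f =1 g.
Proof.
move=> [inj _] e x; apply/eqP; rewrite -subr_eq0; apply/eqP/inj => h.
have := congr1 (fun a => s2l a x) (e (l2s h)); rewrite /= linearB => ->.
exact: subrr.
Qed.

(** The transpose of q: evaluation at x, composed with q, is evaluation at a unique y. *)
Lemma star_full X Y (q : {linear S Y -> S X}) : refl Y ->
  exists f : {linear X -> Y}, forall h, q h = starm f h.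
Proof.
move=> [inj sur].
have [|||f fE] := @ex_lin_rel _ X Y (fun x y => forall h, s2l (q h) x = s2l h y).
- move=> x; have [p pE] := evP x; have [y yE] := sur (linc p q).
  exists y => h; apply: (can_inj (btK (b := B))).
  by have := yE h; rewrite /= pE.
- move=> x y y' h h'; apply/eqP; rewrite -subr_eq0; apply/eqP/inj => k.
  by rewrite linearB -[k]l2sK -h -h' subrr.
- by move=> a x x' y y' h h' k; rewrite !linearP h h'.
by exists f => h; apply: star_ext => x; rewrite fE.
Qed.

(** A five lemma for double duals. As Ext^1 from the dual of Y to U vanishes, a functional on the
    dual of X extends to the dual of P, where it is evaluation at some u; the image of u in X
    represents it. *)
Lemma good_step Y P X (i : {linear Y -> P}) (p : {linear P -> X}) :
  ses i p -> ext1 X T -> refl Y -> refl P -> perp U (S P) -> perp U (S Y) ->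
  refl X /\ perp U (S X).
Proof.
move=> Si eX [injY surY] [injP surP] hP hY.
have [ii ie ps] := Si; have Ss := star_ses Si eX; have [si se ss] := Ss.
split; last exact: perp_left Ss hP hY.
split=> [x hx|q].
  have [u uE] := ps x; have [v vE] := evP u.
  have [|w wE] := desc_coker (h := v) se ss.
    by move=> f; rewrite vE starmE uE (hx (s2l f)) bt0.
  have [y yE] := surY w.
  suff e : i y - u = 0.
    by rewrite -uE -[u](subrK (i y)) -opprB e oppr0 add0r (ses0 _ Si).
  apply: injP => f; rewrite linearB; apply/eqP; rewrite subr_eq0; apply/eqP.
  apply: (can_inj (btK (b := B))); have := vE (l2s f).
  by rewrite -wE yE starmE.
have [q' q'E] := hY 0%N _ _ _ _ Ss q; have [u uE] := surP q'.
by exists (p u) => f; rewrite -q'E uE starmE.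
Qed.

(** The mirror image of [good_step]. A functional on the dual of X' is evaluation at some x' = g c
    and extends to evaluation at c on the dual of C; as the latter is projective, this is the
    vanishing of Ext^1 from the dual of X to U. *)
Lemma good_costep X C X' (f : {linear X -> C}) (g : {linear C -> X'}) :
  ses f g -> ext1 X' T -> refl X' -> refl C -> projective (S C) ->
  perp U (S X') -> refl X /\ perp U (S X).
Proof.
move=> Sf eX [injX surX] [injC surC] pC hX.
have [fi fe gs] := Sf; have Ss := star_ses Sf eX; have [si se ss] := Ss.
split.
  split=> [x hx|q].
    apply: (lin_inj0 fi); apply: injC => h; exact: (hx (linc h f)).
  have [c cE] := surC (linc q (starm f)).
  have /fe[x xE] : g c = 0.
    apply: injX => h; have e : starm f (starm g (l2s h)) = 0.
      by apply: star_ext => x; rewrite !starmE (ses0 _ Sf) s2l0 linear0.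
    have := cE (starm g (l2s h)).
    rewrite (_ : linc q _ _ = q (starm f (starm g (l2s h)))) // e linear0.
    by rewrite starmE -(bt0 B) => /(can_inj (btK (b := B))).
  exists x => h; have [k <-] := ss h.
  by have := cE k; rewrite -xE.
apply: (perp_syz pC Ss _ hX); apply: (ext1_pres pC Ss) => h.
have [x' x'E] := surX h; have [c cE] := gs x'; have [v vE] := evP c.
by exists v => z; rewrite vE starmE cE x'E.
Qed.

(** Generators of the dual have no common zero, since maps to T separate the elements of a reflexive
    module. *)
Lemma refl_embed X : refl X -> fin_gen (S X) ->
  exists n (f : {linear X -> {ffun 'I_n -> T}}), injective f.
Proof.
move=> [inj _] [n [g gP]]; exists n, (lin_tuple (fun i => s2l (g i))).
apply: lin_inj => x e; apply: inj => f; have [c cE] := gP (l2s f).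
rewrite -[f]l2sK cE.
have h (r : seq 'I_n) : s2l (\sum_(i <- r) c i *: g i) x = 0.
  elim: r => [|i r IH]; rewrite ?big_nil // big_cons s2lD IH addr0 s2lZ.
  have := congr1 (fun u : {ffun 'I_n -> T} => u i) e; rewrite !ffunE => ->.
  by rewrite bt0 scaler0 bs0.
exact: h.
Qed.

Definition dgood X : Prop := [/\ refl X, perp U (S X) & fpd (S X)].

Lemma star_fg X : noeth E -> fin_gen U -> fin_gen X -> fin_gen (S X).
Proof.
move=> hE gU /fin_genP[n [p ps]].
have si : injective (starm p).
  move=> a b e; apply: star_ext => x; have [u <-] := ps x.
  by rewrite -!starmE e.
apply: (hE _ _ _ si).
have [f [g [fg gf]]] := star_ffun (R^o : lmodType R) n.
have [h [k [hk kh]]] := star_R.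
have r1 : retract (S (free R n)) {ffun 'I_n -> S (R^o : lmodType R)} by exists f, g.
apply: fin_gen_retract r1 _; apply: fin_gen_ffun.
by apply: fin_gen_retract gU; exists h, k.
Qed.

Hypotheses (hR : noeth R) (hE : noeth E).
Hypotheses (full : bfull B) (faith : bfaith B) (Tstrong : fstrong T).

Lemma coresk_good s X : fpd X -> coresk T s X ->
  [/\ refl X, perp U (S X) & fgpd s (S X)].
Proof.
have [[nT hT] _ eT] := Tstrong.
elim: s X => [|s IH] X hX.
  move=> aX; have [gS pS] := star_add_proj full faith aX.
  by split=> //; [exact: refl_add|exact: perp_proj].
move=> [C [X' [f [g [Sf aC cX']]]]].
have hC : fpd C by exists nT; exact: fgpd_add aC.
have hX' := fpd_coker Sf hX hC.
have [r' p' d'] := IH _ hX' cX'; have eX' := eT _ hX'.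
have [gC pC] := star_add_proj full faith aC.
have [r p] := good_costep Sf eX' r' (refl_add full aC) pC p'.
have Ss := star_ses Sf eX'; have [si se ss] := Ss.
split=> //; split; first exact: fin_gen_surj ss gC.
exists (S X'), (S C), (starm g), (starm f); split=> //; by case: d'.
Qed.

Lemma good_R : dgood (R^o : lmodType R).
Proof.
have [_ [s cR] _] := Tstrong.
have hRo : fpd (R^o : lmodType R).
  by exists 0%N; split; [exact: fin_gen_R | exact: proj_R].
by have [r p d] := coresk_good hRo cR; split=> //; exists s.
Qed.

Lemma fpd_U : fpd U.
Proof.
have [_ _ [n d]] := good_R; have [f [g [fg gf]]] := star_R.
exists n; apply: (fgpd_retract hE _ d); by exists g, f.
Qed.

(** Double centraliser property: reflexivity of R itself says that R is the endomorphism ring of T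
    over E. *)
Lemma full_bop : bfull (bop B).
Proof.
have [[_ sur] _ _] := good_R; have [f [g [fg gf]]] := star_R => h.
have h1 : linear (fun k : S (R^o : lmodType R) => (h : {linear U -> U}) (bt (s2l k 1))).
  by move=> b k l; rewrite s2lP btD bsK linearP.
have [r rE] := sur (mklin h1); exists r => u.
have h2 := rE (l2s (lin_scalel (bs u))); move: h2 => /=.
by rewrite scale1r bsK.
Qed.

Lemma faith_bop : bfaith (bop B).
Proof.
have [[inj _] _ _] := good_R => r h; apply: (inj r) => f.
have -> : r = (r : R) *: (1 : R^o) by exact/esym/mulr1.
rewrite linearZ /=; have := h (bt (f 1)); by rewrite /= btK.
Qed.

Lemma good_proj P : fgpd 0 P -> dgood P.
Proof.
move=> [gP pP]; have [n rP] := fin_gen_proj gP pP.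
have [r p [m d]] := good_R; have rS := star_retract rP.
have [f [g [fg gf]]] := star_ffun (R^o : lmodType R) n.
have rS' : retract (S P) {ffun 'I_n -> S (R^o : lmodType R)}.
  by apply: retract_trans rS _; exists f, g.
split; first exact: refl_retract rP (refl_ffun n r).
  apply: perp_retract hE _ rS' (perp_ffun n p).
  by apply: fin_gen_ffun; case: d.
exists m; exact: fgpd_retract hE rS' (fgpd_ffun n d).
Qed.

(** One half of the duality between the modules of finite projective dimension on both sides. The
    induction along syzygies starts from R, which is settled by its coresolution. *)
Theorem dual_good X : fpd X -> dgood X.
Proof.
have [_ _ eT] := Tstrong.
move=> [n]; elim: n X => [|n IH] X hX; first exact: good_proj.
have [k [Z [i [p [Si hZ]]]]] := fpd_cover hR hX.
have [rZ pZ dZ] := IH _ hZ; have [rF pF dF] := good_proj (fgpd_free R k).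
have eX := eT X (ex_intro _ n.+1 hX).
have [r q] := good_step Si eX rZ rF pF pZ.
split=> //; exact: fpd_ker hE (star_ses Si eX) dF dZ.
Qed.

(** Dualising a finite resolution by finitely generated projectives gives a coresolution in add U.
    For X = T, whose dual is E, this is the third tilting condition over E. *)
Lemma dual_coresk n X : fgpd n X -> exists s, coresk U s (S X).
Proof.
have [_ _ eT] := Tstrong.
elim: n X => [|n IH] X hX.
  by case: hX => gX pX; exists 0%N; exact: star_proj_add.
have [k [Z [i [p [Si hZ]]]]] := fpd_cover hR hX; have [s cZ] := IH _ hZ.
exists s.+1, (S (free R k)), (S Z), (starm p), (starm i); split=> //.
  exact: star_ses Si (eT X (ex_intro _ n.+1 hX)).
by case: (fgpd_free R k) => gF pF; exact: star_proj_add.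
Qed.

Lemma coresk_E : exists s, coresk U s (E^o : lmodType E).
Proof.
have [[n hT] _ _] := Tstrong; have [s cs] := dual_coresk hT.
have [f [g [fg gf]]] := star_T full faith.
by exists s; apply: (coresk_iso fg gf cs).
Qed.

Lemma cogen_strong X : fpd X -> exists n (f : {linear X -> {ffun 'I_n -> T}}), injective f.
Proof.
by move=> hX; have [r _ [n [gS _]]] := dual_good hX; exact: refl_embed.
Qed.

(* A presentation of C is the dual of a map f between powers of T; when C has
   no map to U, f is injective, so Ext^1(coker f, T) = 0 makes the dual of f
   onto, that is C = 0. *)
Lemma strong_nonzero (C : lmodType E) : fin_gen C ->
  (forall h : {linear C -> U}, forall x, h x = 0) -> is_zero C.
Proof.
move=> /fin_genP[n [p ps]] hC.
have [Z [j Sj]] := ses_ker ps; have [ji je _] := Sj.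
have /fin_genP[m [q qs]] := hE ji (fin_gen_free E n).
pose e i := lin_inj_at (E^o : lmodType E) (i : 'I_m) 1.
pose d i l : E := j (q (e i)) l.
have hf : linear (fun t : {ffun 'I_n -> T} => [ffun i => \sum_l bs (d i l *: bt (t l))] : {ffun 'I_m -> T}).
  move=> r t t'; apply/ffunP => i; rewrite !ffunE scaler_sumr -big_split.
  apply: eq_bigr => l _ /=; rewrite !ffunE btD scalerDr bsD; congr (_ + _).
  by rewrite btC.
pose f := mklin hf.
(* A tuple in the kernel satisfies the relations of C, so it defines a map from C to U, which is
   zero. *)
have hker (t : 'I_n -> T) : (forall i, \sum_l bs (d i l *: bt (t l)) = 0) -> forall l, t l = 0.
  move=> ht l.
  have [g gE] := free_map (fun l => bt (t l)).
  have [|h hE'] := desc_coker (h := g) je ps.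
    move=> z; have [u <-] := qs z; rewrite (_ : g _ = linc g (linc j q) u) // lin_free big1 // => i _.
    rewrite (_ : linc g _ _ = \sum_l d i l *: bt (t l)); last exact: gE.
    rewrite (_ : \sum_l _ = 0) ?scaler0 //.
    by apply: (can_inj (bsK (b := B))); rewrite bs_sum bs0 ht.
  have := hE' (lin_inj_at (E^o : lmodType E) l 1); rewrite hC gE (bigD1 l) //=.
  rewrite ffunE eqxx scale1r big1 ?addr0 => [|l' l'l]; last first.
    by rewrite ffunE (negbTE l'l) scale0r.
  by rewrite -bt0 => /(can_inj (btK (b := B))).
have fi : injective f.
  apply: lin_inj => t ft; apply/ffunP => l; rewrite ffunE; apply: hker l => i.
  by have := congr1 (fun u : {ffun 'I_m -> T} => u i) ft; rewrite !ffunE.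
have [W [g Sf]] := ses_coker fi.
have [[nT hT] _ eT] := Tstrong.
have eW : ext1 W T.
  by apply: eT; apply: fpd_coker Sf _ _; exists nT; exact: fgpd_ffun.
(* The l-th projection extends along f. The components of the extension are multiplications by
   elements c i of E, and faithfulness turns this into an expression of the l-th basis vector by the
   relations of C. *)
have pz l : p (lin_inj_at (E^o : lmodType E) l 1) = 0.
  have [h hE'] := eW _ _ _ _ Sf (lin_proj T l).
  have /choice[c cE] : forall i : 'I_m, exists b, forall t, h (lin_inj_at T i t) = bs (b *: bt t).
    by move=> i; exact: full (linc h (lin_inj_at T i)).
  apply/je; exists (\sum_i c i *: q (e i)).
  rewrite raddf_sum; apply/ffunP => l'; rewrite sum_ffunE.
  transitivity ((\sum_i c i * d i l') : E); first by apply: eq_bigr => i _ /=; rewrite linearZ ffunE.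
  apply/eqP; rewrite -subr_eq0; apply/eqP/faith => t.
  apply: (can_inj (bsK (b := B))); rewrite bs0 scalerBl.
  have := hE' (lin_inj_at T l' t); rewrite (ffun_decomp (f _)) raddf_sum /=.
  under eq_bigr => i _.
    rewrite cE ffunE (bigD1 l') //= ffunE eqxx big1 ?addr0 => [|l'' ll]; last first.
      by rewrite ffunE (negbTE ll) bt0 scaler0 bs0.
    rewrite bsK scalerA; over.
  rewrite -bs_sum -scaler_suml ffunE => e1.
  apply: (can_inj (btK (b := B))); rewrite bsK bt0.
  have := congr1 bt e1; rewrite bsK => ->.
  rewrite ffunE [l' == l]eq_sym; case: eqP => _; rewrite ?bt0 ?scale0r ?subr0 ?scale1r ?subrr //.
move=> x; have [u <-] := ps x; rewrite lin_free big1 // => l _.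
by rewrite pz scaler0.
Qed.

End Duality.

(** * The tilting module seen from its endomorphism ring *)

Section Reverse.
Variables (R E : pzRingType) (B : bimod R E).
Hypotheses (hR : noeth R) (hE : noeth E).
Hypotheses (full : bfull B) (faith : bfaith B) (Tstrong : fstrong (bl B)).
Hypothesis detect : forall C : lmodType R, fin_gen C ->
  (forall h : {linear C -> bl B}, forall x, h x = 0) -> is_zero C.

(** E is reflexive because its dual is T, and [good_step] carries this along syzygies. The nonformal
    point is Ext^1(M, U) = 0 for a presentation 0 -> Z -> F -> M -> 0: with C the cokernel of the
    dual of Z -> F, a map from C to T is evaluation at an element of Z that vanishes in F, so it is
    zero, and [detect] gives C = 0. *)
Theorem reverse_strong : fstrong (br B).
Proof.
have [dT _ eT] := Tstrong.
have full' := full_bop hR full faith Tstrong.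
have faith' := faith_bop hR full faith Tstrong.
have gT : fin_gen (bl B) by case: dT => n [].
have pT := fpd_perp hR eT dT.
pose good M := refl (bop B) M /\ perp (bl B) (star (bop B) M).
have [f [g [fg gf fE]]] := star_R1 (bop B).
have goodE : good (E^o : lmodType E).
  split; last by apply: perp_iso (can_inj gf) _ pT => u; exists (f u).
  split=> [b hb|q].
    apply: faith => t.
    have h : linear (fun c : E^o => (c : E) *: bt t : br B).
      by move=> a x y; rewrite scalerDl scalerA.
    exact: (hb (mklin h)).
  have [b bE] := full (linc q g); exists b => h.
  have := bE (f h); rewrite /= fg => ->; rewrite fE /= bsK -linearZ.
  by congr (bs (s2l h _)); exact: mulr1.
have gS : fin_gen (star (bop B) (E^o : lmodType E)).
  by apply: (fin_gen_surj (f := g)) gT => u; exists (f u); rewrite fg.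
have goodP P : fgpd 0 P -> good P.
  move=> [gP pP]; have [n rP] := fin_gen_proj gP pP; have [r p] := goodE.
  split; first exact: refl_retract rP (refl_ffun n r).
  have [a [b [ab ba]]] := star_ffun (bop B) (E^o : lmodType E) n.
  have rS : retract (star (bop B) P) {ffun 'I_n -> star (bop B) (E^o : lmodType E)}.
    by apply: retract_trans (star_retract (bop B) rP) _; exists a, b.
  apply: perp_retract hR _ rS (perp_ffun n p); exact: fin_gen_ffun.
split; first exact: fpd_U hR hE full faith Tstrong.
  exact: coresk_E hR full faith Tstrong.
suff main n M : fgpd n M -> good M /\ ext1 M (br B) by move=> M [n /main[]].
elim: n M => [|n IH] M hM.
  by split; [exact: goodP|apply: ext1_proj; case: hM].
have [k [Z [i [p [Si hZ]]]]] := fpd_cover hE hM.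
have [[rZ pZ] _] := IH _ hZ; have [rF pF] := goodP _ (fgpd_free E k).
have [ii ie ps] := Si.
have eM : ext1 M (br B).
  apply: (ext1_pres (@proj_free E k) Si) => h.
  have [C [c [cs ce]]] := coker_ex (starm (bop B) i).
  suff zC : is_zero C.
    have /ce[h' h'E] : c (@l2s _ _ (bop B) _ h) = 0 by exact: zC.
    by exists (s2l h') => z; rewrite -(@starmE _ _ (bop B) _ _ i h') h'E.
  apply: detect.
    apply: fin_gen_surj cs _; apply: star_fg => //; by case: hZ.
  move=> w x; have [u <-] := cs x; have [z zE] := rZ.2 (linc w c).
  suff z0 : z = 0 by rewrite (_ : w _ = linc w c u) // zE z0 linear0; exact: bs0.
  apply: (lin_inj0 ii); apply: rF.1 => v.
  have := zE (starm (bop B) i (@l2s _ _ (bop B) _ v)); rewrite starmE /= (exact0 _ ce) linear0.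
  by rewrite -(bs0 B) => /(can_inj (bsK (b := B))).
by split=> //; exact: (@good_step _ _ (bop B) _ _ _ i p Si eM rZ rF pF pZ).
Qed.
End Reverse.

(** * Morita contexts *)

Section Morita.
Variable K : fieldType.

(* A Morita context, as two full idempotents [al 1], [ga 1] of one algebra D
   with corners A and C. *)
Definition corner_of (A D : algType K) (al : A -> D) : Prop :=
  [/\ forall c a b, al (c *: a + b) = c *: al a + al b,
      forall a b, al (a * b) = al a * al b, injective al
    & forall d, exists a, al a = al 1 * d * al 1].

Definition full_in (D : algType K) (e f : D) : Prop :=
  exists n (x y : 'I_n -> D), \sum_i x i * f * y i = e.

Definition morita_context (A C : algType K) : Prop :=
  exists (D : algType K) (al : A -> D) (ga : C -> D),
  [/\ corner_of al, corner_of ga, full_in (al 1) (ga 1) & full_in (ga 1) (al 1)].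

Section Functor.
Variables (A C D : algType K) (al : A -> D) (ga : C -> D).
Hypotheses (hal : corner_of al) (hga : corner_of ga).

Let alL c a b : al (c *: a + b) = c *: al a + al b. Proof. by case: hal. Qed.
Let alM a b : al (a * b) = al a * al b. Proof. by case: hal. Qed.
Let alI : injective al. Proof. by case: hal. Qed.
Let alS d : exists a, al a = al 1 * d * al 1. Proof. by case: hal. Qed.
Let gaL c a b : ga (c *: a + b) = c *: ga a + ga b. Proof. by case: hga. Qed.
Let gaM a b : ga (a * b) = ga a * ga b. Proof. by case: hga. Qed.
Let al0 : al 0 = 0.
Proof. by have := alL (-1) 0 0; rewrite scaler0 addr0 scaleN1r addNr. Qed.
Let alD a b : al (a + b) = al a + al b.
Proof. by have := alL 1 a b; rewrite !scale1r. Qed.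
Let ga0 : ga 0 = 0.
Proof. by have := gaL (-1) 0 0; rewrite scaler0 addr0 scaleN1r addNr. Qed.
Let gaD a b : ga (a + b) = ga a + ga b.
Proof. by have := gaL 1 a b; rewrite !scale1r. Qed.
Let al1 a : al 1 * al a = al a. Proof. by rewrite -alM mul1r. Qed.
Let ga1 a : ga 1 * ga a = ga a. Proof. by rewrite -gaM mul1r. Qed.
Let ga1r a : ga a * ga 1 = ga a. Proof. by rewrite -gaM mulr1. Qed.
Let alk c : al c%:A = c *: al 1.
Proof. by have := alL c 1 0; rewrite !addr0 al0 addr0. Qed.
Let gak c : ga c%:A = c *: ga 1.
Proof. by have := gaL c 1 0; rewrite !addr0 ga0 addr0. Qed.

Section Obj.
Variable M : lmodType A.

(* Hom_A(eDf, M), as functions on D *)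
Definition mfun (p : D -> M) : Prop :=
  [/\ forall d d', p (d + d') = p d + p d', forall a d, p (al a * d) = a *: p d
    & forall d, p (d * ga 1) = p d].
Let car := {p : D -> M | `[< mfun p >]}.
Let vP (p : car) : mfun (sval p). Proof. exact/asboolP/(svalP p). Qed.
Let mk p (h : mfun p) : car := exist _ p (introT (asboolP _) h).
Let m0 : mfun (fun=> 0). Proof. by split=> *; rewrite ?addr0 ?scaler0. Qed.
Let mN p : mfun p -> mfun (fun d => - p d).
Proof. by case=> h1 h2 h3; split=> *; rewrite ?h1 ?h2 ?h3 ?opprD ?scalerN. Qed.
Let mD p q : mfun p -> mfun q -> mfun (fun d => p d + q d).
Proof.
by case=> h1 h2 h3 [k1 k2 k3]; split=> *; rewrite ?h1 ?k1 ?h2 ?k2 ?h3 ?k3 ?scalerDr // addrACA.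
Qed.
Let mZ c p : mfun p -> mfun (fun d => p (d * ga c)).
Proof.
case=> h1 h2 h3; split=> [d d'|a d|d]; first by rewrite mulrDl h1.
  by rewrite -mulrA h2.
by rewrite -mulrA ga1.
Qed.
Let add (p q : car) := mk (mD (vP p) (vP q)).
Let opp (p : car) := mk (mN (vP p)).
Let scl c (p : car) := mk (mZ c (vP p)).
Let addA : associative add.
Proof. by move=> p q r; apply/val_inj/funext => d; exact: addrA. Qed.
Let addC : commutative add.
Proof. by move=> p q; apply/val_inj/funext => d; exact: addrC. Qed.
Let add0 : left_id (mk m0) add.
Proof. by move=> p; apply/val_inj/funext => d; exact: add0r. Qed.
Let addN : left_inverse (mk m0) opp add.
Proof. by move=> p; apply/val_inj/funext => d; exact: addNr. Qed.
Let sA a b p : scl a (scl b p) = scl (a * b) p.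
Proof. by apply/val_inj/funext => d /=; rewrite gaM mulrA. Qed.
Let s1 : left_id 1 scl.
Proof. by move=> p; apply/val_inj/funext => d /=; case: (vP p). Qed.
Let sDr a p q : scl a (add p q) = add (scl a p) (scl a q).
Proof. exact/val_inj/funext. Qed.
Let sDl p a b : scl (a + b) p = add (scl a p) (scl b p).
Proof. by apply/val_inj/funext => d /=; rewrite gaD mulrDr; case: (vP p). Qed.
Definition mobj : lmodType C := mk_lmod addA addC add0 addN sA s1 sDr sDl.
Definition mev (p : mobj) : D -> M := sval (p : car).
Lemma mevP p : mfun (mev p). Proof. exact: vP. Qed.
Lemma mev_inj p q : mev p =1 mev q -> p = q.
Proof. by move=> h; apply/val_inj/funext. Qed.
Definition mmk p (h : mfun p) : mobj := mk h.
Lemma mmkE p (h : mfun p) : mev (mmk h) = p. Proof. by []. Qed.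
Lemma mevL c p q d : mev (c *: p + q) d = mev p (d * ga c) + mev q d.
Proof. by []. Qed.
Lemma mevD p q d : mev (p + q) d = mev p d + mev q d. Proof. by []. Qed.
Lemma mevZ c p d : mev (c *: p) d = mev p (d * ga c). Proof. by []. Qed.
Lemma mevk c p d : mev (c%:A *: p) d = c%:A *: mev p d.
Proof.
have [h1 h2 h3] := mevP p; rewrite mevZ gak -scalerAr.
have hc x : mev p (c *: x) = c%:A *: mev p x.
  rewrite -h2 alk -scalerAl -[LHS]scale1r -h2 -scalerAr.
  by [].
by rewrite hc h3.
Qed.
End Obj.

Section Map.
Variables (M N : lmodType A) (f : {linear M -> N}).
Lemma mmap_fun (p : mobj M) : mfun (fun d => f (mev p d)).
Proof.
have [h1 h2 h3] := mevP p; split=> *; first by rewrite h1 linearD.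
  by rewrite h2 linearZ.
by rewrite h3.
Qed.
Lemma mmap_linP : linear (fun p : mobj M => mmk (mmap_fun p)).
Proof.
move=> c p q; apply: mev_inj => d.
by change (f (mev p (d * ga c) + mev q d) = f (mev p (d * ga c)) + f (mev q d)); exact: linearD.
Qed.
Definition mmap : {linear mobj M -> mobj N} := mklin mmap_linP.
Lemma mmapE p d : mev (mmap p) d = f (mev p d). Proof. by []. Qed.
End Map.

Definition mfunctor : mod_functor A C.
Proof.
exists mobj mmap.
- by move=> M f fE p; apply: mev_inj => d; rewrite mmapE fE.
- by move=> M N P g f h hE p; apply: mev_inj => d; rewrite !mmapE hE.
- by move=> M N c f g h hE p; apply: mev_inj => d; rewrite mevD mevk !mmapE hE.
Defined.

End Functor.

Section Inverse.
Variables (A C D : algType K) (al : A -> D) (ga : C -> D).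
Hypotheses (hal : corner_of al) (hga : corner_of ga).
Variables (n : nat) (x y : 'I_n -> D).
Hypothesis xy : \sum_i x i * ga 1 * y i = al 1.

Let alM a b : al (a * b) = al a * al b. Proof. by case: hal. Qed.
Let alI : injective al. Proof. by case: hal. Qed.
Let alS d : exists a, al a = al 1 * d * al 1. Proof. by case: hal. Qed.
Let gaM a b : ga (a * b) = ga a * ga b. Proof. by case: hga. Qed.
Let gaS d : exists a, ga a = ga 1 * d * ga 1. Proof. by case: hga. Qed.
Let alD a b : al (a + b) = al a + al b.
Proof. by case: hal => h _ _ _; have := h 1 a b; rewrite !scale1r. Qed.
Let al1 a : al 1 * al a = al a. Proof. by rewrite -alM mul1r. Qed.
Let al1r a : al a * al 1 = al a. Proof. by rewrite -alM mulr1. Qed.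
Let ga1 a : ga 1 * ga a = ga a. Proof. by rewrite -gaM mul1r. Qed.
Let ga1r a : ga a * ga 1 = ga a. Proof. by rewrite -gaM mulr1. Qed.

Let F := mfunctor hal hga.
Let G := mfunctor hga hal.

Section AtM.
Variable M : lmodType A.
Let GF : lmodType A := mobj ga hal (mobj al hga M).
Let ev (h : GF) (d d' : D) : M := mev (mev h d) d'.

Let evD1 h d1 d2 d' : ev h (d1 + d2) d' = ev h d1 d' + ev h d2 d'.
Proof. by rewrite /ev; case: (mevP h) => -> _ _; rewrite mevD. Qed.
Let ev_al h d a d' : ev h d (al a * d') = a *: ev h d d'.
Proof. by rewrite /ev; case: (mevP (mev h d)) => _ -> _. Qed.
Let ev_bal h c d d' : ev h (ga c * d) d' = ev h d (d' * ga c).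
Proof. by rewrite /ev; case: (mevP h) => _ -> _; rewrite mevZ. Qed.
Let ev_r h d d' : ev h (d * al 1) d' = ev h d d'.
Proof. by rewrite /ev; case: (mevP h) => _ _ ->. Qed.
Let ev_g h d d' : ev h d (d' * ga 1) = ev h d d'.
Proof. by rewrite /ev; case: (mevP (mev h d)) => _ _ ->. Qed.
Let ev_sum h (I : finType) (P : I -> D) d' : ev h (\sum_i P i) d' = \sum_i ev h (P i) d'.
Proof.
have e0 : ev h 0 d' = 0 by apply: (addIr (ev h 0 d')); rewrite -evD1 !add0r.
exact: (big_morph (fun d => ev h d d') (fun d1 d2 => evD1 h d1 d2 d') e0).
Qed.

(** An element m of M corresponds to h(d)(d') = (d' f d) m, with e and f the images of the units;
    since the x_i f y_i sum to e, summing h(y_i)(x_i) gives m back. *)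
Let eta (h : GF) : M := \sum_i ev h (y i) (x i).

(** Every value of h is a multiple of [eta h]. Linearity and injectivity of [eta] both rest on this
    computation. *)
Let eta_key h d d' a : al a = al 1 * d' * ga 1 * d * al 1 -> a *: eta h = ev h d d'.
Proof.
move=> aE; rewrite /eta scaler_sumr.
have gg : ga 1 * ga 1 = ga 1 by exact: ga1.
transitivity (\sum_i ev h (ga 1 * d * al 1 * x i * ga 1 * y i) (al 1 * d' * ga 1)).
  apply: eq_bigr => i _; have [c cE] := gaS (d * al 1 * x i).
  rewrite -ev_al aE -ev_g.
  have -> : al 1 * d' * ga 1 * d * al 1 * x i * ga 1 = (al 1 * d' * ga 1) * ga c.
    by rewrite cE !mulrA -(mulrA _ (ga 1) (ga 1)) gg.
  by rewrite -ev_bal cE !mulrA.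
rewrite -ev_sum (_ : \sum_i _ = ga 1 * d * al 1 * al 1); last first.
  by rewrite -[X in _ = _ * X]xy mulr_sumr; apply: eq_bigr => i _; rewrite !mulrA.
by rewrite !ev_r ev_bal !ev_g ev_al scale1r.
Qed.

Let eta_lin : linear eta.
Proof.
move=> a h h'; rewrite /eta -/(eta h) -/(eta h').
transitivity (\sum_i (ev h (y i * al a) (x i) + ev h' (y i) (x i))).
  by apply: eq_bigr => i _; rewrite /ev mevL mevD.
rewrite big_split /=; congr (_ + _).
have /choice[q qE] : forall i, exists b, al b = al 1 * x i * ga 1 * (y i * al a) * al 1.
  by move=> i; have [b bE] := alS (x i * ga 1 * (y i * al a)); exists b; rewrite bE !mulrA.
under eq_bigr => i _ do rewrite -(eta_key _ (qE i)).
rewrite -scaler_suml; congr (_ *: _); apply: alI.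
have al0 : al 0 = 0 by apply: (addIr (al 0)); rewrite -alD !add0r.
rewrite (big_morph al alD al0).
transitivity (\sum_i al 1 * (x i * ga 1 * y i) * (al a * al 1)).
  by apply: eq_bigr => i _; rewrite qE !mulrA.
by rewrite -mulr_suml -mulr_sumr xy !al1r !al1.
Qed.

Let eta_inj : injective (mklin eta_lin).
Proof.
apply: lin_inj => h h0; apply: mev_inj => d; apply: mev_inj => d'.
have [a aE] := alS (d' * ga 1 * d).
have := @eta_key h d d' a; rewrite aE !mulrA => /(_ erefl).
by rewrite (_ : eta h = 0) // scaler0.
Qed.

Let eta_surj : surjective_map (mklin eta_lin).
Proof.
move=> m; have [q qE] := choice (fun d => alS d).
have qD d d' : q (d + d') = q d + q d'.
  by apply: alI; rewrite alD !qE mulrDr mulrDl.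
have qM a d : q (al a * d) = a * q d.
  by apply: alI; rewrite alM !qE !mulrA al1 al1r.
have h1 d : mfun al ga (fun d' => q (d' * ga 1 * d) *: m).
  split=> [d1 d2|a d1|d1]; first by rewrite !mulrDl qD scalerDl.
    by rewrite -!mulrA qM scalerA.
  by rewrite -(mulrA d1) ga1.
have h2 : mfun ga al (fun d => mmk hga (h1 d) : mobj al hga M).
  split=> [d1 d2|c d1|d1]; apply: mev_inj => d'.
  - by rewrite mevD !mmkE mulrDr qD scalerDl.
  - by rewrite mevZ !mmkE -!mulrA (mulrA (ga 1) (ga c)) ga1 (mulrA (ga c) (ga 1)) ga1r.
  - rewrite !mmkE; congr (_ *: _); apply: alI; rewrite !qE.
    by rewrite -!mulrA; congr (_ * _); rewrite !mulrA -(mulrA _ (al 1)) al1.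
exists (mmk hal h2); rewrite /= /eta /ev.
rewrite -[RHS]scale1r -[in RHS](_ : \sum_i q (x i * ga 1 * y i) = 1) ?scaler_suml //.
have al0 : al 0 = 0 by apply: (addIr (al 0)); rewrite -alD !add0r.
apply: alI; rewrite (big_morph al alD al0).
transitivity (\sum_i al 1 * (x i * ga 1 * y i) * al 1).
  by apply: eq_bigr => i _; rewrite qE.
by rewrite -mulr_suml -mulr_sumr xy !al1.
Qed.

Definition meta : {linear G (F M) -> M} := mklin eta_lin.
Lemma metaE h : meta h = \sum_i mev (mev h (y i)) (x i). Proof. by []. Qed.
Lemma meta_bij : bijective meta.
Proof. by have [g [e1 e2]] := inv_ex eta_inj eta_surj; exists g. Qed.

End AtM.
Lemma mfunctor_inverse : nat_iso_id F G.
Proof.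
exists meta; split; first exact: meta_bij.
move=> M N f h; rewrite !metaE raddf_sum; apply: eq_bigr => i _.
by [].
Qed.

End Inverse.

Lemma morita_context_equivalent (A C : algType K) :
  morita_context A C -> morita_equivalent A C.
Proof.
move=> [D [al [ga [hal hga [n [x [y xy]]] [m [z [w zw]]]]]]].
exists (mfunctor hal hga), (mfunctor hga hal).
by split; [exact: mfunctor_inverse xy|exact: mfunctor_inverse zw].
Qed.

Lemma morita_context_op (A C : algType K) :
  morita_context A^c C^c -> morita_context A C.
Proof.
move=> [D [al [ga [[a1 a2 a3 a4] [g1 g2 g3 g4] [n [x [y xy]]] [m [z [w zw]]]]]]].
exists (D^c : algType K), al, ga; split.
- split=> //; first by move=> a b; exact: (a2 b a).
  by move=> d; have [a aE] := a4 d; exists a; rewrite aE; exact/esym/(@mulrA D).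
- split=> //; first by move=> a b; exact: (g2 b a).
  by move=> d; have [a aE] := g4 d; exists a; rewrite aE; exact/esym/(@mulrA D).
- by exists n, y, x; rewrite -[RHS]xy; apply: eq_bigr => i _; exact: (@mulrA D).
- by exists m, w, z; rewrite -[RHS]zw; apply: eq_bigr => i _; exact: (@mulrA D).
Qed.
End Morita.

(** * Endomorphism algebras and periodicity *)

Section EndAlgebra.
Variables (K : fieldType) (A : algType K) (T : lmodType A).
Hypothesis nz : exists t : T, t <> 0.

(** The proof that T is nonzero is part of the type because rings in [algType] satisfy 1 <> 0. *)
Definition endo of (exists t : T, t <> 0) := {linear T -> T}.
Local Notation EndT := (endo nz).
HB.instance Definition _ := GRing.Zmodule.on EndT.

Definition of_endo (f : EndT) : {linear T -> T} := f.
Let mul (f g : EndT) : EndT := linc (of_endo f) (of_endo g).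
Let one : EndT := lin1 T.
Let mulA : associative mul. Proof. by move=> f g h; apply: lin_ext. Qed.
Let mul1 : left_id one mul. Proof. by move=> f; apply: lin_ext. Qed.
Let mulr_1 : right_id one mul. Proof. by move=> f; apply: lin_ext. Qed.
Let mulDl : left_distributive mul +%R. Proof. by move=> f g h; apply: lin_ext. Qed.
Let mulDr : right_distributive mul +%R.
Proof. by move=> f g h; apply: lin_ext => x; exact: linearD. Qed.
Let one0 : one != 0.
Proof.
apply/eqP => e; have [t t0] := nz; apply: t0.
exact: (congr1 (fun f : EndT => of_endo f t) e).
Qed.
HB.instance Definition _ := GRing.Zmodule_isNzRing.Build EndT
  mulA mul1 mulr_1 mulDl mulDr one0.

Lemma central_scale (c : K) (a : A) (t : T) : c%:A *: (a *: t) = a *: (c%:A *: t).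
Proof. by rewrite !scalerA -scalerAl -scalerAr mul1r mulr1. Qed.

Let scl_linP (c : K) (f : {linear T -> T}) : linear (fun t : T => c%:A *: f t : T).
Proof. by move=> a x y; rewrite linearP scalerDr central_scale. Qed.
Let scl (c : K) (f : EndT) : EndT := mklin (scl_linP c (of_endo f)).
Let sclA a b f : scl a (scl b f) = scl (a * b) f.
Proof. by apply: lin_ext => t /=; rewrite scalerA -scalerAl mul1r scalerA. Qed.
Let scl1 : left_id 1 scl.
Proof. by move=> f; apply: lin_ext => t /=; rewrite !scale1r. Qed.
Let sclDr : right_distributive scl +%R.
Proof. by move=> a f g; apply: lin_ext => t; exact: scalerDr. Qed.
Let sclDl f : {morph scl^~ f : a b / a + b}.
Proof. by move=> a b; apply: lin_ext => t /=; rewrite !scalerDl. Qed.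
HB.instance Definition _ := GRing.Zmodule_isLmodule.Build K EndT sclA scl1 sclDr sclDl.
Let sclAl (c : K) (f g : EndT) : c *: (f * g) = (c *: f) * g.
Proof. exact: lin_ext. Qed.
HB.instance Definition _ := GRing.Lmodule_isLalgebra.Build K EndT sclAl.
Let sclAr (c : K) (f g : EndT) : c *: (f * g) = f * (c *: g).
Proof. by apply: lin_ext => t; exact/esym/linearZ. Qed.
HB.instance Definition _ := GRing.Lalgebra_isAlgebra.Build K EndT sclAr.

Definition endalg : algType K := EndT.
Lemma endalgM (f g : endalg) t : of_endo (f * g) t = of_endo f (of_endo g t).
Proof. by []. Qed.
Lemma endalgZ (c : K) (f : endalg) t : of_endo (c *: f) t = c%:A *: of_endo f t.
Proof. by []. Qed.
Lemma endalgD (f g : endalg) t : of_endo (f + g) t = of_endo f t + of_endo g t.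
Proof. by []. Qed.
Lemma endalg_ext (f g : endalg) : of_endo f =1 of_endo g -> f = g.
Proof. exact: lin_ext. Qed.
End EndAlgebra.

Section AlgebraStructure.
Variables (K : fieldType).
Implicit Types A C : algType K.

Definition kstr_alg A : fin_gen (A : lmodType K) -> kstr K A.
Proof.
move=> h; refine (@KStr K A (fun c : K => c%:A : A) _ _ _ _ _).
- exact: scale1r.
- by move=> a b; rewrite scalerDl.
- by move=> a b; rewrite -scalerAl mul1r scalerA.
- by move=> a r; rewrite -scalerAl -scalerAr mul1r mulr1.
- have [n [g gP]] := h; exists n, g => r; have [c ->] := gP r; exists c.
  by apply: eq_bigr => i _; rewrite -scalerAl mul1r.
Defined.

Lemma kstr_algE A (h : fin_gen (A : lmodType K)) c : kstr_alg h c = c%:A.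
Proof. by []. Qed.

Definition kcompat A C (B : bimod A C) : Prop :=
  forall (c : K) (t : bl B), bs (c%:A *: bt t) = c%:A *: t.

Lemma iso_End_bimod A (T : lmodType A) C : iso_End T C ->
  exists B : bimod A C, [/\ bl B = T, bfull B, bfaith B & kcompat B].
Proof.
move=> [phi [phiL phi1 phiM phiI phiS]].
have phiD b c t : phi (b + c) t = phi b t + phi c t.
  by have := phiL 1 b c t; rewrite !scale1r.
have sA a b (t : T) : phi a (phi b t) = phi (a * b) t by rewrite phiM.
have s1 : left_id 1 (fun b (t : T) => phi b t) by move=> t; exact: phi1.
have sDr b (x y : T) : phi b (x + y) = phi b x + phi b y by exact: linearD.
have sDl (t : T) b c : phi (b + c) t = phi b t + phi c t by exact: phiD.
pose U : lmodType C := mk_lmod (@addrA T) (@addrC T) (@add0r T) (@addNr T) sA s1 sDr sDl.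
pose t1 (t : T) : U := t; pose t2 (u : U) : T := u.
have h1 : cancel t1 t2 by [].
have h2 : cancel t2 t1 by [].
have h3 x y : t1 (x + y) = t1 x + t1 y by [].
have h4 (r : A) (b : C) (t : T) : t2 (b *: t1 (r *: t)) = r *: t2 (b *: t1 t).
  by have := linearP (phi b) r t 0; rewrite linear0 !addr0.
exists (Bimod h1 h2 h3 h4); split=> //.
  by move=> f; have [b bE] := phiS f; exists b => t; rewrite -bE.
move=> c t; have := phiL c 1 0 t; rewrite addr0 phi1.
have -> : phi 0 t = 0 by apply: (addIr (phi 0 t)); rewrite -phiD !add0r.
by rewrite addr0.
Qed.

Lemma bimod_iso_End A C (B : bimod A C) : bfull B -> bfaith B -> kcompat B ->
  iso_End (bl B) C.
Proof.
move=> full faith kB; exists (fun b => bact B b); split.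
- move=> c b1 b2 t /=; rewrite scalerDl bsD; congr (_ + _).
  rewrite -[in LHS](mul1r b1) scalerAl -scalerA -{1}(bsK (b1 *: bt t)).
  exact: kB.
- by move=> t /=; rewrite scale1r btK.
- by move=> b1 b2 t /=; rewrite bsK scalerA.
- move=> b h; apply: faith => t; apply: (can_inj (bsK (b := B))).
  by rewrite bs0; exact: h.
- by move=> f; have [b bE] := full f; exists b => t; rewrite bE.
Qed.

Lemma kcompat_bop A C (B : bimod A C) : kcompat B -> kcompat (bop B).
Proof. by move=> kB c u /=; rewrite -kB !bsK. Qed.

(** Both algebras are corners of D = End(T1 x T2). A retraction of T1 from a power of T2 writes the
    identity of T1 as a sum of maps through T2, which is fullness; the other direction is the
    same. *)
Lemma add_full A C1 C2 (B1 : bimod A C1) (B2 : bimod A C2) :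
  bfull B1 -> bfaith B1 -> kcompat B1 -> bfull B2 -> bfaith B2 -> kcompat B2 ->
  in_add (bl B2) (bl B1) -> in_add (bl B1) (bl B2) -> morita_context C1 C2.
Proof.
move=> full1 faith1 k1 full2 faith2 k2 a12 a21.
pose T1 := bl B1; pose T2 := bl B2; pose W : lmodType A := (T1 * T2)%type.
have nz : exists t : W, t <> 0.
  apply: contrapT => h; apply: (elimN eqP (oner_neq0 C1)); apply: faith1 => t.
  apply: contrapT => t0; apply: h; exists (t, 0) => -[e].
  by apply: t0; rewrite e bt0 scaler0.
pose D := endalg nz.
pose i1 := lin_pair (lin1 T1) (lin0 T1 T2).
pose i2 := lin_pair (lin0 T2 T1) (lin1 T2).
pose p1 : {linear W -> T1} := lin_fst T1 T2; pose p2 : {linear W -> T2} := lin_snd T1 T2.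
pose al c : D := linc i1 (linc (bact B1 c) p1).
pose ga c : D := linc i2 (linc (bact B2 c) p2).
have corner1 : corner_of al.
  split.
  - move=> c a b; apply: endalg_ext => w; rewrite endalgD endalgZ /=.
    congr pair; last by rewrite /= scaler0 addr0.
    rewrite /= scalerDl bsD; congr (_ + _).
    by rewrite -[in LHS](mul1r a) scalerAl -scalerA -{1}(bsK (a *: _)) k1.
  - move=> a b; apply: endalg_ext => w; rewrite endalgM /=.
    by rewrite bsK scalerA.
  - move=> a b e; apply/eqP; rewrite -subr_eq0; apply/eqP/faith1 => t.
    have := congr1 (fun f : D => bt (of_endo f (t, 0)).1) e.
    by rewrite /= !bsK scalerBl => ->; rewrite subrr.
  - move=> d; have [a aE] := full1 (linc p1 (linc (of_endo d) i1)).
    exists a; apply: endalg_ext => w; rewrite !endalgM /= -aE /=.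
    by rewrite !scale1r !btK.
have corner2 : corner_of ga.
  split.
  - move=> c a b; apply: endalg_ext => w; rewrite endalgD endalgZ /=.
    congr pair; first by rewrite /= scaler0 addr0.
    rewrite /= scalerDl bsD; congr (_ + _).
    by rewrite -[in LHS](mul1r a) scalerAl -scalerA -{1}(bsK (a *: _)) k2.
  - move=> a b; apply: endalg_ext => w; rewrite endalgM /=.
    by rewrite bsK scalerA.
  - move=> a b e; apply/eqP; rewrite -subr_eq0; apply/eqP/faith2 => t.
    have := congr1 (fun f : D => bt (of_endo f (0, t)).2) e.
    by rewrite /= !bsK scalerBl => ->; rewrite subrr.
  - move=> d; have [a aE] := full2 (linc p2 (linc (of_endo d) i2)).
    exists a; apply: endalg_ext => w; rewrite !endalgM /= -aE /=.
    by rewrite !scale1r !btK.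
exists D, al, ga; split=> //.
- have /in_addP[n [i [p ip]]] := a12.
  exists n, (fun j => linc i1 (linc p (linc (lin_inj_at T2 j) p2)) : D),
    (fun j => linc i2 (linc (lin_proj T2 j) (linc i p1)) : D).
  apply: endalg_ext => w.
  have h (r : seq 'I_n) (F : 'I_n -> D) : of_endo (\sum_(j <- r) F j) w = \sum_(j <- r) of_endo (F j) w.
    by elim: r => [|j r IH]; rewrite ?big_nil // !big_cons endalgD IH.
  rewrite h /= scale1r btK -{2}(ip w.1) {2}(ffun_decomp (i w.1)) raddf_sum.
  rewrite [RHS](_ : _ = i1 (\sum_j p (lin_inj_at T2 j (i w.1 j)))) // raddf_sum.
  by apply: eq_bigr => j _; rewrite /= scale1r btK.
- have /in_addP[n [i [p ip]]] := a21.
  exists n, (fun j => linc i2 (linc p (linc (lin_inj_at T1 j) p1)) : D),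
    (fun j => linc i1 (linc (lin_proj T1 j) (linc i p2)) : D).
  apply: endalg_ext => w.
  have h (r : seq 'I_n) (F : 'I_n -> D) : of_endo (\sum_(j <- r) F j) w = \sum_(j <- r) of_endo (F j) w.
    by elim: r => [|j r IH]; rewrite ?big_nil // !big_cons endalgD IH.
  rewrite h /= scale1r btK -{2}(ip w.2) {2}(ffun_decomp (i w.2)) raddf_sum.
  rewrite [RHS](_ : _ = i2 (\sum_j p (lin_inj_at T1 j (i w.2 j)))) // raddf_sum.
  by apply: eq_bigr => j _; rewrite /= scale1r btK.
Qed.

End AlgebraStructure.

Section Periodicity.
Variable K : fieldType.

(* T0 has a nonzero map from every nonzero finitely generated R1-module
   ([strong_nonzero]) and embeds in a power of T1, so T1 has one as well. *)
Lemma strong_step (R0 R1 R2 : algType K) (B0 : bimod R0 R1) (B1 : bimod R1 R2) :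
  noeth R0 -> noeth R1 -> noeth R2 -> bfull B0 -> bfaith B0 -> bfull B1 -> bfaith B1 ->
  fstrong (bl B0) -> fstrong (bl B1) -> fstrong (br B1).
Proof.
move=> h0 h1 h2 full0 faith0 full1 faith1 s0 s1.
apply: (reverse_strong h1 h2 full1 faith1 s1) => C gC hC.
have dU := fpd_U h0 h1 full0 faith0 s0.
have [n [f fi]] := cogen_strong h1 h2 full1 faith1 s1 dU.
apply: (strong_nonzero h1 full0 faith0 s0 gC) => h x; apply: (lin_inj0 fi).
by apply/ffunP => i; rewrite [RHS]ffunE; exact: (hC (linc (lin_proj _ i) (linc f h))).
Qed.

(** Uniqueness of strong tilting modules up to add: T1 embeds in a power of T2 with a cokernel of
    finite projective dimension, and Ext^1 from such a module to T1 vanishes, so the embedding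
    splits. *)
Lemma strong_add (R S1 S2 : algType K) (B1 : bimod R S1) (B2 : bimod R S2) :
  noeth R -> noeth S1 -> noeth S2 -> bfull B1 -> bfaith B1 -> bfull B2 -> bfaith B2 ->
  fstrong (bl B1) -> fstrong (bl B2) -> in_add (bl B2) (bl B1).
Proof.
move=> h h1 h2 full1 faith1 full2 faith2 s1 s2.
have [d1 _ e1] := s1; have [[m d2] _ e2] := s2.
have [n [f fi]] := cogen_strong h h2 full2 faith2 s2 d1.
have [Z [g Sf]] := ses_coker fi.
have dZ : fpd Z.
  by apply: fpd_coker Sf d1 _; exists m; exact: fgpd_ffun.
have [r fr] := ext1_splits Sf (e1 _ dZ).
by apply/in_addP; exists n, f, r.
Qed.

(** Over R2, both T2 and the module T1 read from its other side are strong tilting; their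
    endomorphism rings are R3 and R1. *)
Lemma periodic_context (R0 R1 R2 R3 : algType K)
    (T0 : lmodType R0) (T1 : lmodType R1) (T2 : lmodType R2) :
  fin_gen (R0 : lmodType K) -> fin_gen (R1 : lmodType K) ->
  fin_gen (R2 : lmodType K) -> fin_gen (R3 : lmodType K) ->
  strong_tilting T0 -> strong_tilting T1 -> strong_tilting T2 ->
  iso_End T0 R1 -> iso_End T1 R2 -> iso_End T2 R3 -> morita_context R1 R3.
Proof.
move=> /kstr_alg/noeth_kstr h0 /kstr_alg/noeth_kstr h1 /kstr_alg/noeth_kstr h2.
move=> /kstr_alg/noeth_kstr h3 /(strong_tiltingP _ h0) s0 /(strong_tiltingP _ h1) s1.
move=> /(strong_tiltingP _ h2) s2 /iso_End_bimod[B0 [e0 full0 faith0 k0]].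
move=> /iso_End_bimod[B1 [e1 full1 faith1 k1]] /iso_End_bimod[B2 [e2 full2 faith2 k2]].
subst T0 T1 T2.
have s1' := strong_step h0 h1 h2 full0 faith0 full1 faith1 s0 s1.
have full1' := full_bop h1 full1 faith1 s1.
have faith1' := faith_bop h1 full1 faith1 s1.
apply: (@add_full K R2 R1 R3 (bop B1) B2) => //.
- exact: kcompat_bop.
- exact: (@strong_add R2 R1 R3 (bop B1) B2).
- exact: (@strong_add R2 R3 R1 B2 (bop B1)).
Qed.

End Periodicity.

(** * Transfer of approximations along Hom(V, -) *)

Section HomSource.
Variables (R S : pzRingType) (B : bimod R S^c).
Implicit Types (s : S).
Local Notation V := (bl B).
Definition ract (s : S) : {linear V -> V} := bact B (s : S^c).
Lemma ractM s t v : ract (s * t) v = ract t (ract s v).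
Proof. by rewrite /= bsK scalerA. Qed.
Lemma ract1 v : ract 1 v = v.
Proof. by rewrite /= [_ *: _]scale1r btK. Qed.
Lemma ractD s t v : ract (s + t) v = ract s v + ract t v.
Proof. by rewrite /= [(s + t : S^c) *: _]scalerDl bsD. Qed.

Section Obj.
Variable M : lmodType R.
Let scl s (f : {linear V -> M}) := linc f (ract s).
Let sA a b f : scl a (scl b f) = scl (a * b) f.
Proof. by apply: lin_ext => v; rewrite [RHS](_ : _ = f (ract (a * b) v)) // ractM. Qed.
Let s1 : left_id 1 scl.
Proof. by move=> f; apply: lin_ext => v; rewrite [LHS](_ : _ = f (ract 1 v)) // ract1. Qed.
Let sDr a f g : scl a (f + g) = scl a f + scl a g.
Proof. exact: lin_ext. Qed.
Let sDl f a b : scl (a + b) f = scl a f + scl b f.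
Proof.
apply: lin_ext => v; rewrite [LHS](_ : _ = f (ract (a + b) v)) //.
by rewrite ractD linearD.
Qed.
(** Hom_R(V, M) as a left S-module. The right action of S on V is encoded as a left action of S^c,
    which is why [B] relates R and S^c. *)
Definition hsrc : lmodType S :=
  mk_lmod (@addrA {linear V -> M}) (@addrC {linear V -> M})
    (@add0r {linear V -> M}) (@addNr {linear V -> M}) sA s1 sDr sDl.
Definition h2l (f : hsrc) : {linear V -> M} := f.
Definition l2h (f : {linear V -> M}) : hsrc := f.
Lemma h2lP s f g v : h2l (s *: f + g) v = h2l f (ract s v) + h2l g v.
Proof. by []. Qed.
Lemma h2lD f g v : h2l (f + g) v = h2l f v + h2l g v. Proof. by []. Qed.
Lemma h2lZ s f v : h2l (s *: f) v = h2l f (ract s v). Proof. by []. Qed.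
Lemma h2l0 v : h2l 0 v = 0. Proof. by []. Qed.
Lemma h2l_sum n (F : 'I_n -> hsrc) v : h2l (\sum_i F i) v = \sum_i h2l (F i) v.
Proof. exact: (big_morph (fun f => h2l f v) (fun f g => h2lD f g v) (h2l0 v)). Qed.
Lemma l2hK f : h2l (l2h f) = f. Proof. by []. Qed.
Lemma h_ext f g : h2l f =1 h2l g -> f = g. Proof. exact: lin_ext. Qed.
End Obj.
End HomSource.
Arguments h2l {R S B M}.
Arguments l2h {R S B M}.

Section HomSourceMaps.
Variables (R S : pzRingType) (B : bimod R S^c).
Implicit Types M N X Y Z : lmodType R.
Local Notation V := (bl B).
Local Notation H := (hsrc B).

Lemma hmap_linP M N (f : {linear M -> N}) :
  linear (fun g : H M => l2h (linc f (h2l g)) : H N).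
Proof.
move=> s g h; apply: h_ext => v.
change (f (h2l g (ract B s v) + h2l h v) = f (h2l g (ract B s v)) + f (h2l h v)).
exact: linearD.
Qed.
Definition hmap M N f : {linear H M -> H N} := mklin (@hmap_linP M N f).
Lemma hmapE M N (f : {linear M -> N}) g v : h2l (hmap f g) v = f (h2l g v).
Proof. by []. Qed.

Lemma hmap_ses X Y Z (f : {linear X -> Y}) (g : {linear Y -> Z}) :
  projective V -> ses f g -> ses (hmap f) (hmap g).
Proof.
move=> pV Sf; have [fi fe gs] := Sf; split.
- move=> a b e; apply: h_ext => v; apply: fi; by rewrite -!hmapE e.
- move=> h; split=> [h0|[k <-]]; last first.
    by apply: h_ext => v; rewrite !hmapE (ses0 _ Sf) h2l0.
  have [|k kE] := lift_ker (h := h2l h) fi fe; first by move=> v; rewrite -hmapE h0.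
  by exists (l2h k); apply: h_ext => v; rewrite hmapE kE.
- move=> h; have [k kE] := pV _ _ g (h2l h) gs.
  by exists (l2h k); apply: h_ext => v; rewrite hmapE kE.
Qed.

Lemma hmap_retract X Y : retract X Y -> retract (H X) (H Y).
Proof.
move=> [i [p ip]]; exists (hmap i), (hmap p) => f; apply: h_ext => v.
by rewrite !hmapE ip.
Qed.

Lemma hsrc_ffun X n : retract (H {ffun 'I_n -> X}) {ffun 'I_n -> H X}.
Proof.
exists (lin_tuple (fun i : 'I_n => hmap (lin_proj X i))),
  (lin_cotuple (fun i : 'I_n => hmap (lin_inj_at X i))) => f.
apply: h_ext => v; rewrite [RHS]ffun_decomp.
rewrite (_ : lin_cotuple _ _ = \sum_i hmap (lin_inj_at X i) (hmap (lin_proj X i) f)).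
  by rewrite h2l_sum.
by apply: eq_bigr => i _; rewrite ffunE.
Qed.

Lemma hsrc_fg (K : fieldType) (kR : kstr K R) (kS : kstr K S) M :
  (forall c v, ract B (kS c) v = kR c *: v) ->
  fin_gen V -> fin_gen M -> fin_gen (H M).
Proof.
move=> hk [n [g gP]] gM; apply/(fin_gen_kmod kS).
have hL : linear (fun f : kmod kS (H M) =>
   [ffun i => h2l f (g i)] : kmod kR {ffun 'I_n -> M}).
  move=> c f f'; apply/ffunP => i; rewrite !ffunE.
  rewrite (_ : h2l _ _ = h2l f (ract B (kS c) (g i)) + h2l f' (g i)) // hk linearZ.
  by [].
apply: (noeth_field (i := mklin hL)); last first.
  by apply/(fin_gen_kmod kR); exact: fin_gen_ffun.
move=> f f' e; apply: h_ext => v; have [c ->] := gP v.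
rewrite !raddf_sum; apply: eq_bigr => i _ /=; rewrite !linearZ; congr (_ *: _).
by have := congr1 (fun u : {ffun 'I_n -> M} => u i) e; rewrite !ffunE.
Qed.

End HomSourceMaps.

(* Contravariant finiteness of the modules of finite projective dimension: by
   Wakamatsu's lemma minimal approximations have this shape. *)
Definition app (R : pzRingType) : Prop := forall X : lmodType R, fin_gen X ->
  exists (L Q : lmodType R) (i : {linear L -> Q}) (p : {linear Q -> X}),
  [/\ ses i p, fin_gen L, fpd Q & forall M, fpd M -> ext1 M L].

Definition bdd (R : pzRingType) : Prop :=
  exists d, forall M : lmodType R, fpd M -> pdle d M.

Lemma retract_bij (R : pzRingType) (X Y : lmodType R) (f : {linear X -> Y}) :
  injective f -> surjective_map f -> retract X Y /\ retract Y X.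
Proof.
by move=> fi fs; have [g [fg gf]] := inv_ex fi fs; split; [exists f, g|exists g, f].
Qed.

Section Transfer.
Variables (K : fieldType) (R S : pzRingType) (kR : kstr K R) (kS : kstr K S).
Variable B : bimod R S^c.
Implicit Types M X Y Z W C P : lmodType R.
Implicit Types N L Q : lmodType S.
Local Notation V := (bl B).
Local Notation Phi := (hsrc B).
Local Notation act := (ract B).

Section Coinduction.
Let U : lmodType S := Phi (R^o : lmodType R).

Lemma umul_linP (r : R) (u : U) : linear (fun v : V => (h2l u v : R) * r : R^o).
Proof. by move=> a x y; rewrite linearP mulrDl -mulrA. Qed.
Definition umul r u : U := l2h (mklin (umul_linP r u)).
Lemma umulE r u v : h2l (umul r u) v = (h2l u v : R) * r. Proof. by []. Qed.

Let umulA (a b : R^c) u : umul a (umul b u) = umul (a * b) u.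
Proof. by apply: h_ext => v; rewrite !umulE -mulrA. Qed.
Let umul1 : left_id (1 : R^c) umul.
Proof. by move=> u; apply: h_ext => v; rewrite umulE mulr1. Qed.
Let umulDr (a : R^c) u w : umul a (u + w) = umul a u + umul a w.
Proof. by apply: h_ext => v; rewrite h2lD !umulE h2lD mulrDl. Qed.
Let umulDl u (a b : R^c) : umul (a + b) u = umul a u + umul b u.
Proof. by apply: h_ext => v; rewrite h2lD !umulE mulrDr. Qed.
Let Ur : lmodType R^c :=
  mk_lmod (@addrA U) (@addrC U) (@add0r U) (@addNr U) umulA umul1 umulDr umulDl.
Let toUr (u : U) : Ur := u.
Let ofUr (u : Ur) : U := u.
Let toUrK : cancel toUr ofUr. Proof. by []. Qed.
Let ofUrK : cancel ofUr toUr. Proof. by []. Qed.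
Let toUrD x y : toUr (x + y) = toUr x + toUr y. Proof. by []. Qed.
Let toUrC (s : S) (r : R^c) (u : U) : ofUr (r *: toUr (s *: u)) = s *: ofUr (r *: toUr u).
Proof.
by apply: h_ext => v; rewrite h2lZ; change (h2l (s *: u) v * r = h2l u (act s v) * r).
Qed.
Definition vdual : bimod S R^c := Bimod toUrK ofUrK toUrD toUrC.
Lemma vdualE r u : ract vdual r u = umul r u. Proof. by []. Qed.
End Coinduction.

Local Notation U := (Phi (R^o : lmodType R)).
(** Hom_S(U, N) with U = Hom_R(V, R). For V finitely generated projective, Hom_R(V, -) is tensoring
    with U over R, so [coind] is its right adjoint. *)
Definition coind N : lmodType R := hsrc vdual N.

Hypotheses (gV : fin_gen V) (pV : projective V).
Hypotheses (full : bfull B) (faith : bfaith B).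
Hypotheses (gU : fin_gen U) (pU : projective U).
Hypothesis kact : forall c v, act (kS c) v = kR c *: v.
Variable d : nat.
Hypothesis hker : forall M, fin_gen M -> (forall (f : {linear V -> M}) v, f v = 0) -> pdle d M.

Let hR : noeth R. Proof. exact: noeth_kstr kR. Qed.
Let hS : noeth S. Proof. exact: noeth_kstr kS. Qed.

Lemma dual_basis : exists n (w : 'I_n -> V) (e : 'I_n -> U),
  forall v, v = \sum_i (h2l (e i) v : R) *: w i.
Proof.
have [n [i [p ip]]] := fin_gen_proj gV pV.
exists n, (fun j => p (lin_inj_at (R^o : lmodType R) j 1)),
  (fun j => l2h (linc (lin_proj (R^o : lmodType R) j) i)) => v.
by rewrite -[LHS]ip lin_free.
Qed.

Lemma vdual_kact c (u : bl vdual) : ract vdual (kR c) u = kS c *: u.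
Proof.
apply: h_ext => v; rewrite vdualE umulE h2lZ kact linearZ /=.
exact: (esym (kioC kR c _)).
Qed.

Lemma phi_fg M : fin_gen M -> fin_gen (Phi M).
Proof. exact: hsrc_fg kact gV. Qed.

Lemma coind_fg N : fin_gen N -> fin_gen (coind N).
Proof. exact: (hsrc_fg vdual_kact gU). Qed.

Lemma phi_proj P : fin_gen P -> projective P -> projective (Phi P).
Proof.
move=> gP pP; have [n rP] := fin_gen_proj gP pP.
apply: retract_proj (hmap_retract B rP) _.
by apply: retract_proj (hsrc_ffun B _ n) _; exact: proj_ffun.
Qed.

Lemma phi_fgpd n M : fgpd n M -> fgpd n (Phi M).
Proof.
elim: n M => [|n IH] M hM.
  by case: hM => gM pM; split; [exact: phi_fg|exact: phi_proj].
have [k [Z [i [p [Si hZ]]]]] := fpd_cover hR hM.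
split; first by apply: phi_fg; case: hM.
exists (Phi Z), (Phi (free R k)), (hmap B i), (hmap B p); split.
- by case: (fgpd_free R k) => gF pF; exact: phi_proj.
- exact: hmap_ses.
- by case: (IH _ hZ).
Qed.

Section Adjunction.
Lemma rmul_linP X (x : X) : linear (fun u : U => l2h (linc (lin_scalel x) (h2l u)) : Phi X).
Proof.
by move=> s u u'; apply: h_ext => v; rewrite h2lP /= scalerDl.
Qed.
Definition rmul X x : {linear U -> Phi X} := mklin (@rmul_linP X x).
Lemma rmulE X (x : X) u v : h2l (rmul x u) v = (h2l u v : R) *: x. Proof. by []. Qed.

Lemma rmulD X (x y : X) u : rmul (x + y) u = rmul x u + rmul y u.
Proof. by apply: h_ext => v; rewrite h2lD !rmulE scalerDr. Qed.
Lemma rmulZ X r (x : X) u : rmul (r *: x) u = rmul x (umul r u).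
Proof. by apply: h_ext => v; rewrite !rmulE scalerA. Qed.

Lemma adj_linP X N (g : {linear Phi X -> N}) :
  linear (fun x : X => @l2h _ _ vdual N (linc g (rmul x)) : coind N).
Proof.
move=> r x y; apply: h_ext => u; rewrite h2lP vdualE.
change (g (rmul (r *: x + y) u) = g (rmul x (umul r u)) + g (rmul y u)).
by rewrite rmulD rmulZ linearD.
Qed.
Definition adj X N g : {linear X -> coind N} := mklin (@adj_linP X N g).
Lemma adjE X N (g : {linear Phi X -> N}) x u : h2l (adj g x) u = g (rmul x u).
Proof. by []. Qed.

Lemma coindZ N (h : coind N) r (u : U) : h2l (r *: h) u = h2l h (umul r u).
Proof. by []. Qed.

(** The preimage of h under [adj] sends f to the sum of h(f(w_i))(e_i) over a dual basis of V. *)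
Lemma unadj_ex X N (h : {linear X -> coind N}) :
  exists g : {linear Phi X -> N}, forall x, adj g x = h x.
Proof.
have [n [w [e wE]]] := dual_basis.
have eE (u : U) : u = \sum_i umul (h2l u (w i) : R) (e i).
  apply: h_ext => v; rewrite h2l_sum {1}(wE v) raddf_sum.
  by apply: eq_bigr => i _ /=; rewrite linearZ.
have gL : linear (fun f : Phi X => \sum_i h2l (h (h2l f (w i))) (e i) : N).
  move=> s f f'; transitivity (\sum_i h2l (h (h2l f (act s (w i)))) (e i)
      + \sum_i h2l (h (h2l f' (w i))) (e i)).
    by rewrite -big_split; apply: eq_bigr => i _; rewrite h2lP linearD h2lD.
  congr (_ + _); rewrite scaler_sumr.
  transitivity (\sum_i \sum_j h2l (h (h2l f (w j))) (umul (h2l (e j) (act s (w i)) : R) (e i))).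
    apply: eq_bigr => i _; rewrite {1}(wE (act s (w i))) !raddf_sum h2l_sum.
    by apply: eq_bigr => j _ /=; rewrite !linearZ.
  rewrite exchange_big; apply: eq_bigr => j _ /=.
  rewrite -linearZ (eE (s *: e j)) raddf_sum; apply: eq_bigr => i _.
  by rewrite h2lZ.
exists (mklin gL) => x; apply: h_ext => u.
rewrite adjE (_ : mklin gL _ = \sum_i h2l (h (h2l (rmul x u) (w i))) (e i)) //.
transitivity (\sum_i h2l (h x) (umul (h2l u (w i) : R) (e i))).
  by apply: eq_bigr => i _; rewrite rmulE linearZ.
by rewrite [in RHS](eE u) raddf_sum.
Qed.

Lemma unadj_eq X N (g g' : {linear Phi X -> N}) :
  (forall x, adj g x = adj g' x) -> g =1 g'.
Proof.
have [n [w [e wE]]] := dual_basis.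
move=> h f; have -> : f = \sum_i rmul (h2l f (w i)) (e i).
  apply: h_ext => v; rewrite h2l_sum {1}(wE v) raddf_sum.
  by apply: eq_bigr => i _; rewrite rmulE; exact: linearZ.
rewrite !raddf_sum; apply: eq_bigr => i _ /=.
by rewrite -!adjE h.
Qed.

Lemma ractW (u : U) (v : V) : exists s, forall w, act s w = (h2l u w : R) *: v.
Proof.
by have [s sE] := full (h2l (rmul v u)); exists s => w; rewrite /= -sE rmulE.
Qed.

Lemma ract_inj s t : (forall w, act s w = act t w) -> s = t.
Proof.
move=> e; apply/eqP; rewrite -subr_eq0; apply/eqP; apply: (faith (b := (s - t : S^c))) => w.
have /(can_inj (bsK (b := B))) e1 := e w.
by rewrite [LHS](scalerBl (s : S^c)) e1 subrr.
Qed.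

(** Phi (coind N) is N because S = End(V)^op: the endomorphisms w |-> u(w) v of V come from S, and
    over a dual basis they sum to 1. The first fact gives injectivity, both give surjectivity. *)
Lemma counit N : exists c : {linear Phi (coind N) -> N},
  [/\ forall x, adj c x = x, injective c & surjective_map c].
Proof.
have [c cE] := unadj_ex (lin1 (coind N)); exists c; split=> //.
  apply: lin_inj => f cf; apply: h_ext => v; apply: h_ext => u.
  have [s sE] := ractW u v.
  transitivity (c (rmul (h2l f v) u)); first by rewrite -adjE cE.
  have -> : rmul (h2l f v) u = s *: f.
    by apply: h_ext => w; rewrite rmulE h2lZ sE linearZ.
  by rewrite linearZ /= cf scaler0.
move=> q.
have [sg sgE] : exists sg : V -> U -> S, forall v u w, act (sg v u) w = (h2l u w : R) *: v.
  have /choice[sg sgE] : forall v, exists sg : U -> S, forall u w, act (sg u) w = (h2l u w : R) *: v.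
    by move=> v; have /choice[sg sgE] := fun u => ractW u v; exists sg.
  by exists sg.
have fvL v : linear (fun u : U => sg v u *: q).
  move=> t u u'; rewrite scalerA -scalerDl; congr (_ *: _); apply: ract_inj => w.
  by rewrite ractD ractM !sgE h2lP scalerDl.
have fL : linear (fun v : V => @l2h _ _ vdual N (mklin (fvL v)) : coind N).
  move=> r v v'; apply: h_ext => u; rewrite h2lP vdualE.
  change (sg (r *: v + v') u *: q = sg v (umul r u) *: q + sg v' u *: q).
  rewrite -scalerDl; congr (_ *: _); apply: ract_inj => w.
  by rewrite ractD !sgE scalerDr umulE scalerA.
exists (l2h (mklin fL)).
have [n [w [e wE]]] := dual_basis.
have -> : l2h (mklin fL) = \sum_i rmul (mklin fL (w i)) (e i).
  apply: h_ext => v; rewrite h2l_sum {1}(wE v) raddf_sum.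
  by apply: eq_bigr => i _; rewrite rmulE; exact: linearZ.
rewrite raddf_sum.
transitivity (\sum_i (sg (w i) (e i) *: q)).
  by apply: eq_bigr => i _ /=; rewrite -adjE cE.
rewrite -scaler_suml -[RHS]scale1r; congr (_ *: _); apply: ract_inj => v.
have aD : {morph (fun s => act s v) : s t / s + t} by move=> s t; exact: ractD.
have a0 : act 0 v = 0 by apply: (addIr (act 0 v)); rewrite -aD !add0r.
rewrite (big_morph (fun s => act s v) aD a0) ract1 [RHS](wE v).
by apply: eq_bigr => i _; rewrite sgE.
Qed.

(** By adjunction, as V is projective and Phi is therefore exact. *)
Lemma ext1_coind M N : ext1 (Phi M) N -> ext1 M (coind N).
Proof.
move=> eM X Y f g Sf h; have [u uE] := unadj_ex h.
have [k kE] := eM _ _ _ _ (hmap_ses pV Sf) u.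
exists (adj k) => x; apply: h_ext => w; rewrite -uE !adjE -kE.
by congr (k _); apply: h_ext => v; rewrite hmapE !rmulE linearZ.
Qed.

End Adjunction.

Lemma phi_cover M : fin_gen M ->
  exists r (t : {linear {ffun 'I_r -> V} -> M}), surjective_map (hmap B t).
Proof.
move=> gM; have [r [th thP]] := phi_fg gM.
exists r, (lin_cotuple (fun i => h2l (th i))) => f; have [c ->] := thP f.
exists (l2h (lin_tuple (fun i => act (c i)))); apply: h_ext => v.
rewrite hmapE h2l_sum; apply: eq_bigr => i _; by rewrite !ffunE.
Qed.

Lemma phi_coker_zero X M C (t : {linear X -> M}) (c : {linear M -> C}) :
  surjective_map (hmap B t) -> (forall x, c (t x) = 0) -> surjective_map c ->
  forall (f : {linear V -> C}) v, f v = 0.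
Proof.
move=> ts ct cs f v; have [f' f'E] := pV f cs; have [g gE] := ts (l2h f').
by rewrite -f'E -[f']l2hK -gE hmapE ct.
Qed.

(** Let I be the image in M of a power of V that is onto after Phi. Phi kills M/I, which has
    projective dimension at most d. If Phi M is projective, a summand of the power of V covers I
    with a kernel killed by Phi, so I has projective dimension at most d + 1; each further unit of n
    is a passage to the kernel of the power of V over I. *)
Lemma transfer_fgpd n M : fin_gen M -> fgpd n (Phi M) -> fgpd (n + d.+1) M.
Proof.
elim: n M => [|n IH] M gM hM.
  have [r [t ts]] := phi_cover gM.
  have [I [j [t' [ji t's jt]]]] := im_ex t.
  have [Z [i Si]] := ses_ker t's; have [ii ie _] := Si.
  have SPhi := hmap_ses pV Si.
  have js : surjective_map (hmap B j).
    move=> f; have [g <-] := ts f; exists (hmap B t' g); apply: h_ext => v.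
    by rewrite !hmapE jt.
  have jI : injective (hmap B j).
    by move=> a b e; apply: h_ext => v; apply: ji; rewrite -!hmapE e.
  have pI : projective (Phi I).
    have [rI _] := retract_bij jI js; apply: retract_proj rI _; by case: hM.
  have [s hs] := ses_proj_section SPhi pI.
  have [rho [rhoK rhoE]] := ses_section_retraction SPhi hs.
  pose io k : Phi {ffun 'I_r -> V} := l2h (lin_inj_at V k).
  (* Maps from Phi of a power of V to Phi Z come from R-linear maps, so the splitting rho is induced
     by R1. The composite i R1 is idempotent, and its kernel P still maps onto I. *)
  pose R1 := lin_cotuple (fun k => h2l (rho (io k))) : {linear {ffun 'I_r -> V} -> Z}.
  have R1E (f : Phi {ffun 'I_r -> V}) v : R1 (h2l f v) = h2l (rho f) v.
    have /choice[c cE] : forall k : 'I_r, exists c, forall v, act c v = h2l f v k.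
      move=> k; have [c cE] := full (linc (lin_proj V k) (h2l f)).
      by exists c => w; rewrite /= -cE.
    have fE : f = \sum_k c k *: io k.
      apply: h_ext => w; rewrite h2l_sum [LHS]ffun_decomp; apply: eq_bigr => k _.
      by rewrite h2lZ cE.
    transitivity (\sum_k h2l (rho (io k)) (act (c k) v)).
      by apply: eq_bigr => k _; rewrite cE.
    rewrite fE raddf_sum h2l_sum; apply: eq_bigr => k _ /=.
    by rewrite linearZ h2lZ.
  have kap (f : Phi Z) v : R1 (i (h2l f v)) = h2l f v.
    by rewrite -hmapE R1E rhoK.
  have R1i x : R1 (i (R1 x)) = R1 x.
    rewrite (_ : R1 x = \sum_k h2l (rho (io k)) (x k)) //.
    rewrite (_ : R1 (i _) = linc R1 i (\sum_k h2l (rho (io k)) (x k))) // raddf_sum.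
    by apply: eq_bigr => k _; exact: kap.
  have [P [p0 [p0i p0e]]] := ker_ex R1.
  have t'i z : t' (i z) = 0 by exact: (ses0 _ Si).
  have [|q qE] := lift_ker (h := linD (lin1 _) (linN (linc i R1))) p0i p0e.
    by move=> x; rewrite (_ : R1 _ = R1 (x - i (R1 x))) // linearB R1i subrr.
  have rP : retract P {ffun 'I_r -> V}.
    exists p0, q => x; apply: p0i.
    by rewrite qE (_ : linD _ _ _ = p0 x - i (R1 (p0 x))) // (exact0 _ p0e) linear0 subr0.
  have pP : projective P by apply: retract_proj rP _; exact: proj_ffun.
  have tq : surjective_map (linc t' p0).
    move=> y; have [x xE] := t's y; exists (q x).
    by rewrite /= qE (_ : linD _ _ _ = x - i (R1 x)) // linearB t'i subr0.
  have [Z' [i' Si']] := ses_ker tq; have [ii' ie' _] := Si'.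
  have gP : fin_gen P by apply: fin_gen_retract rP _; exact: fin_gen_ffun.
  have hZ' : pdle d Z'.
    apply: hker => [|f v]; first exact: hR ii' gP.
    have [|k kE] := lift_ker (h := linc p0 (linc i' f)) ii ie.
      by move=> w /=; have := ses0 (f w) Si'.
    apply: (lin_inj0 ii'); apply: (lin_inj0 p0i).
    have := kE v; rewrite /= => <-; rewrite -[k]l2hK -kap l2hK kE.
    by rewrite (_ : linc p0 _ _ = p0 (i' (f v))) // (exact0 _ p0e) linear0.
  have gI : fin_gen I by exact: fin_gen_surj t's (fin_gen_ffun _ gV).
  have hI : pdle d.+1 I by exists Z', P, i', (linc t' p0).
  have [C [c Sc]] := ses_coker ji; have [_ ce cs] := Sc.
  have hC : pdle d C.
    apply: hker; first exact: fin_gen_surj cs gM.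
    apply: (phi_coker_zero ts) cs => x; rewrite -jt; exact: (ses0 _ Sc).
  by split=> //; apply: (pdle_half Sc hI); exact: pdleS.
have [r [t ts]] := phi_cover gM.
have [I [j [t' [ji t's jt]]]] := im_ex t.
have [Z [i Si]] := ses_ker t's; have [ii ie _] := Si.
have SPhi := hmap_ses pV Si.
have js : surjective_map (hmap B j).
  move=> f; have [g <-] := ts f; exists (hmap B t' g); apply: h_ext => v.
  by rewrite !hmapE jt.
have jI : injective (hmap B j).
  by move=> a b e; apply: h_ext => v; apply: ji; rewrite -!hmapE e.
have gVr : fin_gen ({ffun 'I_r -> V} : lmodType R) by exact: fin_gen_ffun.
have pVr : projective ({ffun 'I_r -> V} : lmodType R) by exact: proj_ffun.
have gZ : fin_gen Z by exact: hR ii gVr.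
have hZ : fgpd n (Phi Z).
  split; first exact: phi_fg.
  apply: (pdle_any _ SPhi); first exact: phi_proj.
  by apply/(pdle_iso _ jI js); case: hM.
have [_ hZ'] := IH _ gZ hZ.
have hI : pdle (n.+1 + d.+1) I by exists Z, ({ffun 'I_r -> V} : lmodType R), i, t'.
have [C [c Sc]] := ses_coker ji; have [_ ce cs] := Sc.
have hC : pdle d C.
  apply: hker; first exact: fin_gen_surj cs gM.
  apply: (phi_coker_zero ts) cs => x; rewrite -jt; exact: (ses0 _ Sc).
split=> //; apply: (pdle_half Sc hI); apply: pdle_mono hC.
exact: leq_trans (leqnSn d) (leq_addl _ _).
Qed.

Lemma transfer_fpd M : fin_gen M -> fpd M <-> fpd (Phi M).
Proof.
move=> gM; split=> -[n h]; first by exists n; exact: phi_fgpd.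
by exists (n + d.+1)%N; exact: transfer_fgpd.
Qed.

Theorem transfer_bdd : bdd S -> bdd R.
Proof.
move=> [n hn]; exists (n + d.+1)%N => M hM; have [m [gM _]] := hM.
have hP : fpd (Phi M) by apply/transfer_fpd.
have [k [gP _]] := hP.
by have [] := transfer_fgpd gM (conj gP (hn _ hP)).
Qed.

(** An approximation Q of Phi X is coinduced and pulled back along the unit X -> coind (Phi X). Phi
    inverts the unit, so Phi of the pullback W is Q and W has finite projective dimension; Ext^1
    into coind L vanishes by adjunction. *)
Theorem transfer_app : app S -> app R.
Proof.
move=> hS' X gX; have [L [Q [i [p [Si gL dQ eL]]]]] := hS' _ (phi_fg gX).
have SC := hmap_ses (B := vdual) pU Si.
pose un := adj (lin1 (Phi X)).
have [W [u [v [w [Su vw wu _]]]]] := pullback_ses un SC.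
have [ui ue vs] := Su; have [Ci Ce Cs] := SC.
have gL' := coind_fg gL.
have gW : fin_gen W by exact: fin_gen_ext ue vs gL' gX.
exists (coind L), W, u, v; split=> //; last first.
  by move=> M hM; apply/ext1_coind/eL/transfer_fpd => //; case: hM => n [].
apply/transfer_fpd => //.
have [c [cE ci cs]] := counit Q.
have [cX [cXE cXi cXs]] := counit (Phi X).
(* Triangle identity of the adjunction. *)
have cXun (f : Phi X) : cX (hmap B un f) = f.
  have e1 := unadj_eq (g := linc cX (hmap B un)) (g' := lin1 _).
  apply: e1 => x; apply: h_ext => y; rewrite !adjE.
  have -> : linc cX (hmap B un) (rmul x y) = cX (rmul (un x) y).
    rewrite (_ : linc cX _ _ = cX (hmap B un (rmul x y))) //; congr (cX _).
    by apply: h_ext => z; rewrite hmapE !rmulE linearZ.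
  by rewrite -adjE cXE.
(* Naturality of the counit at p. *)
have cXp (g : Phi (coind Q)) : cX (hmap B (hmap vdual p) g) = p (c g).
  have e1 := unadj_eq (g := linc cX (hmap B (hmap vdual p))) (g' := linc p c).
  apply: e1 => x; apply: h_ext => y; rewrite !adjE.
  have -> : linc cX (hmap B (hmap vdual p)) (rmul x y) = cX (rmul (hmap vdual p x) y).
    rewrite (_ : linc cX _ _ = cX (hmap B (hmap vdual p) (rmul x y))) //.
    by congr (cX _); apply: h_ext => z; rewrite hmapE !rmulE linearZ.
  rewrite -[LHS]adjE cXE hmapE (_ : linc p c _ = p (c (rmul x y))) // -[in RHS]adjE cE.
  by [].
pose th := linc c (hmap B w).
have thi : injective th.
  apply: lin_inj => f /(lin_inj0 ci) wf.
  have vf : hmap B v f = 0.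
    rewrite -[LHS]cXun (_ : hmap B un _ = hmap B (hmap vdual p) (hmap B w f)).
      by rewrite wf !linear0.
    by apply: h_ext => z; rewrite !hmapE vw.
  apply: h_ext => z.
  have /ue[l lE] : v (h2l f z) = 0 by rewrite -hmapE vf h2l0.
  rewrite -lE (_ : l = 0) ?linear0 //; apply: (lin_inj0 Ci).
  by rewrite -wu lE -hmapE wf h2l0.
have ths : surjective_map th.
  move=> q; have [g gE] := cs q.
  have [f0 f0E] := pV (h2l (p q)) vs.
  have e1 : hmap B un (p q) = hmap B (hmap vdual p) g.
    by apply: cXi; rewrite cXun cXp gE.
  have [|k kE] := lift_ker (h := linD (linc w f0) (linN (h2l g))) Ci Ce.
    move=> z; rewrite (_ : linD _ _ _ = w (f0 z) - h2l g z) // linearB.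
    have := congr1 (fun f => h2l f z) e1.
    by rewrite !hmapE => <-; rewrite -vw f0E subrr.
  exists (l2h (linD f0 (linN (linc u k)))); rewrite -gE; congr (c _).
  apply: h_ext => z; rewrite hmapE (_ : h2l _ z = f0 z - u (k z)) // linearB wu kE.
  by rewrite (_ : linD _ _ _ = w (f0 z) - h2l g z) // opprB addrC subrK.
have [n [gQ hQ]] := dQ; exists n; have [r1 r2] := retract_bij thi ths.
exact: fgpd_retract hS r1 (conj gQ hQ).
Qed.

End Transfer.

(** * Existence of strong tilting modules *)

Section StrongExistence.
Variable R : pzRingType.
Implicit Types M X Y Z T C L Q W : lmodType R.

Lemma ext1_lift L Q X W (i : {linear L -> Q}) (p : {linear Q -> X}) (h : {linear W -> X}) :
  ses i p -> ext1 W L -> exists k : {linear W -> Q}, forall w, p (k w) = h w.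
Proof.
move=> Si eW; have [B [u [v [w [Su vw wu _]]]]] := pullback_ses h Si.
have [r ur] := ext1_splits Su eW.
have [s sE] := ses_retraction_section Su ur.
by exists (linc w s) => x /=; rewrite -vw sE.
Qed.

Lemma ext1_ffun2 M T n : ext1 M T -> ext1 M ({ffun 'I_n -> T} : lmodType R).
Proof.
move=> eM X Y f g Sf h.
have /choice[k kE] : forall i : 'I_n, exists k : {linear Y -> T}, forall x, k (f x) = h x i.
  by move=> i; exact: eM _ _ _ _ Sf (linc (lin_proj T i) h).
by exists (lin_tuple k) => x; apply/ffunP => i; rewrite ffunE kE.
Qed.

Lemma ext1_injective M I : injective_module I -> ext1 M I.
Proof.
move=> iI X Y f g [fi _ _] h; have [k kE] := iI _ _ f h fi; by exists k.
Qed.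

Lemma in_add_trans T T' X : in_add T' T -> in_add T X -> in_add T' X.
Proof.
move=> /in_addP[n [i [p ip]]] /in_addP[m rX]; apply/in_addP.
exists #|{: 'I_m * 'I_n}|; apply: retract_trans rX _.
exists (lin_tuple (fun j => linc (lin_proj T' (enum_val j).2)
    (linc i (lin_proj T (enum_val j).1)))).
pose q (k : 'I_m) := linc p (lin_tuple (fun l : 'I_n => lin_proj T' (enum_rank (k, l)))).
exists (lin_tuple q) => u; apply/ffunP => k; rewrite ffunE.
rewrite -[RHS]ip (_ : q k _ = p [ffun l => (lin_tuple (fun j => linc (lin_proj T' (enum_val j).2)
    (linc i (lin_proj T (enum_val j).1))) u) (enum_rank (k, l))]) //.
by congr (p _); apply/ffunP => l; rewrite !ffunE /= enum_rankK.
Qed.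

Lemma coresk_trans T T' s X : in_add T' T -> coresk T s X -> coresk T' s X.
Proof.
move=> hT; elim: s X => [|s IH] X; first exact: in_add_trans.
move=> [C [X' [f [g [Sf aC cX]]]]]; exists C, X', f, g; split=> //.
  exact: in_add_trans aC.
exact: IH.
Qed.

Section CoresFromBound.
Variables (T : lmodType R) (D : nat).
Hypothesis hR : noeth R.
Hypothesis dT : fpd T.
Hypothesis eT : forall M, fpd M -> ext1 M T.
Hypothesis cogen : forall X, fpd X ->
  exists n (f : {linear X -> {ffun 'I_n -> T}}), injective f.
Hypothesis hD : forall M, fpd M -> pdle D M.

(** The index i measures how injective X is: Ext^1(M, X) = 0 when M has projective dimension at most
    i. Each cokernel of an embedding into a power of T gains one level, and at level D, which bounds
    all finite projective dimensions, the embedding splits. *)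
Lemma coresk_bound j i X : (i + j = D)%N -> fpd X ->
  (forall M, fgpd i M -> ext1 M X) -> exists s, coresk T s X.
Proof.
elim: j i X => [|j IH] i X ij dX eX; have [n [f fi]] := cogen dX.
all: have [X' [g Sf]] := ses_coker fi; have [m hT] := dT.
all: have dTn : fpd ({ffun 'I_n -> T} : lmodType R) by exists m; exact: fgpd_ffun.
all: have dX' : fpd X' by exact: fpd_coker Sf dX dTn.
  have [r fr] : exists r : {linear {ffun 'I_n -> T} -> X}, cancel f r.
    apply: (ext1_splits Sf); apply: eX; have [k [gX' _]] := dX'; split=> //.
    by rewrite -[i]addn0 ij; exact: hD.
  by exists 0%N; apply/in_addP; exists n, f, r.
have [|M hM|s cs] := IH i.+1 X' _ dX'; first by rewrite addSnnS.
  have [k [Z [a [b [Sa hZ]]]]] := fpd_cover hR hM.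
  apply: (ext1_pres (@proj_free R k) Sa) => h.
  have [l lE] := ext1_lift h Sf (eX _ hZ).
  have [l' l'E] := @ext1_ffun2 M T n (eT (ex_intro (fun n => fgpd n M) _ hM)) _ _ a b Sa l.
  by exists (linc g l') => z /=; rewrite l'E lE.
exists s.+1, ({ffun 'I_n -> T} : lmodType R), X', f, g; split=> //.
by apply/in_addP; exists n; exact: retract_refl.
Qed.
End CoresFromBound.

Variables (K : fieldType) (kR : kstr K R).
Let hR : noeth R. Proof. exact: noeth_kstr kR. Qed.

(** T is an extension of the injective module [dual1] by L, so Ext^1(M, T) vanishes with Ext^1(M,
    L). It cogenerates the modules of finite projective dimension because their maps to [dual1] lift
    to T. *)
Theorem app_fstrong : app R -> bdd R -> exists T, fstrong T.
Proof.
move=> aR [D hD]; have [L [T [i [p [Si gL dT eL]]]]] := aR _ (dual1_fg kR).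
have eT M : fpd M -> ext1 M T.
  move=> [m hM]; have [k [Z [a [b [Sa hZ]]]]] := fpd_cover hR (fgpdS hM).
  apply: (ext1_half2 (@proj_free R k) Sa Si); first by apply: eL; exists m.
  exact/ext1_injective/dual1_injective.
have cogen X : fpd X -> exists n (f : {linear X -> {ffun 'I_n -> T}}), injective f.
  move=> dX; have [m [gX _]] := dX; have [n [f fi]] := embed_dual kR gX.
  have /choice[h hE] : forall j : 'I_n, exists h : {linear X -> T}, forall x, p (h x) = f x j.
    by move=> j; exact: ext1_lift (linc (lin_proj _ j) f) Si (eL _ dX).
  exists n, (lin_tuple h); apply: lin_inj => x hx; apply: (lin_inj0 fi).
  apply/ffunP => j; rewrite -hE [RHS]ffunE.
  have := congr1 (fun u : {ffun 'I_n -> T} => u j) hx; rewrite !ffunE => ->.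
  exact: linear0.
exists T; split=> //.
apply: (@coresk_bound T D hR dT eT cogen hD D 0%N) => //.
  by exists 0%N; split; [exact: fin_gen_R | exact: proj_R].
by move=> M [_ pM]; exact: ext1_proj.
Qed.

(** X is arbitrary rather than indecomposable, so that minimality of dimension applies to it
    directly. *)
Definition strongly_basic T : Prop := forall X, summand (X * X)%type T -> is_zero X.

(* For T of minimal dimension, a summand X x X of T would leave a smaller
   strong tilting module after removing one copy of X. *)
Theorem fstrong_basic : (exists T, fstrong T) -> exists T, fstrong T /\ strongly_basic T.
Proof.
move=> [T0 s0].
have fgk T : fstrong T -> exists n, kdim (kmod kR T) n.
  by case=> -[m [gT _]] _ _; apply: kdim_ex; apply: (fin_gen_kmod kR T).1 gT.
have h : exists n, `[< exists T, fstrong T /\ kdim (kmod kR T) n >].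
  by have [n hn] := fgk _ s0; exists n; apply/asboolP; exists T0.
case: (ex_minnP h) => n /asboolP[T [sT kT]] hmin.
exists T; split=> // X hX; have /summandP[i [p ip]] := hX.
have [Y [f [g [fg gf]]]] := hX.
pose T' : lmodType R := (X * Y)%type.
have q1 : linear (fun t : T => ((f t).1.2, (f t).2) : T').
  by move=> a x y; rewrite linearP.
have rT' : retract T' T.
  have j1 : linear (fun u : T' => g ((0, u.1), u.2)).
    move=> a [x y] [x' y'] /=; rewrite -linearP; congr (g _).
    by congr pair; congr pair; rewrite /= scaler0 addr0.
  by exists (mklin j1), (mklin q1) => -[x y] /=; rewrite gf.
(* T is the sum of X, X and Y, hence a summand of two copies of X x Y. *)
have aT : in_add T' T.
  apply/in_addP; exists 2%N.
  pose e0 := @ord0 1; pose e1 := @ord_max 1.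
  have a1 : linear (fun t : T => ((f t).1.1, (f t).2) : T') by move=> a x y; rewrite linearP.
  have b1 : linear (fun u : {ffun 'I_2 -> T'} => g (((u e0).1, (u e1).1), (u e0).2)).
    by move=> a u v; rewrite -linearP !ffunE.
  exists (lin_tuple (fun k : 'I_2 => if k == e0 then mklin a1 else mklin q1)), (mklin b1).
  move=> t /=; rewrite !ffunE /= -[RHS]fg; congr (g _).
  by case: (f t) => -[].
have sT' : fstrong T'.
  have [[m dT] [s cs] eT] := sT; split.
  - by exists m; exact: fgpd_retract dT.
  - by exists s; exact: coresk_trans cs.
  - by move=> M hM; exact: ext1_retract2 rT' (eT _ hM).
have q1s : surjective_map (kmodf kR (mklin q1)).
  by move=> [x y]; exists (g ((0, x), y)); rewrite /= gf.
have kT' : kdim (kmod kR T') n.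
  have [[a aS] _] := kT; split.
    by exists (linc (kmodf kR (mklin q1)) a); exact: ses_comp_surj.
  move=> m hm; have [m' km'] := fgk _ sT'.
  apply: leq_trans (km'.2 _ hm); apply: hmin; apply/asboolP; by exists T'.
(* By minimality the projection from T to T' is between spaces of equal dimension, so its kernel,
   the first copy of X, is zero. *)
have q1i := kdim_bij kT kT' q1s.
move=> x; have := q1i (g ((x, 0), 0)) 0; rewrite /= gf linear0 => /(_ erefl).
by move/(congr1 f); rewrite gf linear0 => -[].
Qed.

End StrongExistence.

(** * Absence of repeated summands *)

Section NoDuplicates.

(** u and v are off-diagonal matrix units: u v and v u are orthogonal idempotents that generate
    isomorphic projectives. In this form basicness is visibly left-right symmetric and passes
    between T and End(T). *)
Definition nodup (R : pzRingType) : Prop := forall u v : R,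
  u * u = 0 -> v * v = 0 -> u * v * u = u -> v * u * v = v -> u = 0.

Lemma nodup_op (R : pzRingType) : nodup R -> nodup R^c.
Proof.
move=> h u v uu vv uvu vuv; apply: (h u v uu vv).
  by rewrite -mulrA; exact: uvu.
by rewrite -mulrA; exact: vuv.
Qed.

Lemma dup_maps (R : pzRingType) (X M : lmodType R) : summand (X * X)%type M ->
  exists u v : {linear M -> M}, [/\ forall m, u (u m) = 0, forall m, v (v m) = 0,
    forall m, u (v (u m)) = u m, forall m, v (u (v m)) = v m
    & (forall m, u m = 0) -> is_zero X].
Proof.
move=> /summandP[i [p ip]].
have s1 : linear (fun w : X * X => (w.2, 0) : X * X).
  by move=> a x y; congr pair; rewrite /= scaler0 addr0.
have s2 : linear (fun w : X * X => (0, w.1) : X * X).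
  by move=> a x y; congr pair; rewrite /= scaler0 addr0.
exists (linc i (linc (mklin s1) p)), (linc i (linc (mklin s2) p)); split=> [m|m|m|m|h x] /=.
- by rewrite ip /= (_ : (0, 0) = 0) ?linear0.
- by rewrite ip /= (_ : (0, 0) = 0) ?linear0.
- by rewrite !ip.
- by rewrite !ip.
have := h (i (0, x)); rewrite /= ip => /(congr1 p).
by rewrite ip linear0 => -[].
Qed.

Lemma nodup_basic (R : pzRingType) : nodup R -> basic_module (R^o : lmodType R).
Proof.
move=> h X [nX _] /dup_maps[u [v [uu vv uvu vuv zX]]]; apply/nX/zX => m.
have fE (f : {linear R^o -> R^o}) (r : R) : f r = r * (f 1 : R).
  by rewrite -[in LHS](mulr1 r); exact: linearZ.
rewrite fE; suff -> : (u 1 : R) = 0 by rewrite mulr0.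
apply: (h (u 1) (v 1)); by rewrite -!fE ?uu ?vv ?uvu ?vuv.
Qed.

Lemma nodup_bimod (R E : pzRingType) (B : bimod R E) : bfull B -> bfaith B ->
  nodup E -> basic_module (bl B).
Proof.
move=> full faith h X [nX _] /dup_maps[u [v [uu vv uvu vuv zX]]]; apply/nX/zX => m.
have [a aE] := full u; have [b bE] := full v.
have eqE c c' : (forall t : bl B, bs (c *: bt t) = bs (c' *: bt t)) -> c = c'.
  move=> e; apply/eqP; rewrite -subr_eq0; apply/eqP/faith => t.
  have /(can_inj (bsK (b := B))) e1 := e t.
  by rewrite scalerBl e1 subrr.
have mE c c' t : bs ((c * c') *: bt t) = bs (c *: bt (bs (c' *: bt t))) :> bl B.
  by rewrite bsK scalerA.
have zE t : bs ((0 : E) *: bt t) = 0 :> bl B by rewrite scale0r bs0.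
rewrite aE (h a b) ?zE //; apply: eqE => t.
- by rewrite mE -!aE uu zE.
- by rewrite mE -!bE vv zE.
- by rewrite !mE -!aE -bE uvu.
- by rewrite !mE -!bE -aE vuv.
Qed.

(** The idempotents u v and v u cut out isomorphic independent summands of T, so the image X of u v
    occurs twice. *)
Lemma strongly_basic_nodup (R E : pzRingType) (B : bimod R E) :
  bfaith B -> strongly_basic (bl B) -> nodup E.
Proof.
move=> faith hB u v uu vv uvu vuv.
pose f c := bact B c.
have fM c c' t : f c (f c' t) = f (c * c') t by rewrite /= bsK scalerA.
have f0 t : f 0 t = 0 by rewrite /= scale0r bs0.
pose P t := f (u * v) t = t.
have hP : submodule P.
  split; rewrite /P; first exact: linear0.
    by move=> x y px py; rewrite linearD px py.
  by move=> a x px; rewrite linearZ px.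
have [X [j [ji jE]]] := sub_ex hP.
have jP x : f (u * v) (j x) = j x by apply/jE; exists x.
have L c : u * v * c = c -> exists q : {linear bl B -> X}, forall t, j (q t) = f c t.
  move=> e; have [|||q qE] := @ex_lin_rel _ _ X (fun t x => j x = f c t).
  - by move=> t; apply/jE; rewrite /P fM e.
  - by move=> t x x' <- /ji.
  - by move=> a t t' x x' e1 e2; rewrite !linearP e1 e2.
  by exists q.
have [q1 q1E] := L (u * v) ltac:(by rewrite mulrA uvu).
have [q2 q2E] := L u ltac:(by []).
have zX : is_zero X.
  apply: hB; apply/summandP.
  exists (lin_copair j (linc (f v) j)), (lin_pair q1 q2) => -[x y].
  congr pair; apply: ji.
    rewrite q1E (_ : lin_copair _ _ _ = j x + f v (j y)) // linearD jP fM.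
    by rewrite -mulrA vv mulr0 f0 addr0.
  rewrite q2E (_ : lin_copair _ _ _ = j x + f v (j y)) // linearD fM jP.
  by rewrite -[in f u _](jP x) fM mulrA uu mul0r f0 add0r.
have uv0 : u * v = 0.
  apply: faith => t; apply: (can_inj (bsK (b := B))); rewrite bs0.
  by rewrite -[LHS](q1E t) (zX (q1 t)) linear0.
by rewrite -uvu uv0 mul0r.
Qed.

End NoDuplicates.

(** * Corners of algebras *)

Section BimodOf.
Variables (R E : pzRingType) (T : lmodType R) (phi : E -> {linear T -> T}).
Hypothesis phiM : forall a b t, phi a (phi b t) = phi (a * b) t.
Hypothesis phi1 : forall t, phi 1 t = t.
Hypothesis phiD : forall t a b, phi (a + b) t = phi a t + phi b t.
Let phiDr a (x y : T) : phi a (x + y) = phi a x + phi a y.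
Proof. exact: linearD. Qed.
Let U : lmodType E :=
  mk_lmod (@addrA T) (@addrC T) (@add0r T) (@addNr T) phiM phi1 phiDr phiD.
Let tU (t : T) : U := t.
Let fU (u : U) : T := u.
Let tUK : cancel tU fU. Proof. by []. Qed.
Let fUK : cancel fU tU. Proof. by []. Qed.
Let tUD x y : tU (x + y) = tU x + tU y. Proof. by []. Qed.
Let tUC (r : R) (b : E) (t : T) : fU (b *: tU (r *: t)) = r *: fU (b *: tU t).
Proof. by have := linearP (phi b) r t 0; rewrite linear0 !addr0. Qed.
Definition bimod_of : bimod R E := Bimod tUK fUK tUD tUC.
End BimodOf.

Section Corners.
Variables (K : fieldType) (R S : pzRingType) (kR : kstr K R) (kS : kstr K S).
Variables (e : R) (sg : S -> R).
Hypotheses (ee : e * e = e) (eR : forall r, e * r = e * r * e).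
Hypotheses (sgD : forall a b, sg (a + b) = sg a + sg b).
Hypotheses (sgM : forall a b, sg (a * b) = sg a * sg b) (sg1 : sg 1 = e).
Hypotheses (sgI : injective sg) (sgS : forall r, exists s, sg s = e * r * e).
Hypothesis sgk : forall c, sg (kS c) = kR c * e.

(** The assumptions on V under which approximations pass from S to R, apart from the bound on the
    modules killed by Phi. *)
Definition transfer_datum (B : bimod R S^c) : Prop :=
  let U := hsrc B (R^o : lmodType R) in
  [/\ fin_gen (bl B) /\ projective (bl B), bfull B /\ bfaith B,
      fin_gen U /\ projective U & forall c v, ract B (kS c) v = kR c *: v].

(** V is Re and Phi M is eM. Since eR = eRe, the module Hom_R(Re, R) = eR is free of rank one over
    S. *)
Lemma corner_datum : exists B : bimod R S^c, transfer_datum B /\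
  forall M : lmodType R, (forall (f : {linear bl B -> M}) v, f v = 0) ->
    forall m : M, e *: m = 0.
Proof.
have [V [j [p [ji jE jp pE]]]] := left_ideal_ex ee.
have je v : (j v : R) * e = j v by apply/jE; exists v.
have [e0 e0E] : exists v, j v = e by apply/jE.
have sg_l s : e * sg s = sg s by rewrite -sg1 -sgM mul1r.
have sg_r s : sg s * e = sg s by rewrite -sg1 -sgM mulr1.
have sg0 : sg 0 = 0 by apply: (addIr (sg 0)); rewrite -sgD !add0r.
have /choice[rho rhoE] : forall s : S, exists f : {linear V -> V},
    forall v, j (f v) = (j v : R) * sg s.
  move=> s; have [|||f fE] := @ex_lin_rel _ V V (fun v w => j w = (j v : R) * sg s).
  - by move=> v; apply/jE; rewrite -mulrA sg_r.
  - by move=> v w w' <- /ji.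
  - move=> a v v' w w' h h'; rewrite !linearP h h'.
    by rewrite /= mulrDl -mulrA.
  by exists f.
have rM (a b : S^c) v : rho a (rho b v) = rho (a * b) v.
  by apply: ji; rewrite !rhoE sgM mulrA.
have r1 v : rho (1 : S^c) v = v by apply: ji; rewrite rhoE sg1 je.
have rD v (a b : S^c) : rho (a + b) v = rho a v + rho b v.
  by apply: ji; rewrite linearD !rhoE sgD mulrDr.
pose B : bimod R S^c := bimod_of rM r1 rD.
have actE (s : S) (v : V) : j (ract B s v) = (j v : R) * sg s by exact: rhoE.
have vE (M : lmodType R) (f : {linear V -> M}) v : f v = (j v : R) *: f e0.
  rewrite -linearZ; congr (f _); apply: ji; rewrite linearZ e0E.
  exact/esym/je.
have fe0 (M : lmodType R) (f : {linear V -> M}) : e *: f e0 = f e0.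
  by rewrite [RHS]vE e0E.
have full : bfull B.
  move=> f; have [s sE] := sgS (j (f e0)); exists s => v; apply: ji.
  transitivity ((j v : R) * sg s); last exact/esym/rhoE.
  have h : e * j (f e0) = j (f e0) by rewrite -[in RHS]fe0 linearZ.
  by rewrite (vE _ f) linearZ sE h je.
have faith : bfaith B.
  move=> s h; apply: sgI; rewrite sg0 -sg_l -e0E.
  have := h e0; rewrite -(linear0 j) => h0.
  by rewrite -[LHS](rhoE s e0); congr (j _); exact: h0.
have hU : linear (fun s : S^o => @l2h _ _ B _ (linc (lin_scalel (sg s : R^o)) j) : hsrc B (R^o : lmodType R)).
  move=> t s s'; apply: h_ext => v; rewrite h2lP.
  change ((j v : R) * sg (t * s + s') = (j (ract B t v) : R) * sg s + (j v : R) * sg s').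
  by rewrite actE sgD mulrDr sgM mulrA.
have Ui : injective (mklin hU).
  apply: lin_inj => s h; apply: sgI; rewrite sg0 -sg_l -e0E.
  exact: (congr1 (fun f : hsrc B (R^o : lmodType R) => h2l f e0) h).
have Us : surjective_map (mklin hU).
  move=> f; have [s sE] := sgS (h2l f e0); exists s; apply: h_ext => v.
  change ((j v : R) * sg s = h2l f v).
  by rewrite [RHS](vE _ (h2l f)) sE -eR (_ : e * _ = h2l f e0) //; exact: (fe0 _ (h2l f)).
have [rU1 rU2] := retract_bij Ui Us.
exists B; split.
  split=> //.
  - have rV : retract V (R^o : lmodType R) by exists j, p.
    by split; [exact: fin_gen_retract rV (fin_gen_R R) | exact: retract_proj rV (@proj_R R)].
  - by split; [exact: fin_gen_retract rU2 (fin_gen_R S) | exact: retract_proj rU2 (@proj_R S)].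
  - by move=> c v; apply: ji; rewrite actE sgk linearZ mulrA -kioC -mulrA je.
move=> M h m; have := h (linc (lin_scalel m) j) e0.
by rewrite /= e0E.
Qed.

End Corners.

(** * Modules supported off the oriented cycles *)

Section Acyclic.
Variables (K : fieldType) (R : pzRingType) (k : kstr K R).
Variables (N : finType) (ep : N -> R) (e : R) (r : N -> nat).
Hypothesis sum1 : e + \sum_i ep i = 1.
Hypothesis epp : forall i, ep i * ep i = ep i.
Hypothesis e_ep : forall a i, e * a * ep i = 0.
Hypothesis rI : injective r.
Hypothesis ep_rank : forall a i j, ep i * a * ep j <> 0 -> i = j \/ (r j < r i)%N.
Hypothesis ep_loc : forall a i, exists c, ep i * a * ep i = k c * ep i.

Let hR : noeth R. Proof. exact: noeth_kstr k. Qed.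

(** M lives on the ranks from t to D - 1. Its part at the index j of rank t is covered by copies of
    R ep_j, one for each vector of a K-basis. R ep_j lives on ranks at least t, and its part at j is
    spanned by ep_j, so kernel and cokernel of the map to M live on ranks above t. *)
Lemma acyclic_pd D n t (M : lmodType R) : (forall i, (r i < D)%N) -> (t + n = D)%N ->
  fin_gen M -> (forall m : M, e *: m = 0) ->
  (forall i, (r i < t)%N -> forall m : M, ep i *: m = 0) -> pdle n M.
Proof.
move=> rD; elim: n t M => [|n IH] t M tn gM eM zM.
  have zz (m : M) : m = 0.
    rewrite -[m]scale1r -sum1 scalerDl eM add0r scaler_suml big1 // => i _.
    by apply: zM; rewrite -[t]addn0 tn.
  by apply: proj_zero => x y; rewrite (zz x) (zz y).
have tn' : (t.+1 + n = D)%N by rewrite addSnnS.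
case: (pselect (exists j, r j = t)) => [[j jt]|nj]; last first.
  apply: pdleS; apply: (IH t.+1) => // i; rewrite ltnS leq_eqVlt => /orP[/eqP it|].
    by case: nj; exists i.
  exact: zM.
have hW : submodule (fun m : kmod k M => ep j *: (m : M) = m).
  split=> [|x y xe ye|c x xe]; first exact: scaler0.
    by rewrite scalerDr xe ye.
  by rewrite kmodZ scalerA -kioC -scalerA xe.
have [W [w [wi wE]]] := sub_ex hW.
have wj x : ep j *: (w x : M) = w x by apply/wE; exists x.
have wZ c x : (w (c *: x) : M) = k c *: (w x : M).
  by have := linearP w c x 0; rewrite linear0 !addr0.
have gW : fin_gen W by apply: (noeth_field wi); exact: (fin_gen_kmod k M).1 gM.
have [b kb] := kdim_ex gW; have [[p ps] _] := kb; have pi := kdim_inj kb ps.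
have [V [q [q' [qi qE qq' q'E]]]] := left_ideal_ex (epp j).
have qj x : (q x : R) * ep j = q x by apply/qE; exists x.
have rV : retract V (R^o : lmodType R) by exists q, q'.
have gV : fin_gen V by exact: fin_gen_retract rV (fin_gen_R R).
have pV : projective V by exact: retract_proj rV (@proj_R R).
pose mm i : M := w (p (lin_inj_at (K^o : lmodType K) (i : 'I_b) 1)).
pose f := lin_cotuple (fun i => linc (lin_scalel (mm i)) q) : {linear {ffun 'I_b -> V} -> M}.
have fE u : f u = \sum_i (q (u i) : R) *: mm i by [].
have gP : fin_gen ({ffun 'I_b -> V} : lmodType R) by exact: fin_gen_ffun.
have pP : projective ({ffun 'I_b -> V} : lmodType R) by exact: proj_ffun.
have [I [g [f' [gi f's gf]]]] := im_ex f.
have [Z [i Si]] := ses_ker f's; have [ii ie _] := Si.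
have [C [c Sc]] := ses_coker gi; have [_ ce cs] := Sc.
have mmE (x : W) : exists d : 'I_b -> K, (w x : M) = \sum_l k (d l) *: mm l.
  have [d <-] := ps x; exists (fun l => d l); rewrite lin_free raddf_sum.
  by apply: eq_bigr => l _; exact: wZ.
have [o oE] : exists v, q v = ep j by apply/qE.
have hC : pdle n C.
  apply: (IH t.+1) => //.
  - exact: fin_gen_surj cs gM.
  - by move=> x; have [m <-] := cs x; rewrite -linearZ eM linear0.
  - move=> l; rewrite ltnS leq_eqVlt => /orP[/eqP lt|lt] x; have [m <-] := cs x; last first.
      by rewrite -linearZ zM ?linear0.
    have -> : l = j by apply: rI; rewrite lt.
    rewrite -linearZ; apply/ce.
    have /wE[y yE] : ep j *: (ep j *: m) = ep j *: m by rewrite scalerA epp.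
    have [d dE] := mmE y.
    have h l' : exists v, q v = k (d l') * ep j by apply/qE; rewrite -mulrA epp.
    have [v vE] := choice h.
    exists (f' (finfun v)); rewrite gf fE -yE dE; apply: eq_bigr => l' _.
    by rewrite ffunE vE -scalerA wj.
have hZ : pdle n Z.
  apply: (IH t.+1) => //.
  - exact: hR ii gP.
  - move=> z; apply: ii; rewrite linearZ linear0; apply/ffunP => l; rewrite !ffunE.
    by apply: qi; rewrite linearZ linear0; have := e_ep (q (i z l)) j; rewrite -mulrA qj.
  - move=> l lt z; apply: ii; rewrite linearZ linear0; apply/ffunP => l'; rewrite !ffunE.
    apply: qi; rewrite linearZ linear0.
    transitivity (ep l * (q (i z l') : R) * ep j); first by rewrite -mulrA qj.
    case: (pselect (l = j)) => [->|lj]; last first.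
      apply: contrapT => /ep_rank[//|]; rewrite jt => h.
      by rewrite ltnS leqNgt h in lt.
    have /choice[d dE] := fun l' => ep_loc (q (i z l')) j.
    have e1 : \sum_l k (d l) *: mm l = 0.
      transitivity (ep j *: f (i z)); last by rewrite -gf (ses0 _ Si) linear0 scaler0.
      rewrite fE scaler_sumr; apply: eq_bigr => l1 _.
      by rewrite scalerA -qj mulrA dE -scalerA wj.
    have e2 : p [ffun l => d l] = 0.
      apply: (lin_inj0 wi); rewrite lin_free raddf_sum -[RHS]e1.
      by apply: eq_bigr => l1 _; rewrite ffunE; exact: wZ.
    have := congr1 (fun u : free K b => u l') (lin_inj0 pi e2); rewrite !ffunE => d0.
    by rewrite dE d0 -[k 0]mulr1 -(kio1 k) -(kioM k) mul0r (_ : k 0 = 0) ?mul0r //;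
      apply: (addIr (k 0)); rewrite -kioD !add0r.
apply: (pdle_half Sc); last exact: pdleS.
by exists Z, ({ffun 'I_b -> V} : lmodType R), i, f'.
Qed.

End Acyclic.

(** * Split basic algebras and Loewy lengths *)

Lemma kio0 (K : fieldType) (S : pzRingType) (k : kstr K S) : k 0 = 0.
Proof. by apply: (addIr (k 0)); rewrite -kioD !add0r. Qed.

Definition kstr_op (K : fieldType) (S : pzRingType) (k : kstr K S) : kstr K S^c.
Proof.
refine (@KStr K S^c (fun c => (k c : S^c)) (kio1 k) (kioD k) _ _ _).
- by move=> a b; rewrite [a * b]mulrC; exact: kioM k b a.
- by move=> a r; exact: esym (kioC k a r).
- have [n [g gP]] := kiofg k; exists n, (fun i => (g i : S^c)) => r.
  have [c cE] := gP r; exists c; rewrite {1}cE.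
  by apply: eq_bigr => i _; exact: (kioC k (c i) (g i)).
Defined.

Section Products.
Variables (S : pzRingType) (J : S -> Prop).

(** Single products of n elements of J, without sums: enough to test annihilation by J^n. *)
Fixpoint jprod n (a : S) : Prop :=
  if n is m.+1 then exists b c, [/\ J b, jprod m c & a = b * c] else a = 1.

Lemma jprodSr n a b : jprod n a -> J b -> jprod n.+1 (a * b).
Proof.
elim: n a => [|n IH] a.
  by move=> -> Jb; exists b, 1; rewrite mul1r mulr1.
move=> [c [d [Jc pd ->]]] Jb; exists c, (d * b); split=> //; last by rewrite mulrA.
exact: IH.
Qed.

Lemma jprod_lastP n a :
  jprod n.+1 a -> exists b c, [/\ jprod n b, J c & a = b * c].
Proof.
elim: n a => [|n IH] a [b [c [Jb pc ->]]].
  by exists 1, b; rewrite mul1r; split=> //; rewrite (pc : c = 1) mulr1.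
have [d [f [pd Jf ->]]] := IH _ pc.
by exists (b * d), f; split; [exists b, d | | rewrite mulrA].
Qed.

End Products.

Lemma jprod_op (S : pzRingType) (J : S -> Prop) n a :
  @jprod S^c J n a <-> jprod J n a.
Proof.
split; elim: n a => [|n IH] a //=.
  by move=> [b [c [Jb pc ->]]]; exact: jprodSr (IH _ pc) Jb.
move=> /jprod_lastP[b [c [pb Jc ->]]].
by exists c, b; split=> //; exact: IH.
Qed.

(* S/J is a product of copies of K indexed by I and J is nilpotent; I is empty
   exactly when S = 0. *)
Record split_basic (K : fieldType) (S : pzRingType) (k : kstr K S) (I : finType)
    (eps : I -> S) (J : S -> Prop) : Prop := SplitBasic {
  sb_sum : \sum_i eps i = 1;
  sb_idem : forall i, eps i * eps i = eps i;
  sb_orth : forall i j, i != j -> eps i * eps j = 0;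
  sb_0 : J 0;
  sb_D : forall a b, J a -> J b -> J (a + b);
  sb_ml : forall a b, J b -> J (a * b);
  sb_mr : forall a b, J a -> J (a * b);
  sb_dec : forall a, exists c : I -> K, exists2 b, J b & a = \sum_i k (c i) * eps i + b;
  sb_nil : exists m, forall a, jprod J m a -> a = 0;
  sb_eps : forall i, ~ J (eps i) }.

Lemma split_basic_op (K : fieldType) (S : pzRingType) (k : kstr K S) (I : finType)
    (eps : I -> S) (J : S -> Prop) :
  split_basic k eps J -> @split_basic K S^c (kstr_op k) I eps J.
Proof.
case=> s1 s2 s3 s4 s5 s6 s7 s8 s9 s10; split=> //.
- by move=> i j nij; apply: s3; rewrite eq_sym.
- by move=> a b; exact: s7.
- by move=> a b; exact: s6.
- move=> a; have [c [b Jb E]] := s8 a; exists c, b => //; rewrite {1}E.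
  by congr (_ + _); apply: eq_bigr => i _; exact: (kioC k (c i) (eps i)).
- by have [m mE] := s9; exists m => a /jprod_op; exact: mE.
Qed.

Section SplitBasicModules.
Variables (K : fieldType) (S : pzRingType) (k : kstr K S) (I : finType).
Variables (eps : I -> S) (J : S -> Prop).
Hypothesis sb : split_basic k eps J.
Implicit Types M N P X Y Z : lmodType S.

Let JN a : J a -> J (- a).
Proof. by move=> Ja; rewrite -mulN1r; exact: sb_ml sb _ _ Ja. Qed.
Let JB a b : J a -> J b -> J (a - b).
Proof. by move=> Ja Jb; apply: sb_D sb _ _ Ja _; exact: JN. Qed.

Lemma sb_decl i a : exists c b, J b /\ eps i * a = k c * eps i + b.
Proof.
have [c [b Jb ->]] := sb_dec sb a; exists (c i), (eps i * b).
split; first exact: sb_ml sb _ _ Jb.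
rewrite mulrDr mulr_sumr (bigD1 i) //= mulrA -kioC -mulrA (sb_idem sb) big1 ?addr0 //.
by move=> j ji; rewrite mulrA -kioC -mulrA (sb_orth sb) ?mulr0 // eq_sym.
Qed.

Lemma sb_decr i a : exists c b, J b /\ a * eps i = k c * eps i + b.
Proof.
have [c [b Jb ->]] := sb_dec sb a; exists (c i), (b * eps i).
split; first exact: sb_mr sb _ _ Jb.
rewrite mulrDl mulr_suml (bigD1 i) //= -mulrA (sb_idem sb) big1 ?addr0 //.
by move=> j ji; rewrite -mulrA (sb_orth sb) ?mulr0.
Qed.

Lemma sb_sumZ M (x : M) : x = \sum_i eps i *: x.
Proof. by rewrite -scaler_suml (sb_sum sb) scale1r. Qed.

Inductive jspan M (N : M -> Prop) : M -> Prop :=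
| JSpan0 : jspan N 0
| JSpanC a x y : J a -> N x -> jspan N y -> jspan N (a *: x + y).

Lemma jspanZ M (N : M -> Prop) a x : J a -> N x -> jspan N (a *: x).
Proof. by move=> Ja Nx; rewrite -[_ *: _]addr0; apply: JSpanC => //; exact: JSpan0. Qed.

Lemma jspan_submodule M (N : M -> Prop) : submodule (jspan N).
Proof.
split; first exact: JSpan0.
- by move=> x y; elim=> [|a z w Ja Nz _ IH] hy; rewrite ?add0r -?addrA //; apply: JSpanC => //; exact: IH.
- move=> a x; elim=> [|b z w Jb Nz _ IH]; first by rewrite scaler0; exact: JSpan0.
  by rewrite scalerDr scalerA; apply: JSpanC => //; exact: sb_ml sb _ _ Jb.
Qed.

Lemma jspan_sub M (N N' : M -> Prop) : submodule N' ->
  (forall a x, J a -> N x -> N' (a *: x)) -> forall x, jspan N x -> N' x.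
Proof. by move=> [h0 hD _] hJ x; elim=> // a y z Ja Ny _; apply: hD; exact: hJ. Qed.

(** Nakayama's lemma for N inside L + JN: each substitution of the inclusion into itself multiplies
    the error term by one more element of J, until nilpotence removes it. *)
Lemma jspan_nilpotent M (L N : M -> Prop) : submodule L ->
  (forall x, N x -> exists l y, [/\ L l, jspan N y & x = l + y]) ->
  forall x, N x -> L x.
Proof.
move=> sL hN; have [m mE] := sb_nil sb; have [L0 LD LZ] := sL.
have aux n : forall x a, (n <= m)%N -> jprod J (m - n) a -> N x -> L (a *: x).
  elim: n => [|n IH] x a nm pa Nx.
    by rewrite subn0 in pa; rewrite (mE _ pa) scale0r.
  have [l [y [Ll Ny ->]]] := hN _ Nx; rewrite scalerDr; apply: (LD); first exact: LZ.
  elim: Ny => [|b z w Jb Nz _ IH']; first by rewrite scaler0.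
  rewrite scalerDr scalerA; apply: (LD) => //; apply: (IH) => //; first exact: ltnW.
  by rewrite -(subnSK nm); exact: jprodSr.
by move=> x Nx; rewrite -[x]scale1r; apply: (aux m) => //; rewrite subnn.
Qed.

Lemma jspan_zero M : (forall x : M, jspan (fun=> True) x) -> is_zero M.
Proof.
move=> h x; have sL : submodule (fun x : M => x = 0).
  by split=> // [y z -> ->|a y ->]; rewrite ?addr0 ?scaler0.
apply: (jspan_nilpotent (N := fun=> True) sL) => // y _.
by exists 0, y; split=> //; rewrite add0r.
Qed.

(** JN lies in every maximal submodule by Nakayama. Conversely, if eps_i x is not in JN, take a
    K-linear form on M/JN that is nonzero there; composed with eps_i, it has a maximal submodule of
    N as kernel, because eps_i a is a multiple of eps_i modulo J. *)
Lemma radicalE M (N : M -> Prop) : submodule N -> forall x, radical N x <-> jspan N x.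
Proof.
move=> sN; have [N0 ND NZ] := sN; have NB u v : N u -> N v -> N (u - v).
  by move=> Nu Nv; apply: (ND) => //; rewrite -scaleN1r; exact: NZ.
have sJ := jspan_submodule N; have [J0 JD JZ] := sJ.
have JN' x : jspan N x -> N x by apply: jspan_sub => // a y _; exact: NZ.
move=> x; split=> [[Nx hx]|jx]; last first.
  split; first exact: JN'.
  move=> L [sL LN [y Ny nLy] maxL]; have [L0 LD LZ] := sL.
  have sLJ : submodule (fun x => exists l y, [/\ L l, jspan N y & x = l + y]).
    split; first by exists 0, 0; split=> //; rewrite addr0.
    - move=> _ _ [l [u [Ll ju ->]]] [l' [u' [Ll' ju' ->]]].
      by exists (l + l'), (u + u'); split; [exact: LD|exact: JD|rewrite addrACA].
    - move=> a _ [l [u [Ll ju ->]]].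
      by exists (a *: l), (a *: u); split; [exact: LZ|exact: JZ|rewrite scalerDr].
  case: (maxL _ sLJ).
  - by move=> z Lz; exists z, 0; split=> //; rewrite addr0.
  - by move=> _ [l [u [Ll ju ->]]]; apply: (ND); [exact: LN|exact: JN'].
  - by apply; exists 0, x; split=> //; rewrite add0r.
  - by move=> h; case: nLy; exact: jspan_nilpotent sL h _ Ny.
apply: contrapT => njx.
have [i nji] : exists i, ~ jspan N (eps i *: x).
  apply: contrapT => h; apply: njx; rewrite (sb_sumZ x).
  by apply: big_ind => // i _; apply: contrapT => hi; apply: h; exists i.
have [C [g [gs gE]]] := quot_ex sJ.
pose y := g (eps i *: x); have ny : y <> 0 by move=> /gE.
pose f := @lin_scalel K (kmod k C) (y : kmod k C).
have fi : injective f.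
  apply: lin_inj => c; rewrite /f /= => cy; apply: contrapT => /eqP nc; apply: ny.
  by rewrite -[y]scale1r -(kio1 k) -(mulVf nc) kioM -scalerA (_ : k c *: y = 0) ?scaler0 // -[RHS]cy kmodZ.
have [m [mL mE]] := @functional_ext K (K^o : lmodType K) (kmod k C) f (fun c => c) fi (fun _ _ _ => erefl).
have mD (u v : C) : m (u + v) = m u + m v.
  by have := mL 1 u v; rewrite mul1r scale1r.
have m0 : m (0 : C) = 0 by apply: (addIr (m 0)); rewrite -mD !add0r.
have mZ c (u : C) : m (k c *: u) = c * m u.
  by have := mL c u 0; rewrite m0 !addr0 kmodZ.
have m1 : m y = 1 by have := mE 1; rewrite /f /= scale1r.
pose phi u := m (g (eps i *: u)).
have phiD u v : phi (u + v) = phi u + phi v by rewrite /phi scalerDr linearD mD.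
have phiK c u : phi (k c *: u) = c * phi u.
  by rewrite /phi scalerA -kioC -scalerA linearZ /= mZ.
have phiJ u : jspan N u -> phi u = 0.
  by move=> ju; rewrite /phi (_ : g (eps i *: u) = 0) ?m0 //; apply/gE; exact: (JZ).
have phiZ a u : N u -> exists c, phi (a *: u) = c * phi u.
  move=> Nu; have [c [b [Jb E]]] := sb_decl i a; exists c.
  rewrite {1}/phi scalerA E scalerDl linearD mD -scalerA linearZ /= mZ.
  by rewrite (_ : g (b *: u) = 0) ?m0 ?addr0 //; apply/gE; exact: jspanZ.
pose L u := N u /\ phi u = 0.
suff: L x by case=> _; rewrite /phi -/y m1 => /eqP; rewrite oner_eq0.
apply: hx; split.
- split=> [|u v [Nu u0] [Nv v0]|a u [Nu u0]].
  + by split=> //; rewrite /phi scaler0 linear0.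
  + by split; [exact: ND|rewrite phiD u0 v0 addr0].
  + by split; [exact: NZ|have [c ->] := phiZ a u Nu; rewrite u0 mulr0].
- by move=> u [].
- by exists x => // -[_]; rewrite /phi -/y m1 => /eqP; rewrite oner_eq0.
move=> L' [L'0 L'D L'Z] LL' L'N.
case: (pselect (forall u, L' u -> L u)) => [|h]; [by left|right].
have [u [L'u nu]] : exists u, L' u /\ phi u <> 0.
  apply: contrapT => h'; apply: h => u L'u; split; first exact: L'N.
  by apply: contrapT => nu; apply: h'; exists u.
move=> v Nv; pose c := phi v / phi u.
have -> : v = (v + k (- c) *: u) + k c *: u.
  by rewrite -addrA -scalerDl -kioD addNr kio0 scale0r addr0.
apply: (L'D); last exact: L'Z.
apply: (LL'); split; first by apply: (ND) => //; apply: (NZ); exact: L'N.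
by rewrite phiD phiK mulNr divfK ?subrr //; exact/eqP.
Qed.

End SplitBasicModules.

Section SplitBasicLoewy.
Variables (K : fieldType) (S : pzRingType) (k : kstr K S) (I : finType).
Variables (eps : I -> S) (J : S -> Prop).
Hypothesis sb : split_basic k eps J.
Implicit Types M N P X Y Z : lmodType S.

Definition jser M n : M -> Prop := iter n (@jspan S J M) (fun=> True).

Lemma jser_submodule M n : submodule (@jser M n).
Proof. by case: n => [|n] //; exact: (jspan_submodule sb). Qed.

Lemma rad_seriesE M n : rad_series n = @jser M n.
Proof.
elim: n => // n IH; apply/funext => x; apply/propext.
rewrite /rad_series iterS -/(rad_series n) IH.
by apply: (radicalE sb); exact: jser_submodule.
Qed.

Lemma jser_jprod M n a (x : M) : jprod J n a -> jser n (a *: x).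
Proof.
elim: n a => // n IH a [b [c [Jb pc ->]]]; rewrite -scalerA.
by apply: jspanZ => //; exact: IH.
Qed.

Lemma jser_ind M n (P : M -> Prop) : P 0 -> (forall x y, P x -> P y -> P (x + y)) ->
  (forall a x, jprod J n a -> P (a *: x)) -> forall x, jser n x -> P x.
Proof.
elim: n P => [|n IH] P P0 PD Pa x; first by rewrite -[x]scale1r => _; exact: (Pa).
elim=> // a y z Ja jy _ Pz; apply: (PD) => //.
apply: (IH (fun y => P (a *: y))) jy => [|u v Pu Pv|b u pb].
- by rewrite scaler0.
- by rewrite scalerDr; exact: PD.
- by rewrite scalerA; apply: (Pa); exists a, b.
Qed.

(* All modules S eps_i have Loewy length l. *)
Definition equiloewy (l : nat) : Prop :=
  (forall a, jprod J l a -> a = 0) /\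
  forall i, exists2 a, jprod J l.-1 a & a * eps i <> 0.

Lemma sb_eps0 i : eps i <> 0.
Proof. by move=> e0; apply: (sb_eps sb (i := i)); rewrite e0; exact: sb_0 sb. Qed.

Lemma equiloewy_gt0 l : equiloewy l -> I -> (0 < l)%N.
Proof.
case: l => // -[h _] i; case: (sb_eps0 (i := i)).
by rewrite -[eps i]mul1r [1]h // mul0r.
Qed.

Lemma sb_inv_scale c (x : S) : c != 0 -> k c * x = 0 -> x = 0.
Proof. by move=> nc kx; rewrite -[x]mul1r -(kio1 k) -(mulVf nc) kioM -mulrA kx mulr0. Qed.

(* Since all S eps_i have Loewy length l, membership in JP can be tested by
   multiplication with J^(l-1). *)
Lemma homog_jspan l P i (x : P) : equiloewy l -> fin_gen P -> projective P ->
  eps i *: x = x -> (forall a, jprod J l.-1 a -> a *: x = 0) ->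
  jspan J (fun=> True) x.
Proof.
move=> el fP pP ex ax; have l0 := equiloewy_gt0 el i; have [lz ln] := el.
have [n [u [p up]]] := fin_gen_proj fP pP.
have [J0 JD JZ] := jspan_submodule sb (fun _ : P => True).
suff hJ j : J (u x j).
  rewrite -[x]up lin_free; apply: big_ind => // j _; exact: jspanZ.
have uj a : u (a *: x) j = a * u x j :> S by rewrite linearZ /= ffunE.
have [c [b [Jb E]]] := sb_decl sb i (u x j).
rewrite -uj ex in E; rewrite E; case: (eqVneq c 0) E => [->|nc] E.
  by rewrite kio0 mul0r add0r.
have [a pa []] := ln i; apply: (sb_inv_scale nc).
have ab : a * b = 0 by apply: lz; rewrite -(prednK l0); exact: jprodSr.
have := uj a; rewrite (ax _ pa) linear0 ffunE E mulrDr ab addr0 mulrA -kioC -mulrA.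
by move=> <-.
Qed.

(** Each generator is fixed by one eps_i, so that it is the image of the generator of S eps_i. *)
Definition homog_gen M n : Prop := exists (ix : 'I_n -> I) (m : 'I_n -> M),
  (forall j, eps (ix j) *: m j = m j) /\
  forall x, exists c : 'I_n -> S, x = \sum_j c j *: m j.

Lemma homog_gen_ex M : fin_gen M -> exists n, homog_gen M n.
Proof.
move=> [n [g gP]]; exists #|{: 'I_n * I}|, (fun j => (enum_val j).2),
  (fun j => eps (enum_val j).2 *: g (enum_val j).1).
split=> [j|x]; first by rewrite scalerA (sb_idem sb).
have [c ->] := gP x; exists (fun j => c (enum_val j).1).
transitivity (\sum_(j : 'I_n * I) c j.1 *: (eps j.2 *: g j.1)); last first.
  by rewrite (reindex _ (onW_bij _ (enum_val_bij _))).
rewrite -(pair_bigA _ (fun i j => c i *: (eps j *: g i))) /=.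
by apply: eq_bigr => i _; rewrite -scaler_sumr -(sb_sumZ sb).
Qed.

(** The cover comes from the least number of homogeneous generators. A relation with a coefficient
    outside J would express one generator by the others modulo J, and by Nakayama that generator
    could be dropped. *)
Lemma minimal_cover M : fin_gen M -> exists (Z Q : lmodType S)
    (i : {linear Z -> Q}) (p : {linear Q -> M}),
  [/\ ses i p, fin_gen Q, projective Q & forall z, jspan J (fun=> True) (i z)].
Proof.
move=> fM; have [n [[ix [m [mE mS]]] nmin]] :
    exists n, homog_gen M n /\ forall n', homog_gen M n' -> (n <= n')%N.
  have h : exists n, `[< homog_gen M n >].
    by have [n hn] := homog_gen_ex fM; exists n; apply/asboolP.
  exists (ex_minn h); case: ex_minnP => n /asboolP hn hm.
  by split=> // n' hn'; apply: hm; apply/asboolP.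
(* The idempotent of the free module whose fixed part Q is the sum of the S eps_(ix j). *)
pose r0 : {linear free S n -> free S n} :=
  lin_tuple (fun j => linc (lin_scalel (eps (ix j) : S^o)) (lin_proj (S^o : lmodType S) j)).
have r0E u j : r0 u j = (u j : S) * eps (ix j) by rewrite ffunE.
have [Q [i0 [i0i i0e]]] := ker_ex (lin1 (free S n) - r0 : {linear free S n -> free S n}).
have r0r u : r0 (r0 u) = r0 u.
  by apply/ffunP => j; rewrite !r0E -mulrA (sb_idem sb).
have kE u : (lin1 (free S n) - r0 : {linear _ -> _}) u = u - r0 u by [].
have [r rE] : exists r : {linear free S n -> Q}, forall u, i0 (r u) = r0 u.
  by apply: (lift_ker i0i i0e) => u; rewrite kE r0r subrr.
have i0r q : r0 (i0 q) = i0 q.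
  have /(i0e _) : exists q', i0 q' = i0 q by exists q.
  by rewrite kE => /eqP; rewrite subr_eq0 => /eqP.
have i0K : cancel i0 r by move=> q; apply: i0i; rewrite rE i0r.
have Qr : retract Q (free S n) by exists i0, r.
pose q0 : {linear free S n -> M} := lin_cotuple (fun j => lin_scalel (m j)).
have q0E u : q0 u = \sum_j (u j : S) *: m j by [].
have ps : surjective_map (linc q0 i0).
  move=> x; have [c ->] := mS x; exists (r [ffun j => c j]).
  rewrite [LHS](_ : _ = q0 (i0 (r [ffun j => c j]))) // rE q0E; apply: eq_bigr => j _.
  by rewrite r0E ffunE -scalerA mE.
have [Z [i Si]] := ses_ker ps; exists Z, Q, i, (linc q0 i0); split=> //.
- exact: fin_gen_retract Qr (fin_gen_free _ _).
- exact: retract_proj Qr (@proj_free _ _).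
move=> z; rewrite -[i z]i0K lin_free; set u := i0 (i z).
have u0 : \sum_j (u j : S) *: m j = 0.
  by rewrite -q0E; case: Si => _ /(_ (i z))[_ h] _; apply: h; exists z.
have [J0 JD JZ] := jspan_submodule sb (fun _ : Q => True).
apply: big_ind => // j _; apply: jspanZ => //.
have uE : u = r0 u by rewrite i0r.
have {uE} : (u j : S) = u j * eps (ix j) by rewrite -r0E -uE.
have [c [b [Jb ->]]] := sb_decr sb (ix j) (u j).
case: (eqVneq c 0) => [->|nc] E; first by rewrite E kio0 mul0r add0r.
suff /nmin : homog_gen M n.-1.
  by rewrite leqNgt prednK ?leqnn //; exact: leq_ltn_trans (ltn_ord j).
pose L (x : M) := exists d : 'I_n.-1 -> S, x = \sum_h d h *: m (lift j h).
have LD x y : L x -> L y -> L (x + y).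
  move=> [d ->] [d' ->]; exists (fun h => d h + d' h).
  by rewrite -big_split; apply: eq_bigr => h _; rewrite scalerDl.
have LZ a x : L x -> L (a *: x).
  move=> [d ->]; exists (fun h => a * d h).
  by rewrite scaler_sumr; apply: eq_bigr => h _; rewrite scalerA.
have sL : submodule L.
  by split=> //; exists (fun=> 0); rewrite big1 // => h _; rewrite scale0r.
exists (ix \o lift j), (m \o lift j); split=> [h|x]; first exact: mE.
apply: (jspan_nilpotent sb (L := L) (N := fun=> True) sL) => // {}x _.
have mj : L (m j + k c^-1 *: (b *: m j)).
  move: u0; rewrite (@bigD1_ord _ _ _ _ j) //= E scalerDl -scalerA mE => /eqP.
  rewrite addr_eq0 => /eqP u0.
  rewrite (_ : _ + _ = k c^-1 *: (k c *: m j + b *: m j)); last first.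
    by rewrite scalerDr [k c^-1 *: (k c *: _)]scalerA -kioM mulVf // kio1 scale1r.
  apply: (LZ); rewrite u0 -scaleN1r.
  apply: (LZ); by exists (fun h => u (lift j h)).
have [d ->] := mS x; rewrite (@bigD1_ord _ _ _ _ j) //=.
exists (d j *: (m j + k c^-1 *: (b *: m j)) + \sum_h d (lift j h) *: m (lift j h)),
  ((- d j * k c^-1 * b) *: m j); split.
- by apply: (LD); [exact: LZ | exists (d \o lift j)].
- by apply: jspanZ => //; exact: sb_ml sb _ _ Jb.
- by rewrite scalerDr !mulNr scaleNr -!mulrA -!scalerA addrAC addrK.
Qed.

(** The syzygy Z is projective by induction and lies in JQ, so J^(l-1) kills it. Then every eps_j z
    is in JZ by [homog_jspan], and Z = JZ is zero. *)
Lemma fgpd_projective l n M : equiloewy l -> fgpd n M -> projective M.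
Proof.
move=> el; elim: n M => [|n IH] M; first by case.
move=> [fM dM]; have [Z [Q [i [p [Si fQ pQ iJ]]]]] := minimal_cover fM.
have [ii ie ps] := Si.
have fZ : fin_gen Z := noeth_kstr k ii fQ.
have pZ : projective Z by apply: IH; split=> //; exact: pdle_any pQ Si dM.
have [J0 JD JZ] := jspan_submodule sb (fun _ : Z => True).
have Z0 : is_zero Z.
  apply: (jspan_zero sb) => z; rewrite (sb_sumZ sb z); apply: big_ind => // j _.
  apply: (homog_jspan (i := j) el fZ pZ); first by rewrite scalerA (sb_idem sb).
  move=> a pa; apply: ii; rewrite linear0 linearZ /=; have l0 := equiloewy_gt0 el j.
  elim: (iJ (eps j *: z)) => [|b x y Jb _ _ IHy]; first by rewrite scaler0.
  rewrite scalerDr IHy addr0 scalerA (proj1 el (a * b)) ?scale0r //.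
  by rewrite -(prednK l0); exact: jprodSr.
have pi : injective p.
  by apply: lin_inj => q /ie[z <-]; rewrite (Z0 z) linear0.
by have := (pdle_iso 0 pi ps).1 pQ.
Qed.

End SplitBasicLoewy.

Definition fpd_proj (S : pzRingType) : Prop :=
  forall M : lmodType S, fpd M -> projective M.

Lemma equiloewy_fpd_proj (K : fieldType) (S : pzRingType) (k : kstr K S)
    (I : finType) (eps : I -> S) (J : S -> Prop) l :
  split_basic k eps J -> equiloewy eps J l -> fpd_proj S.
Proof. by move=> sb el M [n]; exact: (fgpd_projective sb el). Qed.

Lemma fpd_proj_bdd (S : pzRingType) : fpd_proj S -> bdd S.
Proof. by move=> h; exists 0%N. Qed.

Lemma fpd_proj_app (S : pzRingType) : noeth S -> fpd_proj S -> app S.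
Proof.
move=> hS h X /fin_genP[n [f fs]]; have [L [i Si]] := ses_ker fs.
exists L, (free S n), i, f; split=> //.
- by case: Si => ii _ _; exact: hS _ _ i ii (fin_gen_free _ _).
- by exists 0%N; split; [exact: fin_gen_free | exact: proj_free].
- by move=> M /h; exact: ext1_proj.
Qed.

Section LoewyLengths.
Variables (K : fieldType) (S : pzRingType) (k : kstr K S) (I : finType).
Variables (eps : I -> S) (J : S -> Prop).
Hypothesis sb : split_basic k eps J.
Implicit Types M N P X Y Z : lmodType S.

Lemma jrad_fix X b (x : X) : J b -> b *: x = x -> x = 0.
Proof.
move=> Jb bx; have sL : submodule (fun x : X => x = 0).
  by split=> // [y z -> ->|a y ->]; rewrite ?addr0 ?scaler0.
apply: (jspan_nilpotent sb (N := fun z => z = x) sL) => // _ ->.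
by exists 0, x; split=> //; rewrite ?add0r // -{2}bx; exact: jspanZ.
Qed.

(** An s with s g = (x, 0) acts on g as a scalar c plus a radical element b. If c = 0, then x = b x;
    otherwise y is fixed by a radical element. The component concerned is zero by Nakayama. *)
Lemma cyclic_indecomposable M i (g : M) : ~ is_zero M -> eps i *: g = g ->
  (forall x, exists a, x = a *: g) -> indecomposable M.
Proof.
move=> nM eg gen; split=> // X Y [f [f' [fK f'K]]].
have fX u : f u = ((f u).1, (f u).2) by case: (f u).
pose x := (f g).1; pose y := (f g).2.
have fa a : f (a *: g) = (a *: x, a *: y) by rewrite linearZ.
have [s sE] := gen (f' (x, 0)).
have [c [b [Jb E]]] := sb_decr sb i s.
have sg : s *: g = k c *: g + b *: g by rewrite -{1}eg scalerA E scalerDl -scalerA eg.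
have [hx hy] : x = k c *: x + b *: x /\ 0 = k c *: y + b *: y.
  have := congr1 f sE; rewrite f'K sg linearD !fa => -[h1 h2].
  by split.
case: (eqVneq c 0) => [c0|nc]; [left|right].
  have x0 : x = 0 by apply: (jrad_fix Jb); rewrite {2}hx c0 kio0 scale0r add0r.
  move=> z; have [a aE] := gen (f' (z, 0)).
  by have := congr1 f aE; rewrite f'K fa x0 scaler0 => -[].
have y0 : y = 0.
  apply: (jrad_fix (b := - (k c^-1 * b))).
    by rewrite -mulNr; exact: sb_ml sb _ _ Jb.
  move/esym/eqP: hy; rewrite addrC addr_eq0 => /eqP hy.
  by rewrite scaleNr -scalerA hy scalerN opprK scalerA -kioM mulVf // kio1 scale1r.
move=> z; have [a aE] := gen (f' (0, z)).
by have := congr1 f aE; rewrite f'K fa y0 scaler0 => -[].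
Qed.

(** The modules S eps_i are indecomposable projective and so fall under the hypothesis; their
    radical series is rewritten by products of elements of J. *)
Lemma proj_equiloewy :
  same_loewy_length (@indec_projective S) -> exists l, equiloewy eps J l.
Proof.
move=> [l hl]; exists l.
have hP i : exists (P : lmodType S) (u : {linear P -> S^o}), [/\ injective u,
    (forall a, (a : S) * eps i = a <-> exists x, u x = a) & has_loewy_length P l].
  have [P [u [r [ui uE uK rE]]]] := left_ideal_ex (sb_idem sb i); exists P, u; split=> //.
  have uP x : (u x : S) * eps i = u x by apply/uE; exists x.
  have rP : retract P (S^o : lmodType S) by exists u, r.
  apply: hl; split.
  - exact: fin_gen_retract rP (fin_gen_R S).
  - apply: (cyclic_indecomposable (g := r 1) (i := i)).
    + move=> /(_ (r 1))/(congr1 u); rewrite rE mul1r linear0.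
      exact: sb_eps0 sb _.
    + apply: ui; rewrite linearZ /= rE mul1r; exact: sb_idem sb i.
    + move=> x; exists (u x); apply: ui; rewrite linearZ /= rE mul1r.
      exact: esym (uP x).
  - by apply: (retract_proj rP); exact: proj_R.
have lz a : jprod J l a -> a = 0.
  move=> pa; rewrite -[a]mulr1 -(sb_sum sb) mulr_sumr big1 // => i _.
  have [P [u [ui uE [hz _]]]] := hP i; have /uE[x xE] := sb_idem sb i.
  have := hz (a *: x); rewrite (rad_seriesE sb) => /(_ (jser_jprod x pa))/(congr1 u).
  by rewrite linearZ /= xE linear0.
split=> // i; have [P [u [ui uE [hz hn]]]] := hP i.
have /uE[x0 x0E] := sb_idem sb i.
have l0 : (0 < l)%N.
  rewrite lt0n; apply/eqP => l0; apply: (sb_eps0 sb (i := i)).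
  by rewrite -x0E (hz x0) ?linear0 // l0.
have [|x rx nx] := hn l.-1; first by rewrite prednK.
apply: contrapT => h; apply: nx; move: rx; rewrite (rad_seriesE sb).
apply: (jser_ind (P := fun x : P => x = 0)) => // [y z -> ->|a y pa]; first by rewrite addr0.
apply: (ui); rewrite linear0 linearZ; change (a * (u y : S) = 0).
have /uE uy : exists y', u y' = u y by exists y.
have [c [b [Jb E]]] := sb_decr sb i (u y); rewrite -uy E mulrDr mulrA -kioC -mulrA.
rewrite (lz (a * b)); last by rewrite -(prednK l0); exact: jprodSr.
rewrite addr0 (_ : a * eps i = 0) ?mulr0 //; apply: contrapT => na; apply: h.
by exists a.
Qed.

Lemma divalZ e a (q : dual_ideal k e) s :
  dval (dival (a *: q)) s = dval (dival q) (s * a).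
Proof. by rewrite linearZ dvalZ. Qed.

Lemma dual_separates (b : S) : b <> 0 -> exists p : S -> K, kfun k p /\ p b <> 0.
Proof.
move=> nb; have [n [f fi]] := embed_dual k (fin_gen_R S).
apply: contrapT => h; apply: nb; apply: (lin_inj0 fi (x := (b : S^o))).
apply/ffunP => j; apply: dival_inj; apply: dval_inj => s; rewrite ffunE linear0.
apply: contrapT => nz; apply: h.
exists (fun t => dval (dival (f 1 j)) (s * t)); split.
  split=> [t t'|c t]; first by rewrite mulrDr dvalr.
  by rewrite mulrA -kioC -mulrA dvalk.
have fb : f (b : S^o) j = b *: f 1 j.
  rewrite -[X in f X](_ : b *: (1 : S^o) = b); last exact: mulr1.
  by rewrite linearZ ffunE.
by rewrite -dvalZ -[X in dval X]linearZ -fb.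
Qed.

Lemma dual_separates_ideal i (b : S) : eps i * b <> 0 ->
  exists q : dual_ideal k (eps i), dval (dival q) b <> 0.
Proof.
move=> /dual_separates[p [[pD pZ] pb]].
have [|s|q qE] := @dual_ideal_ex K S k (eps i) (fun s => p (eps i * s)).
- by split=> [s t|c s]; [rewrite mulrDr pD | rewrite mulrA -kioC -mulrA pZ].
- by rewrite mulrA (sb_idem sb).
by exists q; rewrite qE.
Qed.

(** By nilpotence, a nonzero multiple of x by a product of elements of J of maximal length is killed
    by J. *)
Lemma simple_submodule_ex X (x : X) : x <> 0 ->
  exists a, a *: x <> 0 /\ forall b, J b -> b *: (a *: x) = 0.
Proof.
move=> nx; have [m mE] := sb_nil sb; apply: contrapT => h.
suff : forall n a, (n <= m)%N -> jprod J (m - n) a -> a *: x = 0.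
  by move=> /(_ m 1); rewrite subnn scale1r => /(_ (leqnn _) erefl).
elim=> [|n IH] a nm pa; first by rewrite subn0 in pa; rewrite (mE _ pa) scale0r.
apply: contrapT => nax; apply: h; exists a; split=> // b Jb.
rewrite scalerA; apply: IH; first exact: ltnW.
by rewrite -(subnSK nm); exists b, a.
Qed.

(** The socle of the dual of eps_i S is one-dimensional, since an element killed by J is determined
    by its value at 1. Two nonzero summands would both contribute to it. *)
Lemma dual_ideal_indecomposable i : indecomposable (dual_ideal k (eps i)).
Proof.
set D := dual_ideal _ _.
have val_soc s : exists c, forall q : D, (forall b, J b -> b *: q = 0) ->
    dval (dival q) s = c * dval (dival q) 1.
  have [c [b [Jb E]]] := sb_decl sb i s; exists c => q hq.
  have q1 : dval (dival q) (eps i) = dval (dival q) 1.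
    by have := divalE q 1; rewrite mulr1.
  have qb : dval (dival q) b = 0.
    by rewrite -[b]mul1r -divalZ hq // linear0.
  by rewrite -divalE E dvalr dvalk q1 qb addr0.
split.
  move=> D0; have [|q] := @dual_separates_ideal i (eps i).
    by rewrite (sb_idem sb); exact: sb_eps0 sb _.
  by rewrite (D0 q) linear0.
move=> X Y [f [f' [fK f'K]]].
case: (pselect (is_zero X)) => [|nX]; [by left|right=> y].
have [x nx] : exists x : X, x <> 0.
  by apply: contrapT => h; apply: nX => x; apply: contrapT => nx; apply: h; exists x.
apply: contrapT => ny.
have [a [nax hax]] := simple_submodule_ex nx.
have [b [nby hby]] := simple_submodule_ex ny.
pose q1 : D := f' (a *: x, 0); pose q2 : D := f' (0, b *: y).
have f'i : injective f' by exact: can_inj f'K.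
have f1 : f q1 = (a *: x, 0) by rewrite f'K.
have f2 : f q2 = (0, b *: y) by rewrite f'K.
have fi := can_inj fK.
have h1 c : J c -> c *: q1 = 0.
  move=> Jc; apply: (lin_inj0 fi); rewrite linearZ /= f1.
  by rewrite (_ : c *: _ = (c *: (a *: x), c *: 0)) // hax // scaler0.
have h2 c : J c -> c *: q2 = 0.
  move=> Jc; apply: (lin_inj0 fi); rewrite linearZ /= f2.
  by rewrite (_ : c *: _ = (c *: 0, c *: (b *: y))) // hby // scaler0.
have nq : dval (dival q1) 1 != 0.
  apply/eqP => q0; apply: nax; suff q10 : q1 = 0 by move: f1; rewrite q10 linear0 => -[].
  apply: dival_inj; apply: dval_inj => s; have [c ->] := val_soc s; last by [].
  by rewrite q0 mulr0 linear0.
pose t := dval (dival q2) 1 / dval (dival q1) 1.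
suff q2E : q2 = k t *: q1.
  apply: nby; move: f2; rewrite q2E linearZ /= f1.
  by rewrite (_ : k t *: _ = (k t *: (a *: x), k t *: 0)) // scaler0 => -[_ <-].
apply: dival_inj; apply: dval_inj => s; have [c cE] := val_soc s.
by rewrite divalZ -kioC dvalk !cE // mulrCA divfK.
Qed.

(** S acts on the dual of eps_i S by transposed right multiplication, so a product of elements of J
    kills it exactly when its product with eps_i on the left is zero. This is the Loewy condition on
    the projectives of the opposite ring. *)
Lemma inj_equiloewy : same_loewy_length (@indec_injective S) ->
  exists l, @equiloewy S^c I eps J l.
Proof.
move=> [l hl]; exists l.
have hD i : has_loewy_length (dual_ideal k (eps i)) l.
  apply: hl; split; [exact: dual_ideal_fg | exact: dual_ideal_indecomposable |].
  by apply: dual_ideal_injective; exact: sb_idem sb i.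
have lz a : jprod J l a -> a = 0.
  move=> pa; rewrite -[a]mul1r -(sb_sum sb) mulr_suml big1 // => i _.
  apply: contrapT => /dual_separates_ideal[q]; case; have [hz _] := hD i.
  have := hz (a *: q); rewrite (rad_seriesE sb) => /(_ (jser_jprod q pa)) aq.
  by rewrite -[a]mul1r -divalZ aq linear0.
split=> [a /jprod_op|i]; first exact: lz.
have [hz hn] := hD i.
have l0 : (0 < l)%N.
  rewrite lt0n; apply/eqP => l0.
  have [|q] := @dual_separates_ideal i (eps i).
    by rewrite (sb_idem sb); exact: sb_eps0 sb _.
  by rewrite (hz q) ?linear0 // l0.
have [|x rx nx] := hn l.-1; first by rewrite prednK.
apply: contrapT => h; apply: nx; move: rx; rewrite (rad_seriesE sb).
apply: (jser_ind (P := fun x : dual_ideal k (eps i) => x = 0)) => //.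
  by move=> y z -> ->; rewrite addr0.
move=> a q pa; apply: dival_inj; apply: dval_inj => s.
rewrite divalZ -divalE mulrA; have [c [b [Jb ->]]] := sb_decl sb i s.
rewrite mulrDl (lz (b * a)); last by rewrite -(prednK l0); exists b, a.
rewrite addr0 -mulrA (_ : eps i * a = 0) ?mulr0 ?linear0 ?dvalr0 //.
by apply: contrapT => na; apply: h; exists a => //; exact/jprod_op.
Qed.

End LoewyLengths.

(** * Transfer to the endomorphism algebra of a strong tilting module *)

Section RegularBimodule.
Variable S : pzRingType.

Definition rmulS (s : S^c) : {linear (S^o : lmodType S) -> S^o} := lin_scalel (s : S^o).

Definition regular_bimod : bimod S S^c :=
  @bimod_of S S^c (S^o : lmodType S) rmulS
    (fun a b t => esym (mulrA (t : S) b a)) (fun t => mulr1 (t : S))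
    (fun t a b => mulrDr (t : S) a b).

Lemma regular_bfull : bfull regular_bimod.
Proof.
move=> f; exists (f (1 : S^o) : S) => t.
have h : t = (t : S) *: (1 : S^o) by exact/esym/mulr1.
by rewrite {1}h linearZ.
Qed.

Lemma regular_bfaith : bfaith regular_bimod.
Proof. by move=> s /(_ (1 : S^o)) h; rewrite -[s](mul1r (s : S)); exact: h. Qed.

End RegularBimodule.

Section TiltTransfer.
Variables (K : fieldType) (R S E : pzRingType).
Variables (kR : kstr K R) (kS : kstr K S) (kE : kstr K E).
Variables (B : bimod R S^c) (BT : bimod R E).
Hypothesis tB : transfer_datum kR kS B.
Variable d : nat.
Hypothesis hker : forall M : lmodType R, fin_gen M ->
  (forall (f : {linear bl B -> M}) v, f v = 0) -> pdle d M.
Hypothesis pS : fpd_proj S.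
Hypotheses (full : bfull BT) (faith : bfaith BT) (sT : fstrong (bl BT)).
Hypothesis kT : forall c (t : bl BT), bs (kE c *: bt t) = kR c *: t.

Let hR : noeth R. Proof. exact: noeth_kstr kR. Qed.
Let hS : noeth S. Proof. exact: noeth_kstr kS. Qed.
Let hE : noeth E. Proof. exact: noeth_kstr kE. Qed.
Let gV : fin_gen (bl B). Proof. by case: tB => -[]. Qed.
Let pV : projective (bl B). Proof. by case: tB => -[]. Qed.
Let fullB : bfull B. Proof. by case: tB => _ []. Qed.
Let faithB : bfaith B. Proof. by case: tB => _ []. Qed.
Let gU : fin_gen (hsrc B (R^o : lmodType R)). Proof. by case: tB => _ _ []. Qed.
Let pU : projective (hsrc B (R^o : lmodType R)). Proof. by case: tB => _ _ []. Qed.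
Let kact c v : ract B (kS c) v = kR c *: v. Proof. by case: tB. Qed.

Local Notation T := (bl BT).
Local Notation Phi := (hsrc B).
Let So : lmodType S := S^o.
Let Z : lmodType R := coind B So.

Let phi_projective M : fpd M -> projective (Phi M).
Proof.
move=> dM; apply: pS; have [n [gM _]] := dM.
exact/(transfer_fpd gV pV fullB pU kact hker gM).
Qed.

Let gSo : fin_gen So.
Proof. exact: fin_gen_R. Qed.

Let gZ : fin_gen Z. Proof. exact: (coind_fg gU kact gSo). Qed.

Let dZ : fpd Z.
Proof.
apply/(transfer_fpd gV pV fullB pU kact hker gZ).
have [c [_ ci cs]] := counit gV pV fullB faithB So.
have [r1 _] := retract_bij ci cs.
exists 0%N; split; first exact: fin_gen_retract r1 gSo.
by apply: retract_proj r1 _; exact: proj_R.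
Qed.

(** Phi Z is S, so Z has finite projective dimension and embeds in a power of T. For the cokernel C,
    Phi C is projective, hence Ext^1(C, Z) = 0 by adjunction, and the embedding splits. *)
Let aZ : in_add T Z.
Proof.
have [n [f fi]] := cogen_strong hR hE full faith sT dZ.
have [C [g Sf]] := ses_coker fi.
have [[m dT] _ _] := sT.
have dC : fpd C by apply: fpd_coker Sf dZ _; exists m; exact: fgpd_ffun.
have eC : ext1 C Z by apply: (ext1_coind gV pV); apply: ext1_proj; exact: phi_projective.
have [r fr] := ext1_splits Sf eC.
by apply/in_addP; exists n, f, r.
Qed.

Let rZ : refl BT Z. Proof. exact: refl_add. Qed.

Let z (s : S) : {linear Z -> Z} := hmap (vdual B) (rmulS s).
Let zE s h u : h2l (z s h) u = h2l h u * s :> S. Proof. by []. Qed.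
Let zM s t h : z s (z t h) = z (t * s) h.
Proof. by apply: h_ext => u; rewrite !zE mulrA. Qed.
Let z1 h : z 1 h = h.
Proof. by apply: h_ext => u; rewrite zE mulr1. Qed.
Let zD s t h : z (s + t) h = z s h + z t h.
Proof. by apply: h_ext => u; rewrite h2lD !zE mulrDr. Qed.

Let V' : lmodType E := star BT Z.
Let ph (s : S^c^c) : {linear V' -> V'} := starm BT (z s).
Let phM a b (t : V') : ph a (ph b t) = ph (a * b) t.
Proof. by apply: star_ext => x; rewrite !starmE zM. Qed.
Let ph1 (t : V') : ph 1 t = t.
Proof. by apply: star_ext => x; rewrite !starmE z1. Qed.
Let phD (t : V') a b : ph (a + b) t = ph a t + ph b t.
Proof. by apply: star_ext => x; rewrite s2lD !starmE zD linearD. Qed.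
Let B' : bimod E S^c^c := bimod_of phM ph1 phD.
Let actE (s : S^c) (v : V') : ract B' s v = starm BT (z s) v. Proof. by []. Qed.

(** By reflexivity of Z, endomorphisms of V' are transposes of endomorphisms of Z; these are maps
    from Phi Z = S to S by adjunction, hence right multiplications. *)
Let full' : bfull B'.
Proof.
move=> f; have [g gE] := star_full f rZ.
have [g' g'E] := unadj_ex gV pV g.
have [c [cE ci cs]] := counit gV pV fullB faithB So.
have [c' [cc' c'c]] := inv_ex ci cs.
have [s sE] := regular_bfull (linc g' c').
exists s => v; rewrite [LHS]gE; apply: star_ext => x.
rewrite [LHS](_ : _ = s2l v (g x)) // [RHS](_ : _ = s2l v (z s x)) //; congr (s2l v _).
rewrite -g'E; apply: h_ext => u; rewrite adjE zE -{2}(cE x) adjE.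
by have := sE (c (rmul B x u)); rewrite /= cc'.
Qed.

Let faith' : bfaith B'.
Proof.
move=> s h; have h0 x : z s x = 0.
  apply: (star_refl_inj (f := z s) (g := lin0 Z Z) rZ) => v.
  rewrite (_ : starm BT (z s) v = 0); last exact: (h v).
  by apply: star_ext => y; rewrite starmE linear0.
have [c [cE ci cs]] := counit gV pV fullB faithB So.
have [y yE] := cs (1 : S^o).
have e1 := unadj_eq gV pV (g := linc (@rmulS S s) c) (g' := lin0 _ So).
rewrite -[s](mul1r (s : S)) -yE; apply: (e1 _ y) => x.
apply: h_ext => u; rewrite !adjE; have := congr1 (fun h => h2l h u) (h0 x).
by rewrite zE -{1}(cE x) adjE => e; rewrite [RHS](_ : _ = 0).
Qed.

Let kact' c v : ract B' (kstr_op kS c) v = kE c *: v.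
Proof.
rewrite actE; apply: star_ext => x; rewrite starmE s2lZ kT -linearZ; congr (s2l v _).
apply: h_ext => u; rewrite zE coindZ (_ : umul _ _ = kS c *: u) ?linearZ /=.
  exact: esym (kioC kS c _).
exact: vdual_kact kact c u.
Qed.

(** Hom_E(V', E) is Hom_R(T, Z) by reflexivity of Z, since E is the dual of T, and this is Hom_S(Phi
    T, S) by adjunction; Phi T is finitely generated projective. *)
Let U'_ok : fin_gen (hsrc B' (E^o : lmodType E)) /\ projective (hsrc B' (E^o : lmodType E)).
Proof.
have dT : fpd T by case: sT.
have gT : fin_gen T by case: dT => n [].
have pPT := phi_projective dT.
have gPT := phi_fg gV kact gT.
have aPT : in_add (bl (regular_bimod S)) (Phi T).
  by have [n rn] := fin_gen_proj gPT pPT; apply/in_addP; exists n.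
have [gH pH] := star_add_proj (@regular_bfull S) (@regular_bfaith S) aPT.
have [ka' [ka [kaK ka'K]]] := star_T full faith.
have hL : linear (fun g : star (regular_bimod S) (Phi T) =>
    @l2h _ _ B' _ (linc ka (starm BT (@adj _ _ B T So (s2l g)))) : hsrc B' (E^o : lmodType E)).
  move=> s g g'; apply: h_ext => v; rewrite h2lP.
  rewrite [RHS](_ : _ = ka (starm BT (adj (s2l g)) (ract B' s v) + starm BT (adj (s2l g')) v)).
    2: by rewrite linearD.
  rewrite [LHS](_ : _ = ka (starm BT (adj (s2l (s *: g + g'))) v)) //.
  congr (ka _); apply: star_ext => x; rewrite s2lD !starmE.
  rewrite [X in _ = X + _](_ : _ = s2l v (z s (adj (s2l g) x))) // -linearD; congr (s2l v _).
  by apply: h_ext => u; rewrite h2lD zE !adjE s2lP.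
have hi : injective (mklin hL).
  apply: lin_inj => g h; apply: star_ext => y.
  apply: (unadj_eq gV pV (g := s2l g) (g' := lin0 _ So)) => x.
  transitivity (lin0 T Z x); last by apply: h_ext => u; rewrite adjE.
  apply: (star_refl_inj rZ) => v.
  have := congr1 (fun f : hsrc B' (E^o : lmodType E) => h2l f v) h.
  rewrite [LHS](_ : _ = ka (starm BT (adj (s2l g)) v)) // => /(lin_inj0 (can_inj ka'K)) ->.
  by apply: star_ext => t; rewrite starmE linear0.
have hs : surjective_map (mklin hL).
  move=> u; have [f fE] := star_full (linc ka' (h2l u)) rZ.
  have [g gE] := unadj_ex gV pV f; exists (@l2s _ _ (regular_bimod S) _ g); apply: h_ext => v.
  rewrite [LHS](_ : _ = ka (starm BT (adj g) v)) // -[RHS]kaK; congr (ka _).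
  by have := fE v; rewrite /= => ->; apply: star_ext => x; rewrite !starmE gE.
have [_ r2] := retract_bij hi hs; split; first exact: fin_gen_retract r2 gH.
exact: retract_proj r2 pH.
Qed.

Let gpV' : fin_gen V' /\ projective V'.
Proof. exact: star_add_proj full faith aZ. Qed.

Lemma tilt_datum : transfer_datum kE (kstr_op kS) B'.
Proof. by split=> //; case: gpV' U'_ok. Qed.

(** Duals of projectives lie in add U, and the dual of X is the kernel of an epimorphism from such a
    dual onto the dual of a syzygy; the bound n0 therefore survives the induction. *)
Let star_pdle n0 : pdle n0 (br BT) -> forall X, fpd X -> pdle n0 (star BT X).
Proof.
move=> hn X [n]; have gT : fin_gen (br BT) by case: (fpd_U hR hE full faith sT) => m [].
have hp P : fgpd 0 P -> pdle n0 (star BT P).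
  move=> [gP pP]; have /in_addP[m rm] := star_proj_add BT gP pP.
  by case: (fgpd_retract hE rm (fgpd_ffun m (conj gT hn))).
elim: n X => [|n IH] X hX; first exact: hp.
have [k [Y [i [p [Si hY]]]]] := fpd_cover hR hX.
have [_ _ eT] := sT; have Ss := star_ses Si (eT _ (ex_intro _ n.+1 hX)).
exact: pdle_left Ss (hp _ (fgpd_free R k)) (pdleS (IH _ hY)).
Qed.

(* M is the cokernel of f* for a map f between powers of T; that Hom_E(Z*, M)
   vanishes makes Hom(f, Z) onto, hence Phi f a split monomorphism, hence coker f
   of finite projective dimension, and (coker f)* is a second syzygy of M. *)
Lemma tilt_hker : exists d', forall M : lmodType E, fin_gen M ->
  (forall (f : {linear bl B' -> M}) v, f v = 0) -> pdle d' M.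
Proof.
have [n0 [gbr hn0]] := fpd_U hR hE full faith sT.
(* [n0] bounds the projective dimension of the dual of the cokernel C below; two syzygy steps lead
   from it to M. *)
exists n0.+2 => M gM hM; have [gV' pV'] := gpV'.
have [th [th' [thK th'K]]] := star_T full faith.
have iso n : exists (a : {linear star BT ({ffun 'I_n -> T} : lmodType R) -> free E n})
    (b : {linear free E n -> star BT ({ffun 'I_n -> T} : lmodType R)}), cancel a b /\ cancel b a.
  have [f [g [fg gf]]] := star_ffun BT T n.
  pose u := lin_tuple (fun i : 'I_n => linc th' (lin_proj (star BT T) i)).
  pose v := lin_tuple (fun i : 'I_n => linc th (lin_proj (E^o : lmodType E) i)).
  exists (linc u f), (linc g v); split=> x.
    rewrite -[RHS]fg [LHS](_ : _ = g (v (u (f x)))) //; congr (g _).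
    by apply/ffunP => i; rewrite !ffunE /= ffunE /= th'K.
  rewrite [LHS](_ : _ = u (f (g (v x)))) // gf.
  by apply/ffunP => i; rewrite !ffunE /= ffunE /= thK.
have [n [p ps]] := (fin_genP M).1 gM.
have [a [b [ab ba]]] := iso n.
pose p' := linc p a.
have p's : surjective_map p' by move=> x; have [y <-] := ps x; exists (b y); rewrite /= ba.
have [N [j Sj]] := ses_ker p's; have [ji je _] := Sj.
have dX n' : fpd ({ffun 'I_n' -> T} : lmodType R).
  by have [[m dT] _ _] := sT; exists m; exact: fgpd_ffun.
have rX n' : refl BT ({ffun 'I_n' -> T} : lmodType R) by apply/refl_ffun/refl_T.
have [gXn pXn] : fin_gen (star BT ({ffun 'I_n -> T} : lmodType R)) /\
    projective (star BT ({ffun 'I_n -> T} : lmodType R)).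
  by apply: star_add_proj full faith _; apply/in_addP; exists n; exact: retract_refl.
have [m [q qs]] := (fin_genP N).1 (hE ji gXn).
have [a' [b' [ab' ba']]] := iso m.
have [f fE] := star_full (linc j (linc q a')) (rX m).
have q's : surjective_map (linc q a').
  by move=> x; have [y <-] := qs x; exists (b' y); rewrite /= ba'.
have fim x : (exists y, starm BT f y = x) <-> p' x = 0.
  split=> [[y <-]|/je[w <-]].
    by rewrite -fE [LHS](_ : _ = p' (j (q (a' y)))) //; exact: ses0 _ Sj.
  by have [y <-] := q's w; exists y; rewrite -fE.
(* The transpose of g vanishes in M by [hM], so it lands in N; projectivity of V' lifts it through
   the cover of N, and reflexivity of Z transposes the lift back to g'. *)
have ext (g : {linear {ffun 'I_n -> T} -> Z}) :
    exists g' : {linear {ffun 'I_m -> T} -> Z}, forall x, g x = g' (f x).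
  have [|w wE] := lift_ker (h := starm BT g) ji je.
    by move=> v; have := hM (linc p' (starm BT g)) v.
  have [w' w'E] := pV' _ _ (linc q a') w q's.
  have [g' g'E] := star_full w' rZ.
  exists g'; apply: (star_refl_inj (g := linc g' f) rZ) => v.
  transitivity (starm BT f (w' v)).
    by rewrite -fE -wE -w'E.
  by rewrite g'E; apply: star_ext => x.
have pPn := phi_projective (dX n); have pPm := phi_projective (dX m).
have gPn : fin_gen (Phi {ffun 'I_n -> T}).
  by apply: (phi_fg gV kact); case: (dX n) => l [].
have [l [u [r ur]]] := fin_gen_proj gPn pPn.
(* Phi of the n-th power of T is a summand of a power of S; extending its coordinates along f by
   [ext] and adjunction splits Phi f. *)
have [s sE] : exists s : {linear Phi {ffun 'I_m -> T} -> Phi {ffun 'I_n -> T}},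
    forall x, s (hmap B f x) = x.
  have /choice[g gE] : forall i : 'I_l, exists g : {linear Phi {ffun 'I_m -> T} -> So},
      forall x, g (hmap B f x) = u x i.
    move=> i; have [g' g'E] := ext (adj (linc (lin_proj So i) u)).
    have [g gE] := unadj_ex gV pV g'; exists g.
    have e1 := unadj_eq gV pV (g := linc g (hmap B f)) (g' := linc (lin_proj So i) u).
    apply: e1 => x; apply: h_ext => y; rewrite g'E -gE !adjE.
    rewrite [LHS](_ : _ = g (hmap B f (rmul B x y))) //; congr (g _).
    by apply: h_ext => v; rewrite hmapE !rmulE linearZ.
  exists (linc r (lin_tuple g)) => x; rewrite -[RHS]ur [LHS](_ : _ = r (lin_tuple g (hmap B f x))) //.
  by congr (r _); apply/ffunP => i; rewrite ffunE gE.
have [I [i [f' [ii f's fi]]]] := im_ex f.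
have [C [c Sc]] := ses_coker ii; have [_ ce cs] := Sc.
have gC : fin_gen C by apply: fin_gen_surj cs _; case: (dX m) => k [].
have dC : fpd C.
  apply/(transfer_fpd gV pV fullB pU kact hker gC); exists 0%N; split.
    exact: (phi_fg gV kact gC).
  have ScP := hmap_ses pV Sc; have [Pi Pe Ps] := ScP.
  have f'Ps : surjective_map (hmap B f').
    move=> h; have [g gE] := pV (h2l h) f's.
    by exists (l2h g); apply: h_ext => v; rewrite hmapE gE.
  have Fi x : hmap B i (hmap B f' x) = hmap B f x by apply: h_ext => v; rewrite !hmapE fi.
  have rK h : linc (hmap B f') s (hmap B i h) = h.
    have [x <-] := f'Ps h; rewrite Fi.
    by rewrite [LHS](_ : _ = hmap B f' (s (hmap B f x))) // sE.
  have [t tE] := ses_retraction_section ScP rK.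
  by apply: retract_proj pPm; exists t, (hmap B c).
have [_ _ eT] := sT.
have Ss := star_ses Sc (eT _ dC); have [si se _] := Ss.
have fE' x : starm BT f x = starm BT f' (starm BT i x).
  by apply: star_ext => y; rewrite !starmE fi.
have f'inj x : starm BT f' x = 0 -> x = 0.
  move=> e; apply: star_ext => y; have [w <-] := f's y.
  by rewrite -starmE e.
have SN : ses (starm BT c) (linc q a').
  split=> // x; rewrite -se; split=> [h|h].
    by apply: f'inj; rewrite -fE' -fE [LHS](_ : _ = j (linc q a' x)) // h linear0.
  by apply: (lin_inj0 ji); rewrite [LHS](_ : _ = linc j (linc q a') x) // fE fE' h linear0.
have [gXm pXm] : fin_gen (star BT ({ffun 'I_m -> T} : lmodType R)) /\
    projective (star BT ({ffun 'I_m -> T} : lmodType R)).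
  by apply: star_add_proj full faith _; apply/in_addP; exists m; exact: retract_refl.
exists N, (star BT ({ffun 'I_n -> T} : lmodType R)), j, p'; split=> //.
exists (star BT C), (star BT ({ffun 'I_m -> T} : lmodType R)), (starm BT c), (linc q a').
by split=> //; exact: star_pdle.
Qed.

Theorem tilt_transfer : exists (C : bimod E S^c^c) d',
  transfer_datum kE (kstr_op kS) C /\ forall M : lmodType E, fin_gen M ->
  (forall (f : {linear bl C -> M}) v, f v = 0) -> pdle d' M.
Proof. by have [d' hd] := tilt_hker; exists B', d'; split=> //; exact: tilt_datum. Qed.

End TiltTransfer.

(** * Split basic structure of corners *)

Section CornerBasic.
Variables (K : fieldType) (R : pzRingType) (k : kstr K R) (idem : Defs.idempotent R).
Local Notation e := (idem_val idem).
Local Notation A := (corner idem).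

Lemma corner_cut_subproof (r : R) : e * r * e \in corner_pred idem.
Proof. by rewrite inE !mulrA idemP -!mulrA idemP. Qed.
Definition corner_cut r : A := Corner (corner_cut_subproof r).

Lemma corner_cutK (a : A) : corner_cut (val a) = a.
Proof. by apply: val_inj; rewrite /= corner_idl corner_idr. Qed.

Lemma corner_valD (a b : A) : val (a + b) = val a + val b. Proof. by []. Qed.
Lemma corner_valM (a b : A) : val (a * b) = val a * val b. Proof. by []. Qed.
Lemma corner_val1 : val (1 : A) = e. Proof. by []. Qed.
Lemma corner_val_sum (I : finType) (P : pred I) (F : I -> A) :
  val (\sum_(i | P i) F i) = \sum_(i | P i) val (F i).
Proof. exact: (big_morph (fun a : A => val a) corner_valD erefl). Qed.

Let kE c : val (corner_cut (k c)) = k c * e.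
Proof. by rewrite /= -kioC -mulrA idemP. Qed.
Definition kstr_corner : kstr K A.
Proof.
refine (@KStr K A (fun c => corner_cut (k c)) _ _ _ _ _).
- by apply: val_inj; rewrite kE kio1 mul1r.
- by move=> a b; apply: val_inj; rewrite corner_valD !kE kioD mulrDl.
- move=> a b; apply: val_inj; rewrite corner_valM !kE kioM.
  by rewrite -{1}(idemP idem) -!mulrA; congr (_ * _); rewrite !mulrA kioC.
- move=> a r; apply: val_inj; rewrite !corner_valM !kE -mulrA corner_idl.
  by rewrite mulrA -kioC -mulrA corner_idr.
- have [n [g gP]] := kiofg k; exists n, (fun i => corner_cut (g i)) => r.
  have [c cE] := gP (val r); exists c; rewrite -{1}(corner_cutK r) cE; apply: val_inj.
  rewrite corner_val_sum [LHS]/= mulr_sumr mulr_suml; apply: eq_bigr => i _.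
  by rewrite corner_valM kE -[RHS]mulrA corner_idl /= !mulrA (kioC k (c i) e).
Defined.

Lemma kstr_cornerE c : val (kstr_corner c) = k c * e.
Proof. exact: kE. Qed.

Variables (I : finType) (eps : I -> R) (J : R -> Prop) (P : {pred I}).
Hypothesis sb : split_basic k eps J.
Hypothesis eP : e = \sum_(i in P) eps i.

Lemma corner_eps i : i \in P -> e * eps i = eps i /\ eps i * e = eps i.
Proof.
move=> Pi; rewrite eP mulr_suml mulr_sumr; split; rewrite (bigD1 i) //= (sb_idem sb) big1 ?addr0 //.
  by move=> j /andP[_ ji]; exact: sb_orth sb _ _ ji.
by move=> j /andP[_ ji]; rewrite (sb_orth sb) // eq_sym.
Qed.

Definition ceps (i : {i | i \in P}) : A := corner_cut (eps (val i)).
Lemma cepsE i : val (ceps i) = eps (val i).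
Proof. by have [h1 h2] := corner_eps (svalP i); rewrite /= h1 h2. Qed.

Lemma split_basic_corner :
  split_basic kstr_corner ceps (fun a : A => J (val a)).
Proof.
split.
- apply: val_inj; rewrite corner_val_sum corner_val1 eP [RHS]big_sub.
  by apply: eq_bigr => i _; exact: cepsE.
- by move=> i; apply: val_inj; rewrite corner_valM !cepsE (sb_idem sb).
- by move=> i j ij; apply: val_inj; rewrite corner_valM !cepsE (sb_orth sb).
- exact: sb_0 sb.
- by move=> a b; exact: sb_D sb _ _.
- by move=> a b; exact: sb_ml sb _ _.
- by move=> a b; exact: sb_mr sb _ _.
- move=> a; have [c [b Jb E]] := sb_dec sb (val a).
  exists (fun i => c (val i)), (corner_cut b).
    by apply: (sb_mr sb); apply: (sb_ml sb).
  rewrite -{1}(corner_cutK a) E; apply: val_inj.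
  rewrite corner_valD /= mulrDr mulrDl; congr (_ + _).
  rewrite corner_val_sum mulr_sumr mulr_suml.
  rewrite [RHS](_ : _ = \sum_(i in P) k (c i) * eps i).
    rewrite (bigID (fun i => i \in P)) /= [X in _ + X]big1 ?addr0.
      apply: eq_bigr => i Pi; have [h1 h2] := corner_eps Pi.
      by rewrite -mulrA -mulrA h2 mulrA -kioC -mulrA h1.
    move=> i nPi; rewrite -!mulrA (_ : eps i * e = 0) ?mulr0 //.
    rewrite eP mulr_sumr big1 // => j Pj; rewrite (sb_orth sb) //.
    by apply: contraNneq nPi => ->.
  rewrite [RHS]big_sub; apply: eq_bigr => i _.
  rewrite corner_valM cepsE kstr_cornerE -mulrA.
  by have [-> _] := corner_eps (svalP i).
- have [m mE] := sb_nil sb; exists m => a pa; apply: val_inj.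
  (* The empty product of the corner is e and not 1, hence the factor e. *)
  suff [b pb ->] : exists2 b, jprod J m b & val a = b * e by rewrite (mE _ pb) mul0r.
  elim: m a pa {mE} => [|m IH] a; first by move=> ->; exists 1; rewrite ?mul1r.
  move=> [b [c [Jb pc ->]]]; have [d pd dE] := IH _ pc.
  by exists (val b * d); [exists (val b), d | rewrite corner_valM dE mulrA].
- by move=> i; rewrite cepsE; exact: sb_eps sb _.
Qed.

End CornerBasic.

(** Modulo J the ring is a product of copies of K, where u^2 = 0 forces u = 0; so u is in J, and u =
    (u v)^m u vanishes by nilpotence. *)
Lemma split_basic_nodup (K : fieldType) (R : pzRingType) (k : kstr K R)
    (I : finType) (eps : I -> R) (J : R -> Prop) : split_basic k eps J -> nodup R.
Proof.
move=> sb u v uu vv uvu vuv.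
have JB a b : J (a + b) -> J b -> J a.
  move=> Jab Jb; rewrite -[a](addrK b) -mulN1r.
  by apply: (sb_D sb Jab); exact: sb_ml sb _ _ Jb.
have Ju : J u.
  rewrite -[u]mulr1 -(sb_sum sb) mulr_sumr; apply: big_ind; first exact: sb_0 sb.
    exact: sb_D sb.
  move=> i _; have [c [b [Jb E]]] := sb_decr sb i u; rewrite E.
  case: (eqVneq c 0) E => [->|nc] E; first by rewrite kio0 mul0r add0r.
  have h : 0 = k c * (k c * eps i + b) + u * b.
    by rewrite -E mulrA kioC -mulrA -mulrDr -E mulrA uu mul0r.
  case: (sb_eps sb (i := i)).
  have J1 : J (k c * (k c * eps i)).
    apply: (JB _ (k c * b + u * b)).
      by rewrite addrA -mulrDr -h; exact: sb_0 sb.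
    by apply: (sb_D sb); apply: (sb_ml sb).
  rewrite -[eps i]mul1r -(kio1 k) -(mulVf (mulf_neq0 nc nc)) kioM kioM -!mulrA.
  exact: sb_ml sb _ _ J1.
have [m mE] := sb_nil sb.
suff [a pa ->] : exists2 a, jprod J m a & u = a * u by rewrite (mE _ pa) mul0r.
elim: m {mE} => [|m [a pa uE]]; first by exists 1; rewrite ?mul1r.
exists (u * v * a); last by rewrite -mulrA -uE uvu.
by exists (u * v), a; split=> //; exact: sb_mr sb _ _ Ju.
Qed.

(** * Path algebras modulo relations *)

Section PathAlgebraQuotient.
Variables (K : fieldType) (Q : quiver) (I : admissible_ideal K Q).
Local Notation KQ := (pathalg K Q).
Local Notation L := (pathquot I).
Local Notation pi := (to_quot I).
Implicit Types (f g : KQ) (p q r : qpath Q) (v w : vertex Q) (x y : L).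

Let piZ c f : pi (c *: f) = c *: pi f. Proof. exact: to_quotZ. Qed.
Let piM f g : pi (f * g) = pi f * pi g. Proof. exact: to_quotM. Qed.
Let pi1 : pi 1 = 1. Proof. by []. Qed.
Let pi_sum (T : Type) (s : seq T) (F : T -> KQ) :
  pi (\sum_(i <- s) F i) = \sum_(i <- s) pi (F i).
Proof. exact: (big_morph pi (@to_quotD K Q I) (@to_quot0 K Q I)). Qed.
Let piP x : exists f, x = pi f. Proof. by exists (of_quot x); rewrite of_quotK. Qed.
Let pi_eq0 f : f \in I -> pi f = 0.
Proof. by move=> If; apply/eqP; rewrite -(to_quot0 I) to_quot_eq subr0. Qed.

(** Membership in the n-th power of the arrow ideal, read from the lengths of the paths that
    occur. *)
Definition long n f : Prop := forall p, p \in msupp f -> (n <= plength p)%N.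

Lemma long0 n : long n 0. Proof. by move=> p; rewrite msupp0 inE. Qed.
Lemma longD n f g : long n f -> long n g -> long n (f + g).
Proof.
move=> hf hg p /(fsubsetP (msuppD_le f g)); rewrite inE => /orP[]; [exact: hf|exact: hg].
Qed.
Lemma long_pathU n c p : (n <= plength p)%N -> long n (<< c *g p >> : KQ).
Proof. by move=> h q /(fsubsetP msuppU_le); rewrite inE => /eqP ->. Qed.

Lemma plength_comp p q r : Defs.pcomp p q = Some r -> plength r = (plength p + plength q)%N.
Proof.
case: (pend q =P pstart p) => [e|/eqP/pcompN -> //].
have [s -> E] := pcompP e; case=> <-.
by rewrite /plength /ptrail E /= size_cat addnC.
Qed.

Lemma longM n m f g : long n f -> long m g -> long (n + m) (f * g).
Proof.
move=> hf hg; change (long (n + m) (pathalg_mul f g)).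
rewrite /pathalg_mul big_seq; apply: big_ind => [|? ?|p /hf hp]; [exact: long0|exact: longD|].
rewrite big_seq; apply: big_ind => [|? ?|q /hg hq]; [exact: long0|exact: longD|].
case E: (Defs.pcomp p q) => [r|] /=; last exact: long0.
by apply: long_pathU; rewrite (plength_comp E) leq_add.
Qed.

Definition arrow_rad x : Prop := exists2 f, long 1 f & x = pi f.

Lemma long_mem m f : (forall p, (m <= plength p)%N -> pathU K p \in I) ->
  long m f -> f \in I.
Proof.
move=> hm hf; rewrite (pathalgE f) big_seq; apply: rpred_sum => p /hf/hm Ip.
by have := aideal_mull (f@_p)%:A Ip; rewrite -scalerAl mul1r.
Qed.

Lemma jprod_long n x : jprod arrow_rad n x -> exists2 f, long n f & x = pi f.
Proof.
elim: n x => [|n IH] x /=; first by move=> ->; exists 1.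
move=> [b [c [[f hf ->] /IH[g hg ->] ->]]]; exists (f * g); last by rewrite piM.
exact: longM hf hg.
Qed.

Definition cut v w f : KQ :=
  \sum_(p <- msupp f) (if (pend p == v) && (pstart p == w) then f@_p *: pathU K p else 0).

Lemma videm_cut v w f : videm K v * f * videm K w = cut v w f.
Proof.
have hl p : videm K v * pathU K p = if pend p == v then pathU K p else 0.
  by rewrite [LHS]pathalg_mulU pcomp_trivl; case: eqP.
have hr p : pathU K p * videm K w = if pstart p == w then pathU K p else 0.
  by rewrite [LHS]pathalg_mulU pcomp_trivr; case: eqP.
rewrite {1}(pathalgE f) mulr_sumr mulr_suml; apply: eq_bigr => p _.
rewrite -scalerAr -scalerAl hl; case: eqP => _ /=; last by rewrite mul0r scaler0.
by rewrite hr; case: eqP => _; rewrite ?scaler0.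
Qed.

Lemma qvidem_cut v w f : qvidem I v * pi f * qvidem I w = pi (cut v w f).
Proof. by rewrite /qvidem -!piM videm_cut. Qed.

Lemma qvidem_path v w x : qvidem I v * x * qvidem I w <> 0 ->
  exists p, pstart p = w /\ pend p = v.
Proof.
have [f ->] := piP x; rewrite qvidem_cut => h; apply: contrapT => np; apply: h.
rewrite /cut big1 ?to_quot0 // => p _; case: andP => // -[/eqP e /eqP s].
by case: np; exists p.
Qed.

Lemma qvidem_local v x : (forall p, pstart p = v -> pend p = v -> plength p = 0%N) ->
  exists c, qvidem I v * x * qvidem I v = c *: qvidem I v.
Proof.
move=> hv; have [f ->] := piP x; rewrite qvidem_cut.
suff [c ->] : exists c, cut v v f = c *: videm K v by exists c; rewrite piZ.
rewrite /cut; apply: (big_ind (fun y : KQ => exists c, y = c *: videm K v)) => [|_ _ [c ->] [d ->]|p _]; first by exists 0; rewrite scale0r.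
  by exists (c + d); rewrite scalerDl.
case: andP => [[/eqP e /eqP s]|_]; last by exists 0; rewrite scale0r.
exists f@_p; congr (_ *: pathU K _); apply: val_inj => /=.
have := hv p s e; rewrite /plength => /size0nil h.
by rewrite -s -h /pstart /ptrail; case: (pword p).
Qed.

Lemma pathquot_fg : fin_gen (L : lmodType K).
Proof.
have [m hm] := aideal_nilpotent I.
(* Words of length at most m serve as indices; a word that is not a path contributes 0 through
   [insub]. *)
pose T := {: vertex Q * m.-bseq (arrow Q)}.
pose g (t : T) : L := pi (opathU 1 (insub (t.1, val t.2))).
exists #|T|, (fun i => g (enum_val i)) => x; have [f ->] := piP x.
have gen p : exists c : T -> K, pi (pathU K p) = \sum_t c t *: g t.
  case: (leqP m (plength p)) => [/hm/pi_eq0 ->|pm].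
    by exists (fun=> 0); rewrite big1 // => t _; rewrite scale0r.
  have sp : (size (ptrail p) <= m)%N by exact: ltnW.
  pose t0 : T := (pstart p, Bseq sp); exists (fun t => (t == t0)%:R).
  rewrite (bigD1 t0) //= eqxx scale1r big1 ?addr0 => [|t /negbTE ->]; last by rewrite scale0r.
  rewrite /g /=; congr pi; rewrite (_ : insub _ = Some p) //.
  by rewrite -[RHS](valK p); congr insub; rewrite /= /pstart /ptrail; case: (pword p).
suff [c ->] : exists c : T -> K, pi f = \sum_t c t *: g t.
  by exists (fun i => c (enum_val i)); rewrite (reindex _ (onW_bij _ (enum_val_bij _))).
rewrite (pathalgE f) pi_sum.
apply: (big_ind (fun y => exists c : T -> K, y = \sum_t c t *: g t)) => [|_ _ [c ->] [d ->]|p _].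
- by exists (fun=> 0); rewrite big1 // => t _; rewrite scale0r.
- by exists (fun t => c t + d t); rewrite -big_split; apply: eq_bigr => t _; rewrite scalerDl.
- have [c cE] := gen p; exists (fun t => f@_p * c t); rewrite piZ cE scaler_sumr.
  by apply: eq_bigr => t _; rewrite scalerA.
Qed.

Lemma qvidem_sum : \sum_v qvidem I v = 1.
Proof. by rewrite -pi1 -pi_sum. Qed.

Lemma pathquot_split_basic : split_basic (kstr_alg pathquot_fg) (qvidem I) arrow_rad.
Proof.
split.
- exact: qvidem_sum.
- by move=> v; rewrite qvidem_mul eqxx.
- by move=> v w /negbTE vw; rewrite qvidem_mul vw.
- by exists 0; rewrite ?to_quot0 //; exact: long0.
- by move=> _ _ [f hf ->] [g hg ->]; exists (f + g); rewrite ?to_quotD //; exact: longD.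
- move=> a _ [f hf ->]; have [g ->] := piP a; exists (g * f); last by rewrite piM.
  by apply: (@longM 0 1).
- move=> _ b [f hf ->]; have [g ->] := piP b; exists (f * g); last by rewrite piM.
  by apply: (@longM 1 0).
- move=> x; have [f ->] := piP x; exists (fun v => f@_(ptriv v)).
  (* Removing the coefficients at the trivial paths leaves only paths of positive length. *)
  exists (pi (f - \sum_v f@_(ptriv v) *: videm K v)); last first.
    rewrite (_ : \sum_i _ = pi (\sum_v f@_(ptriv v) *: videm K v)).
      by rewrite -to_quotD addrC subrK.
    by rewrite pi_sum; apply: eq_bigr => v _; rewrite kstr_algE -scalerAl mul1r piZ.
  exists (f - \sum_v f@_(ptriv v) *: videm K v) => // p; apply: contraLR.
  rewrite -ltnNge ltnS leqn0 => /eqP p0; rewrite -mcoeff_eq0 mcoeffB.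
  have -> : p = ptriv (pstart p).
    apply: val_inj => /=; move: p0; rewrite /plength => /size0nil.
    by rewrite /pstart /ptrail; case: (pword p) => /= a s ->.
  rewrite raddf_sum (bigD1 (pstart p)) //= big1 ?addr0 => [|v vp].
    by rewrite pcoeffZ mcoeffUU mulr1 subrr.
  rewrite pcoeffZ mcoeffU; case: eqP => [/(congr1 (@pstart Q)) /= e|]; last by rewrite mulr0.
  by rewrite (e : v = pstart p) eqxx in vp.
- have [m hm] := aideal_nilpotent I; exists m => a /jprod_long[f hf ->].
  by apply: pi_eq0; exact: long_mem hm hf.
- move=> v [f hf] /eqP; rewrite /qvidem to_quot_eq => If.
  have : ptriv v \in msupp (videm K v - f).
    rewrite -mcoeff_neq0 mcoeffB mcoeffUU (mcoeff_outdom (g := f)) ?subr0 ?oner_eq0 //.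
    by apply/negP => /hf.
  by move=> /(aideal_ge2 If).
Qed.

End PathAlgebraQuotient.

(** * Reachability and ranks of vertices *)

Section QuiverOrder.
Variable Q : quiver.
Implicit Types (p q c : qpath Q) (v w : vertex Q).

Definition reach w v : Prop := exists p : qpath Q, pstart p = w /\ pend p = v.

Lemma reach_refl v : reach v v. Proof. by exists (ptriv v). Qed.

Lemma reach_trans u v w : reach u v -> reach v w -> reach u w.
Proof.
move=> [p [ps pe]] [q [qs qe]]; have e : pend p = pstart q by rewrite pe qs.
have [r Er _] := pcompP e; have [h1 h2] := pcomp_endpoints Er.
by exists r; rewrite h1 h2.
Qed.

Lemma precyclic_reach w v : reach w v -> precyclic v -> precyclic w.
Proof.
move=> rwv [p [c [ps oc pc]]].
have [q [qs qe]] : reach w (pend p) by apply: reach_trans rwv _; exists p.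
by exists q, c; rewrite qe.
Qed.

Lemma postcyclic_reach w v : reach w v -> postcyclic w -> postcyclic v.
Proof.
move=> rwv [p [c [oc pc pe]]].
have [q [qs qe]] : reach (pstart p) v by apply: reach_trans rwv; exists p.
by exists q, c; rewrite qs.
Qed.

Lemma closed_path_critical v p :
  pstart p = v -> pend p = v -> plength p <> 0%N -> critical v.
Proof.
move=> ps pe /eqP; rewrite -lt0n => p0.
have oc : oriented_cycle p by split; rewrite // ps.
by split; [exists (ptriv v), p | exists (ptriv v), p]; split=> //=;
  rewrite /pvertices /pend /= -?ps inE eqxx.
Qed.

Lemma reach_anti v w : v <> w -> reach v w -> reach w v -> critical v.
Proof.
move=> vw [p [ps pe]] [q [qs qe]]; have e : pend p = pstart q by rewrite pe qs.
have [r Er _] := pcompP e; have [h1 h2] := pcomp_endpoints Er.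
apply: (@closed_path_critical v r); rewrite ?h1 ?h2 // (plength_comp Er) => /eqP.
rewrite addn_eq0 => /andP[_ /eqP]; rewrite /plength => /size0nil p0; apply: vw.
by rewrite -ps -pe /pend p0.
Qed.

(** Ties of h are broken by the enumeration: h is scaled by the size of T, and the position in T is
    the remainder. *)
Lemma rank_ex (T : finType) (h : T -> nat) :
  exists r : T -> nat, injective r /\ forall x y, (h x < h y)%N -> (r x < r y)%N.
Proof.
exists (fun x => h x * #|T| + enum_rank x)%N; split=> [x y|x y hxy].
  move=> e; have n0 : (0 < #|T|)%N by apply/card_gt0P; exists x.
  have := congr1 (modn^~ #|T|) e.
  by rewrite !modnMDl !modn_small // => /ord_inj/enum_rank_inj.
have : (h x * #|T| + enum_rank x < (h x).+1 * #|T|)%N by rewrite mulSn addnC ltn_add2r.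
move=> /leq_trans; apply; apply: leq_trans (leq_addr _ _).
by rewrite leq_mul2r hxy orbT.
Qed.

(** The height of v counts the vertices that reach v. It grows strictly from w to a noncritical v,
    because v itself does not reach w. *)
Lemma reach_rank : exists r : vertex Q -> nat, injective r /\
  forall v w, ~ critical v -> v <> w -> reach w v -> (r w < r v)%N.
Proof.
pose h v := #|[pred u | `[< reach u v >]]|.
have [r [ri rh]] := rank_ex h; exists r; split=> // v w nv vw rwv; apply: rh.
apply: proper_card; apply/fintype.properP; split.
  by apply/fintype.subsetP => u /asboolP hu; apply/asboolP; exact: (reach_trans hu rwv).
exists v; first by apply/asboolP; exact: reach_refl.
apply/asboolP => rvw; apply: nv; exact: reach_anti vw rvw rwv.
Qed.

End QuiverOrder.

Lemma transfer_datum_app_bdd (K : fieldType) (R S : pzRingType) (kR : kstr K R)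
    (kS : kstr K S) (B : bimod R S^c) d :
  transfer_datum kR kS B ->
  (forall M : lmodType R, fin_gen M -> (forall (f : {linear bl B -> M}) v, f v = 0) ->
    pdle d M) ->
  app S -> bdd S -> app R /\ bdd R.
Proof.
move=> [[gV pV] [full faith] [gU pU] kact] hker aS bS; split.
  exact: (transfer_app gV pV full faith gU pU kact hker aS).
exact: (transfer_bdd gV pV full pU kact hker bS).
Qed.

(** * Construction of the tilting sequence and its periodicity *)

Section Nonzero.
Variable R : pzRingType.

Lemma coresk_zero (T X : lmodType R) s : is_zero T -> coresk T s X -> is_zero X.
Proof.
move=> T0; have hadd Y : in_add T Y -> is_zero Y.
  move=> /in_addP[n [i [p ip]]] y; rewrite -[y]ip (_ : i y = 0) ?linear0 //.
  by apply/ffunP => j; exact: etrans (T0 _) (esym (T0 _)).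
elim: s X => [|s IH] X; first exact: hadd.
move=> [C [X' [f [g [[fi _ _] aC _]]]]] x.
by apply: (lin_inj0 fi); exact: hadd aC _.
Qed.

Lemma fstrong_nonzero (T : lmodType R) : (1 : R) <> 0 -> fstrong T -> exists t : T, t <> 0.
Proof.
move=> n1 [_ [s cs] _]; apply: contrapT => h; apply: n1.
apply: (coresk_zero _ cs (1 : R^o)) => t; apply: contrapT => nt.
by apply: h; exists t.
Qed.
End Nonzero.

Section EndomorphismAlgebras.
Variable K : fieldType.
Implicit Types A C : algType K.

Lemma iso_End_endalg A (T : lmodType A) (nz : exists t : T, t <> 0) :
  iso_End T (endalg nz).
Proof.
exists (@of_endo K A T nz); split=> //.
- by move=> b h; apply: endalg_ext => t; exact: h.
- by move=> f; exists f.
Qed.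

Lemma iso_End_opK A (T : lmodType A) C : iso_End T C -> iso_End T (C^c : algType K)^c.
Proof. by []. Qed.

Lemma fin_gen_opK A : fin_gen (A^c : lmodType K) -> fin_gen (A : lmodType K).
Proof. by []. Qed.

(** An element of C is determined by its values on generators of T. *)
Lemma bimod_alg_fg A C (B : bimod A C) : fin_gen (A : lmodType K) -> bfaith B ->
  kcompat B -> fin_gen (bl B) -> fin_gen (C : lmodType K).
Proof.
move=> gA faith kB gT; have [n [g gP]] := gT.
have hL : linear (fun b : C => [ffun i => bs (b *: bt (g i))] :
    kmod (kstr_alg gA) ({ffun 'I_n -> bl B} : lmodType A)).
  move=> c b b'; apply/ffunP => i; rewrite [LHS]ffunE kmodZ !ffunE scalerDl bsD.
  congr (_ + _); rewrite -[in LHS](mul1r b) scalerAl -scalerA -{1}(bsK (b *: bt (g i))).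
  exact: kB.
apply: (@noeth_field K _ _ (mklin hL)); last first.
  exact: (fin_gen_kmod (kstr_alg gA) _).1 (fin_gen_ffun n gT).
apply: lin_inj => b e; apply: faith => t; have [c ->] := gP t.
rewrite bt_sum scaler_sumr big1 // => i _.
apply: (can_inj (bsK (b := B))); rewrite btC bs0 (_ : bs _ = 0) ?scaler0 //.
by have := congr1 (fun u : {ffun 'I_n -> bl B} => u i) e; rewrite !ffunE.
Qed.

End EndomorphismAlgebras.

Section Existence.
Variables (K : fieldType) (L : algType K) (gL : fin_gen (L : lmodType K)).
Variables (A : pzRingType) (kA : kstr K A) (V : bimod L A^c) (d : nat).
Hypothesis tV : transfer_datum (kstr_alg gL) kA V.
Hypothesis hker : forall M : lmodType L, fin_gen M ->
  (forall (f : {linear bl V -> M}) v, f v = 0) -> pdle d M.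
Hypotheses (pA : fpd_proj A) (aAc : app A^c) (bAc : bdd A^c) (nL : nodup L).

(** Two tilts are constructed, B from L and G from B, the second by transfer from the opposite of A.
    The third uses the second module seen from G and returns to B, so that B and G alternate from
    there on. *)
Theorem unlimited_existence : unlimited_strong_tilting L.
Proof.
have hL := noeth_kstr (kstr_alg gL).
have [aL bL] := transfer_datum_app_bdd tV hker
  (fpd_proj_app (noeth_kstr kA) pA) (fpd_proj_bdd pA).
have [T0 [s0 sb0]] := fstrong_basic (kstr_alg gL) (app_fstrong (kstr_alg gL) aL bL).
have nz0 := fstrong_nonzero (elimN eqP (oner_neq0 L)) s0.
have [B iso0] : exists B : algType K, iso_End T0 (B^c : algType K).
  by exists ((endalg nz0)^c : algType K); exact: iso_End_opK (iso_End_endalg nz0).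
clear nz0; have [b0 [e0 full0 faith0 k0]] := iso_End_bimod iso0; subst T0.
have gT0 : fin_gen (bl b0) by case: s0 => -[n []].
have gB := bimod_alg_fg gL faith0 k0 gT0.
have nB := strongly_basic_nodup faith0 sb0.
have [C [d' [tC hC]]] := tilt_transfer (kE := kstr_alg gB) tV hker pA full0 faith0 s0 k0.
have [aB bB] := transfer_datum_app_bdd tC hC aAc bAc.
have hB := noeth_kstr (kstr_alg gB).
have [T1 [s1 sb1]] := fstrong_basic (kstr_alg gB) (app_fstrong (kstr_alg gB) aB bB).
have nz1 := fstrong_nonzero (elimN eqP (oner_neq0 (B^c))) s1.
have [G iso1] : exists G : algType K, iso_End T1 G.
  by exists (endalg nz1); exact: iso_End_endalg.
clear nz1; have [b1 [e1 full1 faith1 k1]] := iso_End_bimod iso1; subst T1.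
have gT1 : fin_gen (bl b1) by case: s1 => -[n []].
have gG := bimod_alg_fg gB faith1 k1 gT1.
have nG := strongly_basic_nodup faith1 sb1.
have hG := noeth_kstr (kstr_alg gG).
have s2 := strong_step hL hB hG full0 faith0 full1 faith1 s0 s1.
have full2 := full_bop hB full1 faith1 s1.
have faith2 := faith_bop hB full1 faith1 s1.
have baB : basic_algebra B.
  split; first exact: fin_gen_opK gB.
  by apply: nodup_basic; exact: (nodup_op nB).
have baG : basic_algebra G by split=> //; exact: nodup_basic.
have baL : basic_algebra L by split=> //; exact: nodup_basic.
have tL : strong_tilt_left L B.
  exists (bl b0); split; last exact: (bimod_iso_End full0 faith0 k0).
    exact: nodup_bimod full0 faith0 nB.
  exact/strong_tiltingP.
have tB : strong_tilt_right B G.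
  exists (bl b1); split; last exact: (bimod_iso_End full1 faith1 k1).
    exact: nodup_bimod full1 faith1 nG.
  exact/strong_tiltingP.
have tG : strong_tilt_left G B.
  exists (bl (bop b1)); split; last exact: (bimod_iso_End full2 faith2 (kcompat_bop k1)).
    exact: nodup_bimod full2 faith2 nB.
  exact/strong_tiltingP.
exists (fun i => if odd i then B else if i is 0 then L else G); split=> //.
  by move=> i; case: odd => //; case: i.
by case=> [|i] //=; case: odd.
Qed.

End Existence.

Theorem strong_tilting_periodic (K : fieldType) (L : algType K) (S : nat -> algType K) :
  strong_tilting_sequence L S ->
  forall i : nat, (1 <= i)%N -> morita_equivalent (S i) (S i.+2).
Proof.
move=> [_ bS tS].
(* Odd terms are replaced by their opposites, so that every tilt concerns left modules and an
   endomorphism algebra without reversal. *)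
pose R i : algType K := if odd i then ((S i)^c : algType K) else S i.
have gR i : fin_gen (R i : lmodType K).
  by rewrite /R; case: odd; case: (bS i).
have tR i : exists T : lmodType (R i), strong_tilting T /\ iso_End T (R i.+1).
  have := tS i; rewrite /R /=; case: odd => /= -[T [_ sT iT]]; by exists T.
case=> [//|i] _; have [T0 [s0 i0]] := tR i; have [T1 [s1 i1]] := tR i.+1.
have [T2 [s2 i2]] := tR i.+2.
have := periodic_context (gR _) (gR _) (gR _) (gR _) s0 s1 s2 i0 i1 i2.
rewrite /R /= negbK; case: odd => /=; first exact: morita_context_equivalent.
by move=> /morita_context_op; exact: morita_context_equivalent.
Qed.

(** * The corners at the precyclic and at the critical vertices *)

Section CornerTransfer.
Variables (K : fieldType) (L : pzRingType) (kL : kstr K L) (T : finType).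
Variables (eps : T -> L) (J : L -> Prop) (sb : split_basic kL eps J).
Variables (e e' : Defs.idempotent L) (P P' : {pred T}) (r : T -> nat).
Hypothesis eP : idem_val e = \sum_(v in P) eps v.
Hypothesis eP' : idem_val e' = \sum_(v in P') eps v.
Hypothesis subP : {subset P' <= P}.
Hypothesis epsP : forall x v w, v \in P -> w \notin P -> eps v * x * eps w = 0.
Hypothesis epsP' : forall x v w,
  v \in P -> v \notin P' -> w \in P' -> eps v * x * eps w = 0.
Hypothesis loc : forall x v, v \notin P' ->
  exists c, eps v * x * eps v = kL c * eps v.
Hypothesis rI : injective r.
Hypothesis rR : forall x v w, v \notin P' -> v <> w -> eps v * x * eps w <> 0 ->
  (r w < r v)%N.
Local Notation A := (corner e).
Local Notation F := (corner e').
Local Notation kA := (kstr_corner kL e).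
Local Notation kF := (kstr_corner kL e').

(** [epsP] says that e L (1 - e) = 0, which is the corner condition for V = Le. The other vertices
    are ranked by r, which bounds the projective dimension of the modules killed by e. *)
Lemma outer_transfer : exists (V : bimod L A^c) d, transfer_datum kL kA V /\
  forall M : lmodType L, fin_gen M -> (forall (f : {linear bl V -> M}) u, f u = 0) -> pdle d M.
Proof.
have e_eps x w : w \notin P -> idem_val e * x * eps w = 0.
  by move=> nw; rewrite eP !mulr_suml big1 // => v Pv; exact: epsP.
have sum1 : idem_val e + \sum_(v in predC P) eps v = 1.
  by rewrite eP -(sb_sum sb) [RHS](bigID (fun v => v \in P)).
have eR a : idem_val e * a = idem_val e * a * idem_val e.
  rewrite -[LHS]mulr1 -sum1 mulrDr [X in _ + X]mulr_sumr [X in _ + X]big1 ?addr0 // => v nv.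
  exact: e_eps.
have [||||||V [tV zV]] := @corner_datum K L A kL kA (idem_val e) val (idemP e) eR _ _ _ _ _ _.
- by [].
- by [].
- by [].
- exact: val_inj.
- by move=> a; exists (corner_cut e a).
- exact: kstr_cornerE.
pose r' (i : {v in predC P}) := r (val i).
have r'I : injective r' by move=> i j /rI/val_inj.
exists V, (\max_i r' i).+1; split=> // M gM hM.
have sum1' : idem_val e + \sum_(i : {v in predC P}) eps (val i) = 1.
  by rewrite -sum1 [in RHS]big_sub.
apply: (@acyclic_pd K L kL _ (fun i : {v in predC P} => eps (val i)) (idem_val e) r'
  sum1' _ _ r'I _ _ (\max_i r' i).+1 _ 0%N) => //.
- by move=> i; exact: (sb_idem sb).
- by move=> a i; apply: e_eps; exact: valP i.
- move=> a i j h; case: (pselect (i = j)) => [|ij]; [by left|right].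
  apply: (rR (x := a)) => //; last by move=> /val_inj.
  by apply: contra (valP i); exact: subP.
- by move=> a i; apply: loc; apply: contra (valP i); exact: subP.
- by move=> i; rewrite ltnS; exact: leq_bigmax.
- exact: zV.
Qed.

(** Inside A it is (1 - f) A f that vanishes, f being the unit of F, so the corner condition holds
    for the opposite rings. *)
Lemma inner_transfer : exists (V : bimod A^c F^c^c) d,
  transfer_datum (kstr_op kA) (kstr_op kF) V /\
  forall M : lmodType A^c, fin_gen M -> (forall (f : {linear bl V -> M}) u, f u = 0) -> pdle d M.
Proof.
have eps_e' x v : v \in P -> v \notin P' -> eps v * x * idem_val e' = 0.
  by move=> Pv nv; rewrite eP' mulr_sumr big1 // => w Pw; exact: epsP'.
pose N : {pred T} := [pred v | (v \in P) && (v \notin P')].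
have sumE : idem_val e = idem_val e' + \sum_(v in N) eps v.
  rewrite eP eP' (bigID (fun v => v \in P')) /=; congr (_ + _).
  by apply: eq_bigl => v; rewrite andb_idl //; exact: subP.
have el v : v \in P -> idem_val e * eps v = eps v by case/(corner_eps sb eP).
have er v : v \in P -> eps v * idem_val e = eps v by case/(corner_eps sb eP).
have ee' : idem_val e * idem_val e' = idem_val e'.
  by rewrite eP' mulr_sumr; apply: eq_bigr => v /subP; exact: el.
have e'e : idem_val e' * idem_val e = idem_val e'.
  by rewrite eP' mulr_suml; apply: eq_bigr => v /subP; exact: er.
pose f : A := corner_cut e (idem_val e').
have fE : val f = idem_val e' by rewrite /= ee' e'e.
pose ep (i : {v in N}) : A := corner_cut e (eps (val i)).
have epE i : val (ep i) = eps (val i).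
  by have /andP[Pi _] := valP i; rewrite /= el ?er.
pose sg (y : F) : A := corner_cut e (val y).
have sgE y : val (sg y) = val y.
  have h : idem_val e * val y = val y by rewrite -(corner_idl y) mulrA ee'.
  by rewrite [LHS](_ : _ = idem_val e * val y * idem_val e) // h -(corner_idr y) -mulrA e'e.
have sum1 : f + \sum_i ep i = 1.
  apply: val_inj; rewrite corner_valD corner_val_sum fE corner_val1 sumE; congr (_ + _).
  by rewrite [RHS]big_sub; apply: eq_bigr => i _; exact: epE.
have ep_f i a : ep i * a * f = 0.
  apply: val_inj; rewrite !corner_valM fE epE.
  by have /andP[Pi ni] := valP i; exact: eps_e'.
have fR (a : A) : a * f = f * (a * f).
  rewrite -[LHS]mul1r -sum1 mulrDl mulr_suml [X in _ + X]big1 ?addr0 // => i _.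
  by rewrite mulrA.
have ff : f * f = f by apply: val_inj; rewrite corner_valM fE idemP.
have [||||||V [tV zV]] := @corner_datum K A^c F^c (kstr_op kA) (kstr_op kF) f sg ff fR _ _ _ _ _ _.
- by move=> a b; apply: val_inj; rewrite corner_valD !sgE.
- by move=> a b; apply: val_inj; rewrite corner_valM !sgE.
- by apply: val_inj; exact: etrans (sgE 1) (esym fE).
- by move=> a b h; apply: val_inj; rewrite -!sgE h.
- move=> a; exists (corner_cut e' (val (a : A))); apply: val_inj.
  apply: etrans (sgE _) _.
  change (idem_val e' * val (a : A) * idem_val e' = val f * (val (a : A) * val f)).
  by rewrite fE mulrA.
- move=> c; apply: val_inj; apply: etrans (sgE _) _.
  change (val (kF c) = val f * val (kA c)); rewrite fE !kstr_cornerE.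
  by rewrite mulrA -kioC -mulrA e'e.
(* Passing to the opposite ring reverses arrows, hence the reversed rank. *)
pose m := \max_v r v; pose r' (i : {v in N}) := (m - r (val i))%N.
have rm v : (r v <= m)%N by exact: leq_bigmax.
have r'I : injective r' by move=> i j h; apply/val_inj/rI; rewrite -(subKn (rm _)) -[RHS](subKn (rm _)) -/(r' i) -/(r' j) h.
exists V, m.+1; split=> // M gM hM.
apply: (@acyclic_pd K A^c (kstr_op kA) _ (ep : _ -> A^c) f r'
  sum1 _ _ r'I _ _ m.+1 _ 0%N) => //.
- by move=> i; apply: val_inj; rewrite corner_valM !epE; exact: (sb_idem sb).
- by move=> a i; rewrite -[RHS](ep_f i a) -[RHS]mulrA.
- move=> a i j h; case: (pselect (i = j)) => [|ij]; [by left|right].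
  have h' : eps (val j) * val (a : A) * eps (val i) <> 0.
    by move=> h0; apply: h; apply: val_inj; rewrite corner_valM corner_valM !epE mulrA.
  have /andP[_ nj] := valP j.
  have lt := rR nj (fun ji => ij (val_inj (esym ji))) h'.
  by rewrite /r' ltn_sub2l // (leq_trans lt).
- move=> a i; have /andP[Pi ni] := valP i.
  have [c cE] := loc (val (a : A)) ni; exists c; apply: val_inj.
  transitivity (eps (val i) * (val (a : A) * eps (val i))).
    by rewrite -!epE.
  rewrite mulrA cE (_ : val _ = val (ep i) * val (kA c)) // epE kstr_cornerE.
  by rewrite mulrA -kioC -mulrA er.
- by move=> i; rewrite ltnS leq_subr.
- exact: zV.
Qed.

End CornerTransfer.

Theorem proposition6p2 (K : fieldType) (Q : quiver) (I : admissible_ideal K Q)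
    (e := vertex_idempotent I (@precyclic Q))
    (e' := vertex_idempotent I (@critical Q))
    (h_proj : same_loewy_length (@indec_projective (corner e)))
    (h_inj : same_loewy_length (@indec_injective (corner e'))) :
  unlimited_strong_tilting (pathquot I) /\
  forall S : nat -> algType K, strong_tilting_sequence (pathquot I) S ->
    forall i : nat, (1 <= i)%N -> morita_equivalent (S i) (S i.+2).
Proof.
split; last exact: strong_tilting_periodic.
have sb := pathquot_split_basic I.
pose P : {pred vertex Q} := [pred v | `[< precyclic v >]].
pose P' : {pred vertex Q} := [pred v | `[< critical v >]].
have eP : idem_val e = \sum_(v in P) qvidem I v by [].
have eP' : idem_val e' = \sum_(v in P') qvidem I v by [].
have subP : {subset P' <= P} by move=> v /asboolP[pv _]; exact/asboolP.
have epsP (x : pathquot I) v w : v \in P -> w \notin P -> qvidem I v * x * qvidem I w = 0.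
  move=> /asboolP pv /asboolP nw; apply: contrapT => /qvidem_path r; apply: nw.
  exact: precyclic_reach r pv.
have epsP' (x : pathquot I) v w :
    v \in P -> v \notin P' -> w \in P' -> qvidem I v * x * qvidem I w = 0.
  move=> /asboolP pv /asboolP nv /asboolP[_ qw]; apply: contrapT => /qvidem_path r.
  by apply: nv; split=> //; exact: postcyclic_reach r qw.
have loc (x : pathquot I) v : v \notin P' ->
    exists c, qvidem I v * x * qvidem I v = kstr_alg (pathquot_fg I) c * qvidem I v.
  move=> /asboolP nv; have [p ps pe|c ->] := @qvidem_local K Q I v x.
    by apply: contrapT => p0; apply: nv; exact: closed_path_critical ps pe p0.
  by exists c; rewrite kstr_algE -scalerAl mul1r.
have [r [rI rR']] := reach_rank Q.
have rR (x : pathquot I) v w : v \notin P' -> v <> w ->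
    qvidem I v * x * qvidem I w <> 0 -> (r w < r v)%N.
  by move=> /asboolP nv vw /qvidem_path; exact: rR'.
have sbA := split_basic_corner sb eP; have [l el] := proj_equiloewy sbA h_proj.
have pA := equiloewy_fpd_proj sbA el.
have sbF := split_basic_corner sb eP'; have [l' el'] := inj_equiloewy sbF h_inj.
have pF := equiloewy_fpd_proj (split_basic_op sbF) el'.
have hF := noeth_kstr (kstr_op (kstr_corner (kstr_alg (pathquot_fg I)) e')).
have [V [d [tV hV]]] := outer_transfer sb eP subP epsP loc rI rR.
have [W [d' [tW hW]]] := inner_transfer sb eP eP' subP epsP' loc rI rR.
(* The opposite of A inherits approximations and the bound from the opposite of F; these serve the
   second tilt, as [pA] serves the first. *)
have [aA bA] := transfer_datum_app_bdd tW hW (fpd_proj_app hF pF) (fpd_proj_bdd pF).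
exact: unlimited_existence tV hV pA aA bA (split_basic_nodup sb).
Qed.
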